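(* The following decision problem is undecidable (i.e., there is no algorithm that, on every input, halts and correctly answers it). Input: a set $S$ of $4$ polycubes in $\mathbb{Z}^3$. Question: can $\mathbb{Z}^3$ be tiled by translated copies of tiles in $S$?
   Context: A tile in $\mathbb{Z}^n$ is a finite (non-empty) subset of $\mathbb{Z}^n$. Identifying $z\in\mathbb{Z}^n$ with the unit hypercube $\prod_{i=1}^n [z_i,z_i+1]\subset\mathbb{R}^n$, a tile is equivalently a finite union of such unit hypercubes, and tiling $\mathbb{Z}^n$ corresponds to tiling $\mathbb{R}^n$ by unions of unit hypercubes. A polycube in $\mathbb{Z}^3$ is a connected tile: a finite non-empty set $P\subset\mathbb{Z}^3$ such that any two of its points are joined by a path in $P$ whose consecutive points differ by $\pm$ a standard basis vector (i.e., the corresponding unit cubes are joined face-to-face). Given a finite set $S$ of tiles in $\mathbb{Z}^n$, one says that $\mathbb{Z}^n$ can be tiled by translated copies of tiles in $S$ if there is a family of sets of the form $P+v$ with $P\in S$ and $v\in\mathbb{Z}^n$ that are pairwise disjoint and whose union is $\mathbb{Z}^n$. Only translations are allowed (no rotations or reflections), and not every tile of $S$ is required to be used. The input $S$ is given by explicitly listing the finitely many elements of each tile; the dimension and the number of tiles are fixed. *)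

(* Defs.v *)
From HB Require Import structures.
From mathcomp Require Import all_boot all_order all_algebra finmap.
From mathcomp Require Import boolp classical_sets.

Set Implicit Arguments.
Unset Strict Implicit.
Unset Printing Implicit Defensive.

Import GRing.Theory.

Local Open Scope fset_scope.
Local Open Scope classical_set_scope.
Local Open Scope ring_scope.

Definition adjacent n (u v : 'rV[int]_n) : bool :=
  [exists i, (v == u + delta_mx 0 i) || (v == u - delta_mx 0 i)].

Definition tile n (P : {fset 'rV[int]_n}) : Prop := P != fset0.

Definition connected n (P : {fset 'rV[int]_n}) : Prop :=
  forall x y, x \in P -> y \in P ->
    exists s : seq 'rV[int]_n,
      [/\ all (fun z => z \in P) s, path (@adjacent n) x s & last x s = y].

Definition polycube (P : {fset 'rV[int]_3}) : Prop := tile P /\ connected P.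

Definition translate n (P : {fset 'rV[int]_n}) (v : 'rV[int]_n) :
  set 'rV[int]_n := [set x + v | x in [set` P]].

Definition tileable n (S : {fset {fset 'rV[int]_n}}) : Prop :=
  exists F : set (set 'rV[int]_n),
    [/\ forall A, F A -> exists P v, P \in S /\ A = translate P v,
        forall A B, F A -> F B -> A <> B -> A `&` B = set0
      & \bigcup_(A in F) A = setT].

(* Partial recursive functions of any number of arguments.  Programs carry no
   arity: on an argument list that is too short, [RSucc], [RProj] and [RPrim]
   are undefined.  [RMu f] searches for a zero in the first argument of [f]. *)
Inductive recfun : Type :=
| RZero
| RSucc
| RProj of nat
| RComp of recfun & seq recfun
| RPrim of recfun & recfun
| RMu of recfun.

(* [eval p s y]: the program [p] halts on the arguments [s] with output [y]. *)
Inductive eval : recfun -> seq nat -> nat -> Prop :=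
| eval_zero s : eval RZero s 0%N
| eval_succ x s : eval RSucc (x :: s) x.+1
| eval_proj i s : (i < size s)%N -> eval (RProj i) s (nth 0%N s i)
| eval_comp f gs s ys y :
    evals gs s ys -> eval f ys y -> eval (RComp f gs) s y
| eval_prim0 f g s y : eval f s y -> eval (RPrim f g) (0%N :: s) y
| eval_primS f g n s r y :
    eval (RPrim f g) (n :: s) r -> eval g (n :: r :: s) y ->
    eval (RPrim f g) (n.+1 :: s) y
| eval_mu f s n (v : nat -> nat) :
    (forall m, (m < n)%N -> eval f (m :: s) (v m).+1) ->
    eval f (n :: s) 0%N -> eval (RMu f) s n
with evals : seq recfun -> seq nat -> seq nat -> Prop :=
| evals_nil s : evals [::] s [::]
| evals_cons g gs s y ys :
    eval g s y -> evals gs s ys -> evals (g :: gs) s (y :: ys).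

(* A decision problem has instances [x : I] with [inst x], each presented to
   the algorithm by any number [w] with [code x w], and asks whether
   [question x].  The answers "yes" and "no" are the outputs 1 and 0; nothing
   is required of the algorithm on numbers that present no instance. *)
Definition decidable_problem (I : Type) (code : I -> nat -> Prop)
    (inst question : I -> Prop) : Prop :=
  exists p : recfun, forall x w, inst x -> code x w ->
    exists b : bool, eval p [:: w] b /\ (b <-> question x).

Definition undecidable_problem (I : Type) (code : I -> nat -> Prop)
    (inst question : I -> Prop) : Prop :=
  ~ decidable_problem code inst question.

(* [CodeSeq.code] is the bijection from [seq nat] to [nat] with
   [code [::] = 0] and [code (n :: s) = 2 ^ n * (2 * code s + 1)]. *)

Definition int_code (z : int) : nat :=
  match z with Posz n => n.*2 | Negz n => n.*2.+1 end.

Definition point_code n (v : 'rV[int]_n) : nat :=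
  CodeSeq.code [seq int_code (v 0 i) | i <- enum 'I_n].

Definition listing_code n (L : seq (seq 'rV[int]_n)) : nat :=
  CodeSeq.code [seq CodeSeq.code [seq point_code v | v <- s] | s <- L].

(* [w] codes a list that enumerates each tile of [S] exactly once, by listing
   each of its points exactly once, in an arbitrary order. *)
Definition tileset_code n (S : {fset {fset 'rV[int]_n}}) (w : nat) : Prop :=
  exists L : seq (seq 'rV[int]_n),
    [/\ all uniq L, perm_eq [seq [fset v in s] | s <- L] S
      & w = listing_code L].

Definition four_polycubes (S : {fset {fset 'rV[int]_3}}) : Prop :=
  #|` S| = 4%N /\ forall P, P \in S -> polycube P.

(* Main.v *)
Require Import Defs.
From mathcomp Require Import all_boot all_order all_algebra finmap.
From mathcomp Require Import boolp classical_sets zify.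
Set Implicit Arguments.
Unset Strict Implicit.
Unset Printing Implicit Defensive.
Import GRing.Theory Num.Theory.

(** A program [g] on input [e] is simulated by labellings of the quadrant: its
    space-time diagram, registers in unary along one axis and time along the
    other, obeys a local rule [e], and stopping with output 1 violates the rule.
    Taking for [g] a decider of the tiling problem composed with the tile set
    below, and for [e] its own rule, gives a contradiction.

    The quadrant is embedded in the plane by nearest-neighbour rules alone.  For
    p = 2, 3 a cell (i,k) carries a comparison of the p-adic valuations of the
    column i and the row k (up to translations); the rules force these comparisons
    by induction on the valuation, since the columns not skipped by a row of
    valuation c are those of valuation at least c - 1, and counting them modulo
    p^3 isolates the next two levels.  A column of valuations (a,b) holds the label
    L(a,b), a row the labels L(a,b), L(a+1,b), L(a,b+1), and equality is demanded
    where the comparisons identify the two.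

    The plane system is turned into tiles of height N: an encoder, a pillar, and a
    ring filling holes.  Ridges and slots of their cross-sections force a planar
    lattice of vertical stacks, and cell (i,j) has colour u when its encoder is
    shifted by 3 * 2^u against the pillars.  Bumps of an encoder fit in dents of
    the neighbouring stacks only when the two shifts differ by an allowed
    3 * (2^u - 2^u'); distinct powers of 2 being determined by their difference,
    this expresses the adjacency relations.  The fourth tile is a translate of the
    ring. *)

(** Valuations are unbounded and symbols finite, so a cell stores only how two valuations compare,
    up to one step. This lets a row of levels (a,b) recognise the columns of levels (a,b), (a+1,b)
    and (a,b+1). Such columns may be far apart, but the row crosses all of them; carrying their
    three labels, it can check the rule of the quadrant inside one cell. Two primes give two
    independent coordinates, and by the Chinese remainder theorem every pair of levels occurs. In
    space an encoder only reveals the difference between its shift and that of a neighbour, modulo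
    the height. The pillars supply a common origin: two pillars touching the same two encoders must
    be level with each other, because a difference of distinct powers of 2 determines both powers.
    This needs neighbours of different colours, which the residues in every symbol guarantee. The
    same inequality keeps dents away from height 0, so adjacent encoder stacks are never level, and
    this is what forces each stack to continue without gaps. The program affects only the height and
    the dents, never the dimension or the number of tiles. *)

(** * Aperiodic rulers *)

(* The p-adic valuation truncated at 2, read off a residue modulo p^2. *)
Definition level p z := if ~~ (p %| z) then 0 else if ~~ (p ^ 2 %| z) then 1 else 2.

(* 1 to 5 locate [a - b] among <= -2, -1, 0, 1, >= 2; the code 0 is kept for
   two infinite valuations. *)
Definition cmp_code a b :=
  if a.+1 < b then 1 else if a < b then 2 else if a == b then 3
  else if a == b.+1 then 4 else 5.

Definition flip t := if t == 0 then 0 else 6 - t.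

Lemma flip_cmp a b : flip (cmp_code a b) = cmp_code b a.
Proof.
rewrite /cmp_code.
case: (ltnP a.+1 b) => h1; case: (ltnP a b) => h2; case: (eqVneq a b) => h3;
case: (eqVneq a b.+1) => h4; case: (ltnP b.+1 a) => h5; case: (ltnP b a) => h6;
case: (eqVneq b a) => h7; case: (eqVneq b a.+1) => h8; rewrite ?/flip //=; lia.
Qed.

Definition skipped t := t <= 1.

Lemma skipped_cmp a b : skipped (cmp_code a b) = (a.+1 < b).
Proof.
rewrite /cmp_code; case: (ltnP a.+1 b) => // h1.
by case: (ltnP a b) => // h2; case: (eqVneq a b) => // h3; case: eqP.
Qed.

(** In a row of valuation b > 0, [f] numbers the columns of valuation at least b - 1. The value is
    then the [cmp_code] of column and row: it starts at 2 for valuation b - 1, and each factor p of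
    [f] raises it by one, up to 5. *)
Definition phase_code p f :=
  if ~~ (p %| f) then 2 else if ~~ (p ^ 2 %| f) then 3
  else if ~~ (p ^ 3 %| f) then 4 else 5.

(** A comparison with valuation 0 can be read off the truncated residues. In the other rows a
    counted column gets the code of its number, and where the valuations agree the unit part of the
    column must be that number divided by p; this ties together all rows of equal valuation. *)
Definition half_rule p zl zc gc t f :=
  [&& (level p zl != 0) && (level p zc != 0)
        || (t == cmp_code (level p zc) (level p zl)),
      [|| skipped t, ~~ (p %| zl) | t == phase_code p f] &
      [|| t != 3, ~~ (p %| zl) | gc == f %/ p]].

(* [zc], [zl]: residues of columns and rows; [gc]: unit part of a column; [t]:
   comparison of column and row; [f]: non-skipped columns of a row, counted
   modulo p^3. *)
Record half_ruler p (zl zc gc : int -> nat) (t f : int -> int -> nat) : Prop :=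
  HalfRuler {
    hr_step : forall i, zc (i + 1)%R = (zc i).+1 %% p ^ 2;
    hr_bound : forall i, zc i < p ^ 2;
    hr_cell : forall i k, half_rule p (zl k) (zc i) (gc i) (t i k) (f i k);
    hr_fbound : forall i k, f i k < p ^ 3;
    hr_phase : forall i k, f (i + 1)%R k = (f i k + ~~ skipped (t (i + 1)%R k)) %% p ^ 3 }.

(** Neither direction suffices alone: on cells with equal valuations one bounds the code from below
    and the other from above, see [zeros_known]. *)
Definition ruler p (zc gc zr gr : int -> nat) (t f s : int -> int -> nat) : Prop :=
  half_ruler p zr zc gc t f /\
  half_ruler p zc zr gr (fun k i => flip (t i k)) (fun k i => s i k).

Definition dvd_pow (p c : nat) (d : int) : bool := ((p ^ c)%:Z %| d)%Z.

(** Only columns of valuation at least that of the row are covered; the rest is the same predicate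
    for the flipped codes. The centres [A] and [B] matter modulo p^(c+1) only. *)
Definition known p c (t : int -> int -> nat) (A B : int) : Prop :=
  forall a i k, a < c -> dvd_pow p a (k - B) -> ~~ dvd_pow p a.+1 (k - B) ->
    dvd_pow p a (i - A) ->
    t i k = if dvd_pow p a.+2 (i - A) then 5 else if dvd_pow p a.+1 (i - A) then 4 else 3.

(** * The counter along one row *)

Section OneDim.
Variables (p : nat) (p_gt1 : 1 < p) (u v : int -> nat).
Hypothesis vb : forall m, v m < p ^ 3.
Hypothesis vS : forall m, v (m + 1)%R = (v m + ~~ skipped (u (m + 1)%R)) %% p ^ 3.
Hypothesis uE : forall m, ~~ skipped (u m) -> u m = phase_code p (v m).

Lemma dvdn_pow3 : p %| p ^ 3. Proof. by rewrite dvdn_exp. Qed.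

Lemma phase_run m (j : nat) :
  (forall l : nat, 0 < l <= j -> ~~ skipped (u (m + l%:Z)%R)) ->
  v (m + j%:Z)%R = (v m + j) %% p ^ 3.
Proof.
elim: j => [|j IH] H; first by rewrite addr0 addn0 modn_small.
have -> : (m + j.+1%:Z = m + j%:Z + 1)%R by lia.
rewrite vS IH; last by move=> l hl; apply: H; lia.
have -> : (m + j%:Z + 1 = m + j.+1%:Z)%R by lia.
by rewrite H ?leqnn // modnDml addn1 addnS.
Qed.

(** Otherwise the counter, advancing by one at each of the next p - 1 places, would meet a multiple
    of p there. *)
Lemma phase_dvd m :
  (forall l : nat, 0 < l < p -> ~~ skipped (u (m + l%:Z)%R)) ->
  (forall l : nat, 0 < l < p -> ~~ (p %| v (m + l%:Z)%R)) ->
  p %| v m.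
Proof.
move=> H1 H2; apply/negPn/negP => nd.
have h : 0 < p - v m %% p < p.
  by rewrite subn_gt0 ltn_pmod ?(ltnW p_gt1) //= ltn_subrL lt0n nd ltnW.
have := H2 _ h; rewrite phase_run; last by move=> l hl; apply: H1; lia.
rewrite /dvdn modn_dvdm ?dvdn_pow3 // {1}(divn_eq (v m) p).
have := ltn_pmod (v m) (ltnW p_gt1).
move=> hh; rewrite -addnA subnKC ?(ltnW hh) // -mulSnr.
by rewrite modnMl.
Qed.

(** The p - 1 places with code 2 between two multiples of p are counted and their phases are not
    divisible by p, so the phases at the multiples are. A skipped multiple would have phase p - 1
    modulo p. *)
Lemma phase_blocks :
  (forall m, ~~ (p%:Z %| m)%Z -> u m = 2) ->
  forall n, [/\ ~~ skipped (u (p%:Z * n)%R), p %| v (p%:Z * n)%R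
   & v (p%:Z * (n + 1))%R = (v (p%:Z * n)%R + p) %% p ^ 3].
Proof.
move=> H.
have nd n (l : nat) : 0 < l < p -> ~~ (p%:Z %| (p%:Z * n + l%:Z)%R)%Z.
  move=> hl; rewrite rpredDl ?dvdz_mulr // dvdzE /=.
  by apply/negP => /dvdn_leq; lia.
have ns n (l : nat) : 0 < l < p -> ~~ skipped (u (p%:Z * n + l%:Z)%R).
  by move=> hl; rewrite H // nd.
have dv n : p %| v (p%:Z * n)%R.
  apply: phase_dvd => l hl; first exact: ns.
  have := uE (ns n l hl); rewrite (H _ (nd n l hl)) /phase_code.
  by case: (p %| _) => //=; case: ifP => // _; case: ifP.
have ns0 n : ~~ skipped (u (p%:Z * (n + 1))%R).
  apply/negP => hs; have := dv (n + 1)%R.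
  have e : (p%:Z * (n + 1) = p%:Z * n + p.-1%:Z + 1)%R by lia.
  move: (vS (p%:Z * n + p.-1%:Z)); rewrite -e hs addn0 => ->.
  rewrite phase_run; last by move=> l hl; apply: ns; lia.
  rewrite modn_mod /dvdn modn_dvdm ?dvdn_pow3 //.
  have /dvdnP [q ->] := dv n; rewrite modnMDl modn_small; lia.
move=> n; split => //.
  by have := ns0 (n - 1)%R; rewrite subrK.
have -> : (p%:Z * (n + 1) = p%:Z * n + p%:Z)%R by lia.
rewrite phase_run // => l /andP [l0]; rewrite leq_eqVlt => /orP [/eqP ->|hl].
  by have := ns0 n; rewrite mulrDr mulr1.
by apply: ns; rewrite l0.
Qed.

End OneDim.

Lemma int_ind2 (P : int -> Prop) m0 :
  P m0 -> (forall m, P m <-> P (m + 1)%R) -> forall m, P m.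
Proof.
move=> h0 hS.
have up (n : nat) : P (m0 + n%:Z)%R.
  elim: n => [|n IH]; first by rewrite addr0.
  have -> : (m0 + n.+1%:Z = m0 + n%:Z + 1)%R by lia.
  by apply/(hS _).1.
have dn (n : nat) : P (m0 - n%:Z)%R.
  elim: n => [|n IH]; first by rewrite subr0.
  apply/hS; by have -> : (m0 - n.+1%:Z + 1 = m0 - n%:Z)%R by lia.
move=> m; have [h|h] := lerP m0 m.
  have -> : m = (m0 + `|m - m0|%N%:Z)%R by lia. exact: up.
have -> : m = (m0 - `|m - m0|%N%:Z)%R by lia. exact: dn.
Qed.

(** * From valuations up to c to valuation c + 1, in one row *)

Section RulerStep.
Variables (p : nat) (p_gt1 : 1 < p).

Lemma dvd_powW (a b : nat) d : a <= b -> dvd_pow p b d -> dvd_pow p a d.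
Proof. by move=> ab; apply: dvdz_trans; rewrite dvdzE /= dvdn_exp2l. Qed.

Lemma dvd_pow0 d : dvd_pow p 0 d.
Proof. by rewrite /dvd_pow expn0 dvd1z. Qed.

Lemma exact_level e d : ~~ dvd_pow p e d ->
  exists a, [/\ a < e, dvd_pow p a d & ~~ dvd_pow p a.+1 d].
Proof.
elim: e => [|e IH]; first by rewrite dvd_pow0.
case: (boolP (dvd_pow p e d)) => [h1 h2|h _]; first by exists e; split.
by have [a [h1 h2 h3]] := IH h; exists a; split => //; lia.
Qed.

Variables (zl zc gc : int -> nat) (t f : int -> int -> nat).
Hypothesis hr : half_ruler p zl zc gc t f.
Variables (c : nat) (A B k : int).
Hypothesis kn : known p c.+1 (fun k i => flip (t i k)) B A.
Hypothesis (hk : dvd_pow p c.+1 (k - B)) (hk' : ~~ dvd_pow p c.+2 (k - B)).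
Hypothesis pzl : p %| zl k.

Lemma flip_eq t0 n : 0 < n -> flip t0 = n -> t0 = 6 - n.
Proof. by rewrite /flip; case: eqP => [->|_]; lia. Qed.

(** The row is read only at columns of valuation at least c, the others being skipped;
    [phase_blocks] applies to this subsequence. *)
Let q : int := Posz (p ^ c).
Let u m := t (A + q * m)%R k.
Let v m := f (A + q * m)%R k.

Lemma q_gt0 : (0 < q)%R.
Proof. by rewrite /q; have : 0 < p ^ c by rewrite expn_gt0 ltnW. Qed.

(** The transposed knowledge applies to a column of valuation a < c: the row, of valuation c + 1,
    exceeds it by at least 2, so the flipped code is 5 and the code is 1. *)
Lemma row_skips i : ~~ dvd_pow p c (i - A) -> skipped (t i k).
Proof.
move=> /exact_level [a [ac h1 h2]].
have ac1 : a < c.+1 by exact: ltnW.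
have := kn ac1 h1 h2 (dvd_powW (ltnW ac1) hk).
by rewrite (dvd_powW _ hk) // => /flip_eq ->.
Qed.

Lemma row_gap m (l : nat) : (l%:Z < q)%R -> f (A + q * m + l%:Z)%R k = v m.
Proof.
elim: l => [|l IH] hl; first by rewrite addr0.
have -> : (A + q * m + l.+1%:Z = A + q * m + l%:Z + 1)%R by lia.
rewrite (hr_phase hr) IH; last by lia.
rewrite row_skips ?addn0 ?modn_small ?(hr_fbound hr) //.
rewrite /dvd_pow -/q.
have -> : (A + q * m + l%:Z + 1 - A = q * m + l.+1%:Z)%R by lia.
rewrite rpredDl ?dvdz_mulr // dvdzE /=; apply/negP => /dvdn_leq; move: hl; rewrite /q; lia.
Qed.

Lemma row_vS m : v (m + 1)%R = (v m + ~~ skipped (u (m + 1)%R)) %% p ^ 3.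
Proof.
have q0 := q_gt0.
rewrite -(@row_gap m (p ^ c).-1); last by rewrite /q; lia.
rewrite /u; have -> : (A + q * (m + 1) = A + q * m + (p ^ c).-1%:Z + 1)%R.
  by rewrite /q in q0 *; lia.
rewrite -(hr_phase hr); congr f; rewrite /q in q0 *; lia.
Qed.

Lemma row_uE m : ~~ skipped (u m) -> u m = phase_code p (v m).
Proof.
have /and3P [_ h _] := hr_cell hr (A + q * m)%R k.
by move: h; rewrite pzl -/(u m) /= => /orP [->|/eqP].
Qed.

Lemma row_u2 m : ~~ (p%:Z %| m)%Z -> u m = 2.
Proof.
move=> pm.
have h1 : dvd_pow p c (A + q * m - A) by rewrite [(A + _)%R]addrC addrK /dvd_pow -/q dvdz_mulr.
have h2 : ~~ dvd_pow p c.+1 (A + q * m - A).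
  rewrite [(A + _)%R]addrC addrK /dvd_pow expnSr PoszM -/q dvdz_mul2l //.
  by have := q_gt0; lia.
have := kn (ltnSn c) h1 h2 (dvd_powW (leqnSn c) hk).
by rewrite (negbTE hk') hk => /flip_eq; apply.
Qed.

Lemma row_blocks i : dvd_pow p c.+1 (i - A) ->
  [/\ ~~ skipped (t i k), p %| f i k & t i k = phase_code p (f i k)].
Proof.
move=> /dvdzP [n hn].
have vb m : v m < p ^ 3 by exact: (hr_fbound hr).
have [h1 h2 _] := phase_blocks p_gt1 vb row_vS row_uE row_u2 n.
have e : (A + q * (p%:Z * n) = i)%R by move: hn; rewrite expnSr PoszM -/q; lia.
have := row_uE h1; move: h1 h2; rewrite /u /v e; split => //.
Qed.

Lemma row_codes i : dvd_pow p c.+1 (i - A) -> 3 <= t i k <= 5.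
Proof.
move=> /row_blocks [_ h ->]; rewrite /phase_code h /=.
by case: ifP => //; case: ifP.
Qed.

Hypothesis zeros : forall i, dvd_pow p c.+1 (i - A) -> ~~ dvd_pow p c.+2 (i - A) -> t i k = 3.

Let pc : int := Posz (p ^ c.+1).
(** The index at which the counter [eta] vanishes modulo p^2, computed backwards from index 1, where
    [eta1] equates the counter with the unit part of the column. No row occurs in it, so all rows of
    this valuation agree on the next centre. *)
Let n0 : int := (1 - (gc (A + pc))%:Z)%R.
Let eta n := (f (A + pc * n)%R k) %/ p.

Lemma pc_gt0 : (0 < pc)%R.
Proof. by rewrite /pc; have : 0 < p ^ c.+1 by rewrite expn_gt0 ltnW. Qed.

Lemma dvd_pc j n : dvd_pow p (c.+1 + j) (pc * n) = dvd_pow p j n.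
Proof. by rewrite /dvd_pow expnD PoszM -/pc dvdz_mul2l //; have := pc_gt0; lia. Qed.

Lemma at_pc n : dvd_pow p c.+1 (A + pc * n - A).
Proof. by rewrite [(A + _)%R]addrC addrK -[X in dvd_pow p X]addn0 dvd_pc dvd_pow0. Qed.

Lemma f_eta n : f (A + pc * n)%R k = p * eta n.
Proof. by have [_ /dvdnP [r hr' ] _] := row_blocks (at_pc n); rewrite /eta hr' mulnK ?(ltnW p_gt1) // mulnC. Qed.

Lemma eta_S n : eta (n + 1)%R = (eta n).+1 %% p ^ 2.
Proof.
have vb m : v m < p ^ 3 by exact: (hr_fbound hr).
have [_ _] := phase_blocks p_gt1 vb row_vS row_uE row_u2 n.
have e x : (A + q * (p%:Z * x) = A + pc * x)%R by rewrite /pc expnSr PoszM -/q; lia.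
rewrite /v !e !f_eta -mulnSr (expnS _ 2) -muln_modr => /eqP.
by rewrite eqn_pmul2l ?(ltnW p_gt1) // => /eqP.
Qed.

Lemma t_eta n : t (A + pc * n)%R k =
  if ~~ (p %| eta n) then 3 else if ~~ (p ^ 2 %| eta n) then 4 else 5.
Proof.
have [_ _ ->] := row_blocks (at_pc n).
rewrite /phase_code f_eta dvdn_mulr //= !(expnS p 2) expnS expn1 !dvdn_pmul2l ?(ltnW p_gt1) //.
Qed.

Lemma zero_eta n : ~~ (p%:Z %| n)%Z -> t (A + pc * n)%R k = 3.
Proof.
move=> h; apply: zeros; first exact: at_pc.
by rewrite [(A + _)%R]addrC addrK -addn1 dvd_pc /dvd_pow expn1.
Qed.

Lemma eta1 : eta 1%R = gc (A + pc).
Proof.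
have e : t (A + pc * 1)%R k = 3 by apply: zero_eta; rewrite dvdz1; lia.
have /and3P [_ _] := hr_cell hr (A + pc * 1)%R k.
by rewrite e pzl /= mulr1 /eta mulr1 => /eqP ->.
Qed.

Lemma eta_mod n : dvd_pow p 2 (Posz (eta n) - (n - n0)).
Proof.
move: n; apply: (@int_ind2 (fun n => dvd_pow p 2 (Posz (eta n) - (n - n0))) 1%R) => [|n].
  rewrite eta1 /n0; set g := Posz _.
  by have -> : (g - (1 - (1 - g)) = 0)%R; [lia | exact: dvdz0].
rewrite eta_S.
have := divn_eq (eta n).+1 (p ^ 2) => e.
have -> : (Posz (eta n) - (n - n0) = (Posz ((eta n).+1 %% p ^ 2) - (n + 1 - n0)) +
  Posz ((eta n).+1 %/ p ^ 2) * Posz (p ^ 2))%R by rewrite -PoszM; lia.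
by rewrite /dvd_pow rpredDr ?dvdz_mull.
Qed.

Lemma eta_dvd j n : j <= 2 -> (p ^ j %| eta n) = dvd_pow p j (n - n0).
Proof.
move=> hj.
have h : dvd_pow p j (Posz (eta n) - (n - n0)) by apply: (dvd_powW hj); exact: eta_mod.
have -> : (p ^ j %| eta n) = dvd_pow p j (Posz (eta n)) by rewrite /dvd_pow dvdzE.
by rewrite -[Posz (eta n)](subrK (n - n0)%R) /dvd_pow rpredDl.
Qed.

(** At index [n0] the code is 5, whereas [zero_eta] gives 3 at every index not divisible by p. *)
Lemma n0_dvd : (p%:Z %| n0)%Z.
Proof.
apply/negPn/negP => nd; have := zero_eta nd.
rewrite t_eta -{1}[p]expn1 !eta_dvd // subrr /dvd_pow !dvdz0.
by [].
Qed.

Lemma row_known i : dvd_pow p c.+1 (i - A) ->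
  t i k = if dvd_pow p c.+3 (i - (A + pc * n0)) then 5
          else if dvd_pow p c.+2 (i - (A + pc * n0)) then 4 else 3.
Proof.
move=> /dvdzP [n hn].
have -> : i = (A + pc * n)%R by rewrite -(subrK A i) hn /pc mulrC addrC.
have -> : (A + pc * n - (A + pc * n0) = pc * (n - n0))%R by lia.
rewrite -[c.+3]addn2 -[c.+2]addn1 !dvd_pc -!eta_dvd // t_eta expn1.
case: (boolP (p ^ 2 %| eta n)) => [h2|_] /=; last by case: (p %| eta n).
by rewrite (dvdn_trans _ h2) // -{1}[p]expn1 dvdn_exp2l.
Qed.

End RulerStep.

Definition tracks p (zc : int -> nat) (A : int) : Prop :=
  forall i, dvd_pow p 2 (Posz (zc i) - (i - A)).

Definition ruled p (zc zr : int -> nat) (t : int -> int -> nat) c (A B : int) : Prop :=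
  [/\ known p c.+1 t A B, known p c.+1 (fun k i => flip (t i k)) B A,
      tracks p zc A & tracks p zr B].

Section RulerInd.
Variables (p : nat) (p_gt1 : 1 < p).

Lemma tracks_dvd zc A j i : tracks p zc A -> j <= 2 ->
  (p ^ j %| zc i) = dvd_pow p j (i - A).
Proof.
move=> /(_ i) h hj; have {}h := dvd_powW hj h.
have -> : (p ^ j %| zc i) = dvd_pow p j (Posz (zc i)) by rewrite /dvd_pow dvdzE.
by rewrite -[Posz (zc i)](subrK (i - A)%R) /dvd_pow rpredDl.
Qed.

Lemma dvd_pow_eqmod c j A A' i : dvd_pow p c (A - A') -> j <= c ->
  dvd_pow p j (i - A') = dvd_pow p j (i - A).
Proof.
move=> h hj; have -> : (i - A' = (i - A) + (A - A'))%R by lia.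
by rewrite /dvd_pow rpredDr //; exact: (dvd_powW hj h).
Qed.

Lemma tracks_eqmod zc A A' c : tracks p zc A -> 2 <= c -> dvd_pow p c (A - A') -> tracks p zc A'.
Proof.
move=> h hc hA i.
have -> : (Posz (zc i) - (i - A') = (Posz (zc i) - (i - A)) - (A - A'))%R by lia.
by rewrite /dvd_pow rpredB //; [exact: h|exact: (dvd_powW hc)].
Qed.

Lemma known_eqmod c t A A' B B' : known p c t A B ->
  dvd_pow p c.+1 (A - A') -> dvd_pow p c.+1 (B - B') -> known p c t A' B'.
Proof.
move=> h hA hB a i k ac.
rewrite !(dvd_pow_eqmod _ hA) ?(dvd_pow_eqmod _ hB) //; try lia.
exact: h.
Qed.

(** [A'] is the centre found by [row_known], common to all rows of valuation c + 1. It differs from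
    [A] by a multiple of p^(c+2), which leaves the earlier levels intact. *)
Lemma known_step zl zc gc t f c A B :
  half_ruler p zl zc gc t f -> ruled p zc zl t c A B ->
  (forall i k, dvd_pow p c.+1 (i - A) -> ~~ dvd_pow p c.+2 (i - A) ->
     dvd_pow p c.+1 (k - B) -> ~~ dvd_pow p c.+2 (k - B) -> t i k = 3) ->
  let A' := (A + Posz (p ^ c.+1) * (1 - Posz (gc (A + Posz (p ^ c.+1)))))%R in
  dvd_pow p c.+2 (A - A') /\
  (forall B', dvd_pow p c.+2 (B - B') -> known p c.+2 t A' B').
Proof.
move=> hr [k1 k2 tc tr] hz A'.
have pzl k : dvd_pow p c.+1 (k - B) -> p %| zl k.
  move=> h; rewrite -[p]expn1 (tracks_dvd _ tr) //; exact: (dvd_powW _ h).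
have hA : dvd_pow p c.+2 (A - A').
  (* Some row of valuation exactly c + 1, to which [n0_dvd] can be applied. *)
  set k0 := (B + Posz (p ^ c.+1))%R.
  have q0 : p ^ c.+1 > 0 by rewrite expn_gt0 ltnW.
  have e : (k0 - B = Posz (p ^ c.+1))%R by rewrite /k0; lia.
  have h1 : dvd_pow p c.+1 (k0 - B) by rewrite e /dvd_pow dvdzz.
  have h2 : ~~ dvd_pow p c.+2 (k0 - B).
    rewrite e /dvd_pow dvdzE /=; apply/negP => /(dvdn_leq q0).
    by rewrite leq_exp2l // ltnn.
  have := n0_dvd p_gt1 hr k2 h1 h2 (pzl _ h1) (fun i a b => hz i k0 a b h1 h2).
  set n0 := (1 - _)%R => hn.
  have -> : (A - A' = - (Posz (p ^ c.+1) * n0))%R by rewrite /A'; lia.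
  rewrite /dvd_pow rpredN.
  by have := dvdz_mul (dvdzz (Posz (p ^ c.+1))) hn; rewrite -PoszM -expnSr.
split => // B' hB a i k; rewrite ltnS leq_eqVlt => /orP [/eqP -> {a}|ac].
  rewrite !(dvd_pow_eqmod _ hB) // => h1 h2 h3.
  have h3' : dvd_pow p c.+1 (i - A) by rewrite -(dvd_pow_eqmod _ hA).
  exact: (row_known p_gt1 hr k2 h1 h2 (pzl _ h1) (fun i a b => hz i k a b h1 h2) h3').
exact: (known_eqmod k1 hA hB).
Qed.

(** By [row_codes] in both directions the code and its flip lie between 3 and 5; as flipping
    subtracts from 6, both must be 3. *)
Lemma zeros_known zc gc zr gr t f s c A B :
  ruler p zc gc zr gr t f s -> ruled p zc zr t c A B ->
  forall i k, dvd_pow p c.+1 (i - A) -> ~~ dvd_pow p c.+2 (i - A) ->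
     dvd_pow p c.+1 (k - B) -> ~~ dvd_pow p c.+2 (k - B) -> t i k = 3.
Proof.
move=> [r1 r2] [k1 k2 tc tr] i k hi hi' hk hk'.
have pz z C j : tracks p z C -> dvd_pow p c.+1 (j - C) -> p %| z j.
  move=> h1 h; rewrite -[p]expn1 (tracks_dvd _ h1) //; exact: (dvd_powW _ h).
have := row_codes p_gt1 r1 k2 hk hk' (pz _ _ _ tr hk) hi.
(* [flip] is an involution only on codes below 6; the known codes 3 to 5 are among them. *)
have k1' : known p c.+1 (fun i k => flip (flip (t i k))) A B.
  move=> a i' k' ac h1 h2 h3; rewrite -(k1 a i' k' ac h1 h2 h3).
  have := k1 a i' k' ac h1 h2 h3; case: ifP => _; last case: ifP => _.
  - by move=> ->.
  - by move=> ->.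
  by move=> ->.
have := row_codes p_gt1 r2 k1' hi hi' (pz _ _ _ tc hi) hk.
by rewrite /flip; case: eqP; lia.
Qed.

Lemma ruled_step zc gc zr gr t f s c A B :
  ruler p zc gc zr gr t f s -> ruled p zc zr t c A B ->
  exists A' B', [/\ dvd_pow p c.+2 (A - A'), dvd_pow p c.+2 (B - B')
    & ruled p zc zr t c.+1 A' B'].
Proof.
move=> hr hd; have [r1 r2] := hr; have [k1 k2 tc tr] := hd.
have hz := zeros_known hr hd.
have [hA kA] := known_step r1 hd hz.
have hd' : ruled p zr zc (fun k i => flip (t i k)) c B A.
  split => // a i' k' ac h1 h2 h3.
  have := k1 a i' k' ac h1 h2 h3 => ->.
  by case: ifP => _; last case: ifP => _.
have [hB kB] := known_step r2 hd' (fun k i hk hk' hi hi' =>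
   congr1 flip (hz i k hi hi' hk hk') : flip (t i k) = 3).
eexists; eexists; split; [exact: hA|exact: hB|split].
- exact: kA.
- exact: kB.
- exact: (tracks_eqmod tc _ hA).
exact: (tracks_eqmod tr _ hB).
Qed.

(** The residues at 0 give the centres modulo p^2, and the first clause of [half_rule] settles
    valuation 0. *)
Lemma ruled_base zc gc zr gr t f s :
  ruler p zc gc zr gr t f s -> exists A B, ruled p zc zr t 0 A B.
Proof.
move=> [r1 r2].
have tr zl z g t0 f0 : half_ruler p zl z g t0 f0 -> tracks p z (- Posz (z 0%R)).
  move=> h; rewrite /tracks; apply: (@int_ind2 (fun i => dvd_pow p 2 (Posz (z i) - (i - - Posz (z 0%R)))) 0%R) => [|i].
    have -> : (Posz (z 0) - (0 - - Posz (z 0)) = 0)%R by lia.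
    exact: dvdz0.
  rewrite (hr_step h); have := divn_eq (z i).+1 (p ^ 2) => e.
  have -> : (Posz (z i) - (i - - Posz (z 0)) =
    (Posz ((z i).+1 %% p ^ 2) - (i + 1 - - Posz (z 0))) +
     Posz ((z i).+1 %/ p ^ 2) * Posz (p ^ 2))%R by rewrite -PoszM; lia.
  by rewrite /dvd_pow rpredDr ?dvdz_mull.
have kn zl z g t0 f0 A B : half_ruler p zl z g t0 f0 -> tracks p z A -> tracks p zl B ->
    known p 1 t0 A B.
  move=> h hA hB [|//] i k _ _ h1 _.
  have /and3P [h2 _ _] := hr_cell h i k; move: h2.
  have ez : p ^ 1 %| zl k = false by rewrite (tracks_dvd _ hB) // (negbTE h1).
  rewrite /level -{1 4}[p]expn1 -{6}[p]expn1 ez /= => /eqP ->.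
  rewrite (tracks_dvd i hA (leqnn 2)) (tracks_dvd i hA (leqnSn 1)).
  have : dvd_pow p 2 (i - A) -> dvd_pow p 1 (i - A) by exact: dvd_powW.
  by case: (dvd_pow p 1 _); case: (dvd_pow p 2 _) => //= /(_ isT).
exists (- Posz (zc 0%R))%R, (- Posz (zr 0%R))%R.
have t1 := tr _ _ _ _ _ r1; have t2 := tr _ _ _ _ _ r2.
by split => //; [exact: (kn _ _ _ _ _ _ _ r1)|exact: (kn _ _ _ _ _ _ _ r2)].
Qed.

(** Dependent choice along [ruled_step]. The centres converge p-adically, and their limits need not
    be integers, so there is one pair for each c. *)
Lemma ruler_offsets zc gc zr gr t f s :
  ruler p zc gc zr gr t f s ->
  exists A B : nat -> int, forall c,
   [/\ dvd_pow p c.+2 (A c - A c.+1), dvd_pow p c.+2 (B c - B c.+1)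
     & ruled p zc zr t c (A c) (B c)].
Proof.
move=> hr; have [A0 [B0 h0]] := ruled_base hr.
pose P (c : nat) (X : int * int) := ruled p zc zr t c X.1 X.2.
pose X0 : {x : nat * (int * int) | P x.1 x.2} := exist _ (0, (A0, B0)) h0.
have nx (x : {x : nat * (int * int) | P x.1 x.2}) : exists y : {x : nat * (int * int) | P x.1 x.2},
   [/\ (sval y).1 = (sval x).1.+1, dvd_pow p (sval x).1.+2 ((sval x).2.1 - (sval y).2.1)
     & dvd_pow p (sval x).1.+2 ((sval x).2.2 - (sval y).2.2)].
  case: x => [[c [A B]] /= h]; have [A' [B' [h1 h2 h3]]] := ruled_step hr h.
  by exists (exist _ (c.+1, (A', B')) h3).
have [F hF] := boolp.choice nx.
pose X n := iter n F X0.
have X1 n : (sval (X n)).1 = n.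
  by elim: n => // n IH; rewrite /X /= -/(X n); case: (hF (X n)) => -> _ _; rewrite IH.
exists (fun n => (sval (X n)).2.1), (fun n => (sval (X n)).2.2) => c.
have [_ h1 h2] := hF (X c); rewrite X1 in h1 h2.
by split => //; have := svalP (X c); rewrite /P X1.
Qed.

End RulerInd.

Definition modn_int (i : int) (m : nat) : nat := `|(i %% Posz m)%Z|%N.

Lemma modn_intE i m : 0 < m -> Posz (modn_int i m) = (i %% Posz m)%Z.
Proof. by move=> m0; rewrite /modn_int gez0_abs // modz_ge0 //; lia. Qed.

Lemma modn_int_lt i m : 0 < m -> modn_int i m < m.
Proof.
move=> m0; have := modn_intE i m0; have := @ltz_pmod i (Posz m) ltac:(lia); lia.
Qed.

Lemma dvdn_modn_int i m d : 0 < m -> d %| m -> (d %| modn_int i m) = (Posz d %| i)%Z.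
Proof.
move=> m0 dm.
have -> : (d %| modn_int i m) = (Posz d %| Posz (modn_int i m))%Z by rewrite dvdzE.
have dm' : (Posz d %| Posz m)%Z by rewrite dvdzE.
rewrite modn_intE // [in RHS](divz_eq i (Posz m)).
move: (i %% _)%Z (i %/ _)%Z => r q.
by rewrite rpredDl //; exact: dvdz_mull.
Qed.

Lemma modn_int1 i m (b : bool) : 0 < m ->
  modn_int (i + Posz b)%R m = (modn_int i m + b) %% m.
Proof.
move=> m0; apply/eqP; rewrite -eqz_nat modn_intE // -modz_nat PoszD modn_intE //.
by rewrite modzDml.
Qed.

Lemma divz_succ i (m : int) : (0 < m)%R -> ((i + 1) %/ m)%Z = ((i %/ m)%Z + Posz (m %| (i + 1)%R)%Z)%R.
Proof.
move=> m0; have e := divz_eq i m; have h1 := @ltz_pmod i m m0; have h2 := @modz_ge0 i m ltac:(lia).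
case: (boolP (m %| (i + 1)%R)%Z) => [/dvdzP [q hq]|nd] /=.
  rewrite hq mulzK; last by lia.
  move: e h1 h2 hq; set r := (i %% m)%Z; set d := (i %/ m)%Z => e h1 h2 hq.
  have : ((q - d - 1) * m = r + 1 - m)%R by lia.
  move=> hh; have : (q - d - 1 = 0)%R by nia. lia.
have e' : (i + 1 = (i %/ m)%Z * m + ((i %% m)%Z + 1))%R by lia.
rewrite {1}e' divzMDl; last by lia.
have hne : ((i %% m)%Z + 1 != m)%R.
  apply: contraNneq nd => hh; rewrite e' hh; apply/dvdzP; exists ((i %/ m)%Z + 1)%R; lia.
move/eqP: hne h1 h2; move: (i %% m)%Z (i %/ m)%Z => r d hne h1 h2.
have hs : (0 <= r + 1 < `|m|%N)%R by lia.
by rewrite divz_small ?addr0.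
Qed.

(** * The standard ruler, centred at 0 *)

Section RulerExists.
Variables (p : nat) (p_pr : prime p).

Definition val_of (i : int) : nat := logn p `|i|%N.
(** The distance between consecutive columns counted by row [k]. At valuation 0 the truncated
    predecessor gives 1, so every column is counted. Row 0 counts none: division by its spacing 0
    yields 0, a constant phase. *)
Definition spacing (k : int) : int := if k == 0%R then 0%R else Posz (p ^ (val_of k).-1).
Definition std_code (i k : int) : nat :=
  if i == 0%R then (if k == 0%R then 0 else 5)
  else if k == 0%R then 1 else cmp_code (val_of i) (val_of k).
Definition std_phase (i k : int) : nat := modn_int (i %/ spacing k)%Z (p ^ 3).
Definition std_digit (i : int) : nat := modn_int i (p ^ 2).
Definition std_unit (i : int) : nat := modn_int (i %/ Posz (p ^ val_of i))%Z (p ^ 2).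

Let p_gt1 : 1 < p := prime_gt1 p_pr.
Let pX_gt0 j : 0 < p ^ j. Proof. by rewrite expn_gt0 ltnW. Qed.

Lemma dvd_val i j : i != 0%R -> dvd_pow p j i = (j <= val_of i).
Proof.
by move=> i0; rewrite /dvd_pow dvdzE /= pfactor_dvdn // absz_gt0.
Qed.

Lemma flip_std i k : flip (std_code i k) = std_code k i.
Proof.
rewrite /std_code; case: (i == 0%R); case: (k == 0%R) => //.
exact: flip_cmp.
Qed.

Lemma std_skip i k : k != 0%R -> skipped (std_code i k) = ~~ (spacing k %| i)%Z.
Proof.
move=> k0; rewrite /std_code /spacing (negbTE k0).
case: (eqVneq i 0%R) => [->|i0]; first by rewrite dvdz0.
rewrite -/(dvd_pow p _ i) dvd_val // skipped_cmp; lia.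
Qed.

Lemma level_std i : i != 0%R -> level p (std_digit i) = minn 2 (val_of i).
Proof.
move=> i0; rewrite /level /std_digit.
rewrite -{1}[p]expn1 !dvdn_modn_int ?dvdn_exp2l // -!/(dvd_pow p _ i) !dvd_val //.
by case: (val_of i) => [|[|n]] /=; lia.
Qed.

Lemma minn2SS n : minn 2 n.+2 = 2. Proof. lia. Qed.

Lemma level_std0 : level p (std_digit 0) = 2.
Proof. by rewrite /level /std_digit /modn_int mod0z /= !dvdn0. Qed.

(** In a row of valuation b > 0 column [i] has number i / p^(b-1), so each clause compares the
    valuations of [i] and of this quotient, which differ by b - 1. *)
Lemma std_cell i k :
  half_rule p (std_digit k) (std_digit i) (std_unit i) (std_code i k) (std_phase i k).
Proof.
have pd j : j != 0%R -> (p %| std_digit j) = (0 < val_of j).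
  move=> j0; rewrite /std_digit -{1}[p]expn1 dvdn_modn_int ?dvdn_exp2l //.
  by rewrite -/(dvd_pow p _ j) dvd_val.
rewrite /half_rule /std_code /std_phase /spacing.
case: (eqVneq k 0%R) => [->|k0].
  case: (eqVneq i 0%R) => [->|i0]; first by rewrite level_std0.
  by rewrite level_std0 level_std //=; case: (val_of i) => [|[|n]]; rewrite ?minn2SS.
case: (eqVneq i 0%R) => [->|i0].
  rewrite level_std0 level_std // div0z /modn_int mod0z /= /phase_code !dvdn0 eqxx !orbT /=.
  by case: (val_of k) => [|[|n]]; rewrite ?minn2SS.
rewrite !level_std // pd //.
set a := val_of i; set b := val_of k.
apply/and3P; split.
- by case: a => [|[|a']]; case: b => [|[|b']]; rewrite ?minn2SS ?orbT ?eqxx.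
- case: (posnP b) => [_|b0]; first by rewrite orbT.
  case: (leqP b.-1 a) => h; last first.
    by rewrite skipped_cmp; have -> : a.+1 < b by lia.
  have /dvdzP [y hy] : dvd_pow p b.-1 i by rewrite dvd_val.
  have hd j : j <= 3 -> (p ^ j %| modn_int (i %/ Posz (p ^ b.-1))%Z (p ^ 3)) = (j + b.-1 <= a).
    move=> j3; rewrite dvdn_modn_int ?dvdn_exp2l // -dvd_val // {1}/dvd_pow hy mulzK; last by have := pX_gt0 b.-1; lia.
    rewrite expnD PoszM dvdz_mul2r //; have := pX_gt0 b.-1; lia.
  have := hd 1 isT; rewrite expn1 => hd1.
  rewrite /phase_code hd1 !hd // skipped_cmp /cmp_code.
  have -> : (1 + b.-1 <= a) = (b <= a) by lia.
  have -> : (2 + b.-1 <= a) = (b < a) by lia.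
  have -> : (3 + b.-1 <= a) = (b.+1 < a) by lia.
  case: (ltnP a.+1 b) => h1 //=; case: (ltnP a b) => h2; case: (ltnP b a) => h3; rewrite ?orbT //=; try lia.
    by case: (eqVneq a b) => h4; [lia|]; case: (eqVneq a b.+1) => h5; case: (ltnP b.+1 a) => h6; rewrite ?orbT //; lia.
  by have -> : a == b by lia.
case: (posnP b) => [_|b0]; first by rewrite orbT.
case: (eqVneq a b) => ab; last first.
  rewrite /cmp_code (negbTE ab); case: ifP => // _; case: ifP => // _; by case: ifP.
apply/orP; right; apply/orP; right.
have /dvdzP [y hy] : dvd_pow p a i by rewrite dvd_val.
have pa0 := pX_gt0 a; have pb0 := pX_gt0 b.-1.
have e1 : (i %/ Posz (p ^ a))%Z = y by rewrite hy mulzK //; lia.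
have e2 : (i %/ Posz (p ^ b.-1))%Z = (y * Posz p)%R.
  rewrite hy ab -{1}(prednK b0) expnS PoszM mulrA mulzK //; lia.
rewrite /std_unit -/a e1 e2 -(@eqn_pmul2r p) ?(ltnW p_gt1) //.
have -> : modn_int (y * Posz p) (p ^ 3) = modn_int y (p ^ 2) * p.
  apply/eqP; rewrite -eqz_nat PoszM !modn_intE // (expnSr p 2) PoszM mulz_modl //.
  by have := ltnW p_gt1; lia.
by rewrite mulnK // ltnW.
Qed.

Lemma std_half : half_ruler p std_digit std_digit std_unit std_code std_phase.
Proof.
split.
- by move=> i; rewrite /std_digit (modn_int1 i true) // addn1.
- by move=> i; apply: modn_int_lt.
- exact: std_cell.
- by move=> i k; apply: modn_int_lt.
move=> i k; rewrite /std_phase; case: (eqVneq k 0%R) => [->|k0].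
  have -> : skipped (std_code (i + 1) 0) by rewrite /std_code eqxx; case: ifP.
  by rewrite /spacing eqxx !divz0 addn0 modn_small // modn_int_lt.
rewrite std_skip // negbK -modn_int1 //; congr modn_int.
by rewrite divz_succ // /spacing (negbTE k0) ltz_nat.
Qed.

Lemma ruler_std : ruler p std_digit std_unit std_digit std_unit std_code std_phase
  (fun i k => std_phase k i).
Proof.
split; first exact: std_half.
have [h1 h2 h3 h4 h5] := std_half; split => //.
- by move=> i k; rewrite flip_std.
by move=> i k; rewrite flip_std.
Qed.

End RulerExists.

(** * Register machines *)

Inductive instr : Type :=
| ICopy of nat & nat
| IZero of nat
| IInc of nat
| IDec of nat
| IJz of nat & nat
| IBack of nat
| IStop.

Definition upd (R : nat -> nat) (j v : nat) : nat -> nat :=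
  fun r => if r == j then v else R r.

Definition mstate : Type := nat * (nat -> nat).

Definition mstep (code : seq instr) (st : mstate) : mstate :=
  let: (pc, R) := st in
  match nth IStop code pc with
  | ICopy i j => (pc.+1, upd R j (R i))
  | IZero j => (pc.+1, upd R j 0)
  | IInc j => (pc.+1, upd R j (R j).+1)
  | IDec j => (pc.+1, upd R j (R j).-1)
  | IJz j d => (if R j == 0 then pc + d else pc.+1, R)
  | IBack d => (pc - d, R)
  | IStop => (pc, R)
  end.

Definition mruns (code : seq instr) (pc : nat) (R : nat -> nat) (pc' : nat)
    (R' : nat -> nat) : Prop :=
  exists n, iter n (mstep code) (pc, R) = (pc', R').

Lemma mruns_refl code pc R : mruns code pc R pc R.
Proof. by exists 0. Qed.

Lemma mruns_trans code pc1 R1 pc2 R2 pc3 R3 :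
  mruns code pc1 R1 pc2 R2 -> mruns code pc2 R2 pc3 R3 -> mruns code pc1 R1 pc3 R3.
Proof. by move=> [n1 h1] [n2 h2]; exists (n2 + n1); rewrite iterD h1. Qed.

Lemma mruns_step code pc R pc' R' pc2 R2 :
  mstep code (pc, R) = (pc', R') -> mruns code pc' R' pc2 R2 -> mruns code pc R pc2 R2.
Proof. by move=> h [n hn]; exists n.+1; rewrite iterSr h. Qed.

Definition code_at (code : seq instr) (pc : nat) (c : seq instr) : Prop :=
  forall i, i < size c -> nth IStop code (pc + i) = nth IStop c i.

Lemma code_at_cat code pc c1 c2 :
  code_at code pc (c1 ++ c2) <-> code_at code pc c1 /\ code_at code (pc + size c1) c2.
Proof.
split=> [h|[h1 h2]].
  split=> i hi; first by rewrite h ?nth_cat ?hi // size_cat ltn_addr.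
  rewrite -addnA h ?size_cat ?ltn_add2l // nth_cat ltnNge leq_addr /=.
  by rewrite addKn.
move=> i; rewrite size_cat nth_cat => hi; case: ltnP => h; first exact: h1.
by rewrite -h2; [congr nth; lia | lia].
Qed.

Lemma code_at_cons code pc x c :
  code_at code pc (x :: c) <-> nth IStop code pc = x /\ code_at code pc.+1 c.
Proof.
rewrite -cat1s code_at_cat addn1; split=> [[h1 h2]|[h1 h2]].
  by split=> //; have := h1 0 isT; rewrite addn0.
by split=> // -[|//] _; rewrite addn0.
Qed.

(* Arguments in the registers [args], result in [fr]; registers from [fr] on are
   scratch.  Jumps are relative. *)
Fixpoint compile (p : recfun) (args : seq nat) (fr : nat) {struct p} : seq instr :=
  match p with
  | RZero => [:: IZero fr]
  | RSucc => [:: ICopy (head 0 args) fr; IInc fr]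
  | RProj i => [:: ICopy (nth 0 args i) fr]
  | RComp f gs =>
      (fix compiles gs fr := if gs is g :: gs' then compile g args fr ++ compiles gs' fr.+1
                             else [::]) gs fr
      ++ compile f (iota fr (size gs)) (fr + size gs) ++ [:: ICopy (fr + size gs) fr]
  | RPrim f g =>
      let cg := compile g (fr.+1 :: fr :: behead args) fr.+3 in
      compile f (behead args) fr.+3 ++
      [:: ICopy fr.+3 fr; IZero fr.+1; ICopy (head 0 args) fr.+2;
          IJz fr.+2 (size cg + 5)] ++
      cg ++ [:: ICopy fr.+3 fr; IInc fr.+1; IDec fr.+2; IBack (size cg + 4)]
  | RMu f =>
      let cf := compile f (fr :: args) fr.+1 in
      [:: IZero fr] ++ cf ++ [:: IJz fr.+1 3; IInc fr; IBack (size cf + 2)]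
  end.

(** A standalone copy of the fixpoint that structural recursion forces to be nested inside
    [compile]. *)
Fixpoint compiles (gs : seq recfun) (args : seq nat) (fr : nat) : seq instr :=
  if gs is g :: gs' then compile g args fr ++ compiles gs' args fr.+1 else [::].

Lemma compile_comp f gs args fr :
  compile (RComp f gs) args fr =
  compiles gs args fr ++ compile f (iota fr (size gs)) (fr + size gs)
    ++ [:: ICopy (fr + size gs) fr].
Proof.
rewrite /=; congr (_ ++ _).
by elim: gs fr {f} => //= g gs IH fr; rewrite IH.
Qed.

Definition simulates p s y : Prop := forall code pc R args fr,
  code_at code pc (compile p args fr) -> all (fun a => a < fr) args -> map R args = s ->
  exists R', [/\ mruns code pc R (pc + size (compile p args fr)) R', R' fr = y
               & forall r, r < fr -> R' r = R r].

Definition simulates_seq gs s ys : Prop := forall code pc R args fr,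
  code_at code pc (compiles gs args fr) -> all (fun a => a < fr) args -> map R args = s ->
  exists R', [/\ mruns code pc R (pc + size (compiles gs args fr)) R',
     size ys = size gs, map R' (iota fr (size gs)) = ys
               & forall r, r < fr -> R' r = R r].

(** Simulating a whole loop of [n] turns says nothing about extending it by a turn; for that, the
    simulation of each body is recorded separately. *)
Definition prim_data f g n s y : Prop := exists v : nat -> nat,
  [/\ v n = y, simulates f s (v 0)
    & forall m, m < n -> simulates g (m :: v m :: s) (v m.+1)].

Lemma upd_same R j v : upd R j v j = v. Proof. by rewrite /upd eqxx. Qed.
Lemma upd_other R j v r : r != j -> upd R j v r = R r.
Proof. by rewrite /upd => /negbTE ->. Qed.

Ltac simp_upd := rewrite /upd; repeat match goal with |- context [?a == ?b] =>
  first [ have -> : (a == b) = true by lia | have -> : (a == b) = false by lia ] end;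
  cbv iota.

Lemma map_regs_eq (R R' : nat -> nat) fr args :
  all (fun a => a < fr) args -> (forall r, r < fr -> R' r = R r) -> map R' args = map R args.
Proof. by move=> /allP h e; apply/eq_in_map => a /h /e. Qed.

Lemma all_ltW (args : seq nat) m n : m <= n -> all (fun a => a < m) args -> all (fun a => a < n) args.
Proof. by move=> mn; apply: sub_all => a /leq_trans; apply. Qed.

(** Register [fr] holds the current value, [fr.+1] the index of the turn and [fr.+2] the number of
    turns left; [inv] is the state at the loop test. *)
Lemma simulates_prim f g n s y : prim_data f g n s y -> simulates (RPrim f g) (n :: s) y.
Proof.
move=> [v [vn hf hg]] code pc R args fr.
case: args => // a args /= hc /andP [afr hargs] [Ra Rs].
move: hc; set cf := compile f _ _; set cg := compile g _ _.
rewrite code_at_cat => -[hcf]; set p1 := pc + size cf.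
rewrite 4!code_at_cons => -[i1 [i2 [i3 [i4]]]]; rewrite code_at_cat => -[hcg].
rewrite !code_at_cons => -[j1 [j2 [j3 [j4 _]]]].
have h3 := all_ltW (leqnSn _) (all_ltW (leqnSn _) (all_ltW (leqnSn _) hargs)).
have [R1 [r1 e1 k1]] := hf code pc R args fr.+3 hcf h3 Rs.
pose R2 := upd (upd (upd R1 fr (R1 fr.+3)) fr.+1 0) fr.+2 (R1 a).
have r2 : mruns code pc R p1.+3 R2.
  apply: mruns_trans r1 _; rewrite -/p1.
  apply: mruns_step; first by rewrite /= i1.
  apply: mruns_step; first by rewrite /= i2.
  apply: mruns_step; first by rewrite /= i3.
  have -> : upd (upd R1 fr (R1 fr.+3)) fr.+1 0 a = R1 a by simp_upd.
  exact: mruns_refl.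
have inv m : m <= n -> exists R', [/\ mruns code pc R p1.+3 R', R' fr = v m, R' fr.+1 = m,
     R' fr.+2 = n - m & forall r, r < fr -> R' r = R r].
  elim: m => [_|m IH mn].
    exists R2; split=> //.
    - by rewrite /R2; simp_upd.
    - by rewrite /R2; simp_upd.
    - by rewrite /R2; simp_upd; rewrite k1 ?Ra ?subn0 //; lia.
    by move=> r hr; rewrite /R2; simp_upd; rewrite k1 //; lia.
  have [R' [r' a1 a2 a3 a4]] := IH (ltnW mn).
  have := hg m mn code p1.+4 R' (fr.+1 :: fr :: args) fr.+3 hcg.
  have hargs' : all (fun a => a < fr.+3) (fr.+1 :: fr :: args) by rewrite /= h3 andbT; lia.
  move=> /(_ hargs'); rewrite /= a1 a2 (map_regs_eq hargs a4) Rs => /(_ erefl) [R3 [r3 b1 b2]].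
  exists (upd (upd (upd R3 fr (R3 fr.+3)) fr.+1 (R3 fr.+1).+1) fr.+2 (R3 fr.+2).-1); split.
  - apply: mruns_trans r' _.
    apply: mruns_step; first by rewrite /= i4 a3; have -> : (n - m == 0) = false by lia.
    apply: mruns_trans r3 _; rewrite -/cg.
    apply: mruns_step; first by rewrite /= j1.
    apply: mruns_step; first by rewrite /= j2.
    apply: mruns_step; first by rewrite /= j3.
    apply: mruns_step; first by rewrite /= j4.
    have -> : (p1.+4 + size cg).+3 - (size cg + 4) = p1.+3 by lia.
    have -> : upd R3 fr (R3 fr.+3) fr.+1 = R3 fr.+1 by simp_upd.
    have -> : upd (upd R3 fr (R3 fr.+3)) fr.+1 (R3 fr.+1).+1 fr.+2 = R3 fr.+2 by simp_upd.
    exact: mruns_refl.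
  - by simp_upd.
  - by simp_upd; rewrite b2 ?a2 //; lia.
  - by simp_upd; rewrite b2 ?a3 //; lia.
  by move=> r hr; simp_upd; rewrite b2 ?a4 //; lia.
have [R' [r' a1 a2 a3 a4]] := inv n (leqnn n).
exists R'; split=> //; last by rewrite a1.
apply: mruns_trans r' _; apply: mruns_step; first by rewrite /= i4 a3 subnn eqxx.
have -> : p1.+3 + (size cg + 5) = pc + size (cf ++ [:: ICopy fr.+3 fr, IZero fr.+1, ICopy a fr.+2,
   IJz fr.+2 (size cg + 5) & cg ++ [:: ICopy fr.+3 fr; IInc fr.+1; IDec fr.+2; IBack (size cg + 4)]]).
  by rewrite size_cat /= size_cat /= /p1; lia.
exact: mruns_refl.
Qed.

Lemma simulates_mu f s n (v : nat -> nat) :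
  (forall m, m < n -> simulates f (m :: s) (v m).+1) -> simulates f (n :: s) 0 ->
  simulates (RMu f) s n.
Proof.
move=> hlt hn code pc R args fr /=; set cf := compile f _ _.
rewrite code_at_cons code_at_cat => -[i1 [hcf]]; rewrite !code_at_cons => -[j1 [j2 [j3 _]]].
move=> hargs Rs.
have hargs' : all (fun a => a < fr.+1) (fr :: args) by rewrite /= ltnSn (all_ltW (leqnSn _) hargs).
have inv m : m <= n -> exists R', [/\ mruns code pc R pc.+1 R', R' fr = m & forall r, r < fr -> R' r = R r].
  elim: m => [_|m IH mn].
    exists (upd R fr 0); split.
    - by apply: mruns_step; [rewrite /= i1|exact: mruns_refl].
    - by rewrite upd_same.
    by move=> r hr; rewrite upd_other //; lia.
  have [R' [r' a1 a2]] := IH (ltnW mn).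
  have := hlt m mn code pc.+1 R' (fr :: args) fr.+1 hcf hargs'.
  rewrite /= a1 (map_regs_eq hargs a2) Rs => /(_ erefl) [R3 [r3 b1 b2]].
  exists (upd R3 fr (R3 fr).+1); split.
  - apply: mruns_trans r' _; apply: mruns_trans r3 _; rewrite -/cf.
    apply: mruns_step; first by rewrite /= j1 b1.
    apply: mruns_step; first by rewrite /= j2.
    apply: mruns_step; first by rewrite /= j3.
    have -> : (pc.+1 + size cf).+2 - (size cf + 2) = pc.+1 by lia.
    exact: mruns_refl.
  - by rewrite upd_same b2 ?a1.
  by move=> r hr; rewrite upd_other ?b2 ?a2 //; lia.
have [R' [r' a1 a2]] := inv n (leqnn n).
have := hn code pc.+1 R' (fr :: args) fr.+1 hcf hargs'.
rewrite /= a1 (map_regs_eq hargs a2) Rs => /(_ erefl) [R3 [r3 b1 b2]].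
exists R3; split.
- apply: mruns_trans r' _; apply: mruns_trans r3 _; rewrite -/cf.
  apply: mruns_step; first by rewrite /= j1 b1 eqxx.
  rewrite size_cat /=; have -> : pc.+1 + size cf + 3 = pc + (size cf + 3).+1 by lia.
  exact: mruns_refl.
- by rewrite b2 ?a1.
by move=> r hr; rewrite b2 ?a2 //; lia.
Qed.

Lemma simulates_comp f gs s ys y :
  simulates_seq gs s ys -> simulates f ys y -> simulates (RComp f gs) s y.
Proof.
move=> hgs hf code pc R args fr; rewrite compile_comp.
rewrite !code_at_cat => -[c1 [c2]]; rewrite code_at_cons => -[c3 _] hargs Rs.
have [R1 [r1 sz e1 k1]] := hgs code pc R args fr c1 hargs Rs.
have hi : all (fun a => a < fr + size gs) (iota fr (size gs)).
  by apply/allP => a; rewrite mem_iota; lia.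
have [R2 [r2 e2 k2]] := hf code _ R1 _ _ c2 hi e1.
exists (upd R2 fr y); split.
- apply: mruns_trans r1 _; apply: mruns_trans r2 _.
  apply: mruns_step; first by rewrite /= c3.
  rewrite e2 !size_cat /= addn1 !addnS !addnA; exact: mruns_refl.
- by rewrite upd_same.
by move=> r hr; rewrite upd_other ?k2 ?k1 //; lia.
Qed.

Scheme eval_mut := Minimality for eval Sort Prop
  with evals_mut := Minimality for evals Sort Prop.

Lemma compile_correct p s y : eval p s y -> simulates p s y.
Proof.
(* The statement is strengthened by the turn-by-turn data, which the case [eval_primS] extends by
   one turn. *)
move=> h; suff : simulates p s y /\ (forall f g n s', p = RPrim f g -> s = n :: s' ->
   prim_data f g n s' y) by case.
move: p s y h.
apply: (@eval_mut _ (fun gs s ys => simulates_seq gs s ys)) => //=.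
- move=> s; split=> // code pc R args fr; rewrite /= code_at_cons => -[c1 _] _ _.
  exists (upd R fr 0); split=> [||r hr].
  + by apply: mruns_step; [rewrite /= c1|rewrite addn1; exact: mruns_refl].
  + by rewrite upd_same.
  by rewrite upd_other //; lia.
- move=> x s; split=> // code pc R [//|a args] fr /=; rewrite !code_at_cons => -[c1 [c2 _]] _ [ra _].
  exists (upd (upd R fr (R a)) fr (R a).+1); split=> [||r hr].
  + apply: mruns_step; first by rewrite /= c1.
    apply: mruns_step; first by rewrite /= c2 upd_same.
    rewrite addn2; exact: mruns_refl.
  + by rewrite upd_same ra.
  by rewrite !upd_other //; lia.
- move=> i s hi; split=> // code pc R args fr; rewrite /= code_at_cons => -[c1 _] _ rs.
  exists (upd R fr (R (nth 0 args i))); split=> [||r hr].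
  + by apply: mruns_step; [rewrite /= c1|rewrite addn1; exact: mruns_refl].
  + by rewrite upd_same -rs (nth_map 0) // -(size_map R) rs.
  by rewrite upd_other //; lia.
- by move=> f gs s ys y _ hgs _ [hf _]; split=> //; exact: simulates_comp hgs hf.
- move=> f g s y _ [hf _].
  have pd : prim_data f g 0 s y by exists (fun=> y).
  split; first exact: simulates_prim.
  by move=> f' g' n s' [<- <-] [<- <-].
- move=> f g n s r y _ [_ hpr] _ [hg _].
  have [v [vn hf hv]] := hpr f g n s erefl erefl.
  have pd : prim_data f g n.+1 s y.
    exists (fun m => if m == n.+1 then y else v m); split=> //; first by rewrite eqxx.
    move=> m; rewrite ltnS leq_eqVlt => /orP [/eqP ->|mn].
      by rewrite eqxx (ltn_eqF (ltnSn n)) vn.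
    by rewrite !ltn_eqF ?ltnS // ?(ltnW mn) //; apply: hv.
  split; first exact: simulates_prim.
  by move=> f' g' n' s' [<- <-] [<- <-].
- move=> f s n v _ hlt _ [h0 _]; split=> //.
  by apply: (@simulates_mu f s n v) => // m /hlt [].
- move=> s code pc R args fr _ _ _; exists R; split=> //; rewrite addn0; exact: mruns_refl.
move=> g gs s y ys _ [hg _] _ hgs code pc R args fr /=.
rewrite code_at_cat => -[c1 c2] hargs rs.
have [R1 [r1 e1 k1]] := hg code pc R args fr c1 hargs rs.
have := hgs code _ R1 args fr.+1 c2 (all_ltW (leqnSn _) hargs).
rewrite (map_regs_eq hargs k1) rs => /(_ erefl) [R2 [r2 e2 e3 k2]].
exists R2; split.
- by rewrite size_cat addnA; apply: mruns_trans r1 r2.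
- by rewrite /= e2.
- by rewrite e3 k2 ?e1.
by move=> r hr; rewrite k2 ?k1 //; lia.
Qed.

(** * Space-time diagrams on the quadrant *)

Definition testbit (e i : nat) : bool := odd (e %/ 2 ^ i).

Lemma testbit_exists (P : nat -> bool) N :
  exists e, e < 2 ^ N /\ forall i, testbit e i = (i < N) && P i.
Proof.
elim: N => [|N [e [eN he]]].
  by exists 0; split=> // i; rewrite /testbit div0n.
exists (e + P N * 2 ^ N); split.
  rewrite expnS; case: (P N); lia.
move=> i; rewrite /testbit ltnS; case: (ltngtP i N) => [iN|iN|->] /=.
- have -> : P N * 2 ^ N = (P N * 2 ^ (N - i).-1 * 2) * 2 ^ i.
    by rewrite -!mulnA -expnS -expnD; congr (_ * 2 ^ _); lia.
  rewrite addnC divnMDl ?expn_gt0 // oddD oddM andbF; have := he i; rewrite /testbit iN => ->.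
  by [].
- rewrite divn_small // (@leq_trans (2 ^ N.+1)) ?leq_exp2l // expnS; case: (P N); lia.
by rewrite addnC divnMDl ?expn_gt0 // divn_small // addn0; case: (P N).
Qed.

Lemma testbit_lt e i : testbit e i -> i < e.
Proof.
rewrite /testbit; case: (ltnP e (2 ^ i)) => [h|h _]; first by rewrite divn_small.
exact: leq_trans (ltn_expl i (ltnSn 1)) h.
Qed.

(** A code exceeds the entries of its list, and a set bit of [e] has index below [e]; hence allowed
    labels are smaller than [e] and the alphabet is finite. *)
Definition allowed e (za zb c : bool) (u0 u1 u2 : nat) : bool :=
  testbit e (CodeSeq.code [:: za + zb * 2 + c * 4; u0; u1; u2]).

Lemma code_gt_head n s : n < CodeSeq.code (n :: s).
Proof.
rewrite /=; apply: leq_trans (ltn_expl n (ltnSn 1)) _.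
by rewrite leq_pmulr.
Qed.

Lemma code_gt_tail n s : CodeSeq.code s < CodeSeq.code (n :: s).
Proof.
rewrite /= -/(CodeSeq.code s); have : 0 < 2 ^ n by rewrite expn_gt0.
move: (2 ^ n) (CodeSeq.code s); nia.
Qed.

Lemma allowed_lt e za zb c u0 u1 u2 :
  allowed e za zb c u0 u1 u2 -> [/\ u0 < e, u1 < e & u2 < e].
Proof.
move=> /testbit_lt; set n := _ + _.
have := code_gt_tail n [:: u0; u1; u2]; have := code_gt_head u0 [:: u1; u2].
have := code_gt_tail u0 [:: u1; u2]; have := code_gt_head u1 [:: u2].
have := code_gt_tail u1 [:: u2]; have := code_gt_head u2 [::]; move: (CodeSeq.code _) (CodeSeq.code _) => *.
split; lia.
Qed.

(** The flag [a < e] writes [e] in unary along the first axis, so the rule receives its own number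
    as input. *)
Definition labelling e (l : nat -> nat -> nat) : Prop :=
  forall a b, allowed e (a == 0) (b == 0) (a < e) (l a b) (l a.+1 b) (l a b.+1).

(* At position [a] and time [b]: the program counter, the bits [a < R r], and a
   copy of the bits at position [a - 1], needed by an increment. *)
Section SpaceTime.
Variable code : seq instr.
Let K := \max_(i <- code) (match i with
   | ICopy i j => maxn i j | IZero j | IInc j | IDec j => j | IJz j _ => j | _ => 0 end).+1.
Let bits := K.+1.-tuple bool.
Let m := (size code).+1.
Definition cell_state : finType := ('I_m * bits * bits)%type.

Let read (B : bits) r := nth false B r.
Definition counter_bits (R : nat -> nat) (a : nat) : bits := [tuple a < R (val r) | r < K.+1].

Definition next_bits I (B0 LB0 B1 : bits) : bits :=
  [tuple match I with
   | ICopy i j => if val r == j then read B0 i else read B0 r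
   | IZero j => if val r == j then false else read B0 r
   | IInc j => if val r == j then read LB0 r else read B0 r
   | IDec j => if val r == j then read B1 r else read B0 r
   | _ => read B0 r end | r < K.+1].

Definition next_pc I (pc : nat) (B0 : bits) : nat :=
  match I with
  | IJz j d => if read B0 j then pc.+1 else pc + d
  | IBack d => pc - d
  | _ => pc.+1 end.

Definition is_stop I := if I is IStop then true else false.

(** Jumps are decided at position 0 only, where the bit of a register tells whether it is nonzero;
    the counter is then copied along the line. The left copy at position 0 is all true, because an
    incremented register exceeds 0. *)
Definition local_rule (za zb c : bool) (s0 s1 s2 : cell_state) : bool :=
  let: (pc0, B0, L0) := s0 in let: (pc1, B1, L1) := s1 in let: (pc2, B2, L2) := s2 in
  let I := nth IStop code pc0 in
  [&& val pc1 == val pc0, L1 == B0, za ==> (L0 == [tuple true | r < K.+1]),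
      zb ==> (val pc0 == 0) && (B0 == [tuple (val r == 0) && c | r < K.+1]),
      ~~ is_stop I, B2 == next_bits I B0 L0 B1 & za ==> (val pc2 == next_pc I pc0 B0)].

Definition start_regs (x : nat) : nat -> nat := fun r => if r == 0 then x else 0.
Definition state_at x b : mstate := iter b (mstep code) (0, start_regs x).

Lemma read_counter R a r : r <= K -> read (counter_bits R a) r = (a < R r).
Proof. by move=> rK; rewrite /read -(tnth_nth _ _ (Ordinal (rK : r < K.+1))) tnth_mktuple. Qed.

Lemma instr_regs pc I : nth IStop code pc = I ->
  match I with ICopy i j => i <= K /\ j <= K | IZero j | IInc j | IDec j => j <= K
   | IJz j _ => j <= K | _ => True end.
Proof.
case: (ltnP pc (size code)) => [h|h]; last by rewrite nth_default // => <-.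
move=> e; have := @leq_bigmax _ (fun i : 'I_(size code) => (match nth IStop code i with
   | ICopy i j => maxn i j | IZero j | IInc j | IDec j => j | IJz j _ => j | _ => 0 end).+1) (Ordinal h).
have -> : \max_(i < size code) (match nth IStop code i with
   | ICopy i j => maxn i j | IZero j | IInc j | IDec j => j | IJz j _ => j | _ => 0 end).+1 = K.
  by rewrite /K (big_nth IStop) big_mkord.
rewrite /= e; case: I {e} => //=; lia.
Qed.

Lemma next_correct pc R a L0 : ~~ is_stop (nth IStop code pc) ->
  (forall r, r <= K -> read L0 r = (a == 0) || (a.-1 < R r)) ->
  let: (pc', R') := mstep code (pc, R) in
  next_bits (nth IStop code pc) (counter_bits R a) L0 (counter_bits R a.+1) = counter_bits R' a
  /\ next_pc (nth IStop code pc) pc (counter_bits R 0) = pc'.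
Proof.
move=> ns hL /=; have := @instr_regs pc _ erefl.
case: (nth IStop code pc) ns => //=.
- move=> i j _ [hi hj]; split=> //; apply: eq_from_tnth => r; rewrite !tnth_mktuple /upd.
  by have rK := ltn_ord r; rewrite !read_counter //; case: eqP.
- move=> j _ hj; split=> //; apply: eq_from_tnth => r; rewrite !tnth_mktuple /upd.
  by have rK := ltn_ord r; rewrite !read_counter //; case: eqP.
- move=> j _ hj; split=> //; apply: eq_from_tnth => r; rewrite !tnth_mktuple /upd.
  have rK := ltn_ord r; rewrite !read_counter // hL //; case: eqP => // ->.
  by case: a {hL}.
- move=> j _ hj; split=> //; apply: eq_from_tnth => r; rewrite !tnth_mktuple /upd.
  have rK := ltn_ord r; rewrite !read_counter //; case: eqP => // ->.
  by case: (R j).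
- move=> j d _ hj; split=> //.
    by apply: eq_from_tnth => r; rewrite !tnth_mktuple; have rK := ltn_ord r; rewrite read_counter.
  by rewrite read_counter // lt0n; case: eqP.
move=> d _ _; split=> //.
by apply: eq_from_tnth => r; rewrite !tnth_mktuple; have rK := ltn_ord r; rewrite read_counter.
Qed.

Lemma spacetime_sound x (l : nat -> nat -> cell_state) :
  (forall a b, local_rule (a == 0) (b == 0) (a < x) (l a b) (l a.+1 b) (l a b.+1)) ->
  forall b, ~~ is_stop (nth IStop code (state_at x b).1) /\
    forall a, val (l a b).1.1 = (state_at x b).1 /\ (l a b).1.2 = counter_bits (state_at x b).2 a.
Proof.
move=> H b.
have ns a' b' : ~~ is_stop (nth IStop code (l a' b').1.1).
  have := H a' b'; case: (l a' b') => [[pc0 B0] L0]; case: (l a'.+1 b') => [[pc1 B1] L1].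
  by case: (l a' b'.+1) => [[pc2 B2] L2] /and5P [_ _ _ _ /andP [h _]].
suff h : forall a, val (l a b).1.1 = (state_at x b).1 /\ (l a b).1.2 = counter_bits (state_at x b).2 a.
  by split=> //; have [<- _] := h 0; apply: ns.
elim: b => [|b IH] a.
  have := H a 0; case: (l a 0) => [[pc0 B0] L0]; case: (l a.+1 0) => [[pc1 B1] L1].
  case: (l a 1) => [[pc2 B2] L2] /and5P [_ _ _ /= /andP [/eqP -> /eqP ->] _]; split=> //.
  apply: eq_from_tnth => r; rewrite !tnth_mktuple /start_regs.
  by case: eqP.
have pcS a' : val (l a'.+1 b.+1).1.1 = (l a' b.+1).1.1.
  have := H a' b.+1; case: (l a' b.+1) => [[pc0 B0] L0]; case: (l a'.+1 b.+1) => [[pc1 B1] L1].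
  by case: (l a' b.+2) => [[pc2 B2] L2] /and5P [/eqP].
have hL r : r <= K -> read (l a b).2 r = (a == 0) || (a.-1 < (state_at x b).2 r).
  move=> rK; case: a => [|a] /=.
    have := H 0 b; case: (l 0 b) => [[pc0 B0] L0]; case: (l 1 b) => [[pc1 B1] L1].
    case: (l 0 b.+1) => [[pc2 B2] L2] /and5P [_ _ /eqP -> _ _] /=.
    by rewrite /read -(tnth_nth _ _ (Ordinal (rK : r < K.+1))) tnth_mktuple.
  have [_] := IH a.
  have := H a b; case: (l a b) => [[pc0 B0] L0]; case: (l a.+1 b) => [[pc1 B1] L1].
  case: (l a b.+1) => [[pc2 B2] L2] /and5P [_ /eqP -> _ _ _] /= ->.
  by rewrite read_counter.
have pc0E : val (l 0 b.+1).1.1 = (state_at x b.+1).1.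
  have [e1 e2] := IH 0.
  have ns0 := ns 0 b; rewrite e1 in ns0.
  have := @next_correct (state_at x b).1 (state_at x b).2 0 [tuple true | r < K.+1] ns0.
  rewrite -surjective_pairing [state_at x b.+1]iterS -/(state_at x b).
  case: (mstep code (state_at x b)) => pc' R' [|_ <-].
    by move=> r rK; rewrite /read -(tnth_nth _ _ (Ordinal (rK : r < K.+1))) tnth_mktuple.
  move: e1 e2; have := H 0 b; case: (l 0 b) => [[pc0 B0] L0]; case: (l 1 b) => [[pc1 B1] L1].
  by case: (l 0 b.+1) => [[pc2 B2] L2] /and5P [_ _ _ _ /and3P [_ _ /eqP /= ->]] -> ->.
split.
  by elim: a {hL} => [//|a IHa]; rewrite pcS.
have [e1 e2] := IH a; have [e3 e4] := IH a.+1.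
have nsa := ns a b; rewrite e1 in nsa.
have := @next_correct (state_at x b).1 (state_at x b).2 a _ nsa hL.
rewrite -surjective_pairing [state_at x b.+1]iterS -/(state_at x b).
case: (mstep code (state_at x b)) => pc' R' [<- _].
move: e1 e2 e3 e4; have := H a b; case: (l a b) => [[pc0 B0] L0]; case: (l a.+1 b) => [[pc1 B1] L1].
by case: (l a b.+1) => [[pc2 B2] L2] /and5P [_ _ _ _ /and3P [_ /eqP /= -> _]] -> -> _ ->.
Qed.

Lemma spacetime_complete x :
  (forall b, ~~ is_stop (nth IStop code (state_at x b).1)) ->
  exists l : nat -> nat -> cell_state,
  forall a b, local_rule (a == 0) (b == 0) (a < x) (l a b) (l a.+1 b) (l a b.+1).
Proof.
move=> ns.
pose LB b a : bits := if a is a'.+1 then counter_bits (state_at x b).2 a' else [tuple true | r < K.+1].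
exists (fun a b => (inord (state_at x b).1, counter_bits (state_at x b).2 a, LB b a)).
move=> a b; rewrite /local_rule.
(* The counter never leaves the code in a run that does not stop, since the default instruction is
   [IStop]. *)
have pcE b' : val (inord (state_at x b').1 : 'I_m) = (state_at x b').1.
  rewrite /= inordK // /m ltnS; have := ns b'.
  by case: (leqP (size code) (state_at x b').1) => h; [rewrite nth_default|move=> _; exact: ltnW].
rewrite !pcE !eqxx (ns b) !andTb.
have hL r : r <= K -> read (LB b a) r = (a == 0) || (a.-1 < (state_at x b).2 r).
  move=> rK; case: a => [|a] /=.
    by rewrite /read -(tnth_nth _ _ (Ordinal (rK : r < K.+1))) tnth_mktuple.
  by rewrite read_counter.
have := @next_correct _ _ a _ (ns b) hL.
rewrite -surjective_pairing [state_at x b.+1]iterS -/(state_at x b).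
case: (mstep code (state_at x b)) => pc' R' [-> h2].
apply/and4P; split.
- by apply/implyP => /eqP ->.
- apply/implyP => /eqP ->; rewrite /state_at /=; apply/eqP/eq_from_tnth => r.
  by rewrite !tnth_mktuple /start_regs; case: eqP.
- exact: eqxx.
by apply/implyP => /eqP a0; rewrite -h2 a0.
Qed.

End SpaceTime.

(** [e] is the bit table of the relation on ranks. It is obtained before [x], so [x] may later be
    [e] itself. *)
Lemma quadrant_encoding (S : finType) (rel : bool -> bool -> bool -> S -> S -> S -> bool) :
  exists e, forall x, (exists l : nat -> nat -> S,
      forall a b, rel (a == 0) (b == 0) (a < x) (l a b) (l a.+1 b) (l a b.+1)) <->
    (exists l : nat -> nat -> nat,
      forall a b, allowed e (a == 0) (b == 0) (a < x) (l a b) (l a.+1 b) (l a b.+1)).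
Proof.
pose idx (t : bool * bool * bool * S * S * S) :=
  let: (za, zb, c, s0, s1, s2) := t in
  CodeSeq.code [:: za + zb * 2 + c * 4; enum_rank s0 : nat; enum_rank s1 : nat; enum_rank s2 : nat].
pose relt (t : bool * bool * bool * S * S * S) :=
  let: (za, zb, c, s0, s1, s2) := t in rel za zb c s0 s1 s2.
have [e [_ he]] := testbit_exists (fun i => [exists t, (idx t == i) && relt t]) (\max_t idx t).+1.
have idx_inj za zb c s0 s1 s2 (t : bool * bool * bool * S * S * S) : idx t = idx (za, zb, c, s0, s1, s2) ->
   t = (za, zb, c, s0, s1, s2).
  case: t => [[[[[za' zb'] c'] s0'] s1'] s2'] /(can_inj CodeSeq.codeK) [h h0 h1 h2].
  have [-> -> ->] : [/\ za' = za, zb' = zb & c' = c].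
    by move: h; case: za'; case: zb'; case: c'; case: za; case: zb; case: c.
  by rewrite (enum_rank_inj (val_inj h0)) (enum_rank_inj (val_inj h1)) (enum_rank_inj (val_inj h2)).
have al za zb c s0 s1 s2 : allowed e za zb c (enum_rank s0) (enum_rank s1) (enum_rank s2)
   = rel za zb c s0 s1 s2.
  rewrite /allowed he ltnS (leq_bigmax (F := idx) (za, zb, c, s0, s1, s2)) /=.
  apply/existsP/idP => [[t /andP [/eqP /idx_inj -> //]]|h].
  by exists (za, zb, c, s0, s1, s2); rewrite eqxx.
exists e => x; split=> [[l hl]|[l hl]].
  by exists (fun a b => enum_rank (l a b) : nat) => a b; rewrite al.
have ex a b : exists s : S, l a b = enum_rank s :> nat.
  have := hl a b; rewrite /allowed he => /andP [_ /existsP [[[[[[za zb] c] s0] s1] s2]]].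
  by move=> /andP [/eqP /(can_inj CodeSeq.codeK) [_ h0 _ _] _]; exists s0.
have [f hf] := boolp.choice (fun ab : nat * nat => ex ab.1 ab.2).
exists (fun a b => f (a, b)) => a b.
by rewrite -al; have := hl a b; rewrite !(hf (_, _)).
Qed.

Lemma iter_stop code n pc R : is_stop (nth IStop code pc) -> iter n (mstep code) (pc, R) = (pc, R).
Proof.
move=> h; elim: n => // n IH; rewrite iterS IH /=.
by move: h; case: (nth IStop code pc).
Qed.

Lemma quadrant_simulation (g : recfun) :
  exists e, forall b : bool, eval g [:: e] b -> ((exists l, labelling e l) <-> b = false).
Proof.
pose c := compile g [:: 0] 1.
(* Register 1 holds the answer: 0 leads to the endless loop [IBack 0], anything else to [IStop]. *)
pose code := c ++ [:: IJz 1 2; IStop; IBack 0].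
have [e he] := quadrant_encoding (@local_rule code).
exists e => b hb; rewrite /labelling -he.
have at_c : code_at code 0 c by move=> i hi; rewrite add0n nth_cat hi.
have [R [[n hn] R1 _]] := compile_correct hb (R := start_regs e) (args := [:: 0]) (fr := 1) at_c isT erefl.
have st : state_at code e n = (size c, R) by rewrite /state_at hn.
have hnth i : nth IStop code (size c + i) = nth IStop [:: IJz 1 2; IStop; IBack 0] i.
  by rewrite nth_cat ltnNge leq_addr /= addKn.
have st1 : state_at code e n.+1 = (if b then (size c).+1 else size c + 2, R).
  rewrite /state_at iterS -/(state_at code e n) st /=.
  by have := hnth 0; rewrite addn0 => -> /=; rewrite R1; case: b {hb R1}.
split=> [[l hl]|b0].
  have := (spacetime_sound hl n.+1).1; rewrite st1.
  by case: b {hb R1 st1} => //; have := hnth 1; rewrite addn1 => ->.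
apply: spacetime_complete => k; apply/negP => hk.
have loop j : iter j (mstep code) (size c + 2, R) = (size c + 2, R).
  by elim: j => // j IH; rewrite iterS IH /= hnth /= subn0.
have e1 : state_at code e (k + n.+1) = (size c + 2, R).
  by rewrite /state_at iterD -/(state_at code e n.+1) st1 b0 loop.
have e2 : state_at code e (n.+1 + k) = state_at code e k.
  by rewrite {1}/state_at iterD -/(state_at code e k); case: (state_at code e k) hk => pc R' hk; rewrite iter_stop.
by move: hk; rewrite -e2 addnC e1 /= hnth.
Qed.

(** * The nearest-neighbour system *)

(** The first summand bounds a label [u + e * t] with u < e and t at most [e]; 30 exceeds the
    counters modulo 27. *)
Definition radix e := e * e.+1 + 30.
Definition nsym e := radix e ^ 18.
Definition digit e (s j : nat) := (s %/ radix e ^ j) %% radix e.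

(* Digits 0-6 (p = 2) and 7-13 (p = 3): residue and unit part of the column, of
   the row, comparison code, row phase, column phase; digit 14: label of the
   column; digits 15-17: the labels L(a,b), L(a+1,b), L(a,b+1) known to a row of
   levels (a,b).  A label is [u + e * t] with [u] a symbol and [t = min(a,e)]. *)
Definition ruler_cell p (c : nat -> nat) (o : nat) : bool :=
  half_rule p (c (o + 2)) (c o) (c o.+1) (c (o + 4)) (c (o + 5)) &&
  half_rule p (c o) (c (o + 2)) (c (o + 3)) (flip (c (o + 4))) (c (o + 6)).

Definition label_cell (c : nat -> nat) : bool :=
  [&& (c 4 == 3) && (c 11 == 3) ==> (c 14 == c 15),
      (c 4 == 4) && (c 11 == 3) ==> (c 14 == c 16) &
      (c 4 == 3) && (c 11 == 4) ==> (c 14 == c 17)].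

(** Residues show only whether a is 0; the capped count t in the label makes the flag [a < e]
    available. The count is fixed by induction on a, separately for each b. *)
Definition row_cell e (c : nat -> nat) : bool :=
  [&& allowed e (level 2 (c 2) == 0) (level 3 (c 9) == 0) (c 15 %/ e < e)
        (c 15 %% e) (c 16 %% e) (c 17 %% e),
      (level 2 (c 2) == 0) ==> (c 15 %/ e == 0) &
      c 16 %/ e == minn (c 15 %/ e).+1 e].

Definition cell_ok e (c : nat -> nat) : bool :=
  [&& ruler_cell 2 c 0, ruler_cell 3 c 7, label_cell c & row_cell e c].

Definition ruler_right p (c c' : nat -> nat) (o : nat) : bool :=
  [&& c' o == (c o).+1 %% p ^ 2, c' (o + 2) == c (o + 2), c' (o + 3) == c (o + 3)
    & c' (o + 5) == (c (o + 5) + ~~ skipped (c' (o + 4))) %% p ^ 3].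

Definition ruler_up p (c c' : nat -> nat) (o : nat) : bool :=
  [&& c' (o + 2) == (c (o + 2)).+1 %% p ^ 2, c' o == c o, c' o.+1 == c o.+1
    & c' (o + 6) == (c (o + 6) + ~~ skipped (flip (c' (o + 4)))) %% p ^ 3].

Definition right_ok e (c c' : nat -> nat) : bool :=
  [&& cell_ok e c, ruler_right 2 c c' 0, ruler_right 3 c c' 7,
      c' 15 == c 15, c' 16 == c 16 & c' 17 == c 17].

Definition up_ok e (c c' : nat -> nat) : bool :=
  [&& cell_ok e c, ruler_up 2 c c' 0, ruler_up 3 c c' 7 & c' 14 == c 14].

Definition hrel e (s s' : nat) : bool := right_ok e (digit e s) (digit e s').
Definition vrel e (s s' : nat) : bool := up_ok e (digit e s) (digit e s').

Definition sft_config e (s : int -> int -> nat) : Prop :=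
  forall i k, [/\ s i k < nsym e, hrel e (s i k) (s (i + 1)%R k)
    & vrel e (s i k) (s i (k + 1)%R)].

Lemma succ_mod_neq m x : 1 < m -> x != x.+1 %% m.
Proof.
move=> m1; apply/eqP => h; have : x < m by rewrite h ltn_pmod // ltnW.
move=> xm; move: h; case: (eqVneq x.+1 m) => [em|ne]; first by rewrite em modnn; lia.
by rewrite modn_small; lia.
Qed.

Lemma hrel_irrefl e s : ~~ hrel e s s.
Proof.
apply/negP => /and3P [_ /and4P [/eqP h _ _ _] _]; move/eqP: h.
by apply/negP; apply: succ_mod_neq.
Qed.

Lemma vrel_irrefl e s : ~~ vrel e s s.
Proof.
apply/negP => /and3P [_ /and4P [/eqP h _ _ _] _]; move/eqP: h.
by apply/negP; apply: succ_mod_neq.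
Qed.

Lemma radix_gt0 e : 0 < radix e. Proof. by rewrite /radix addn_gt0 orbT. Qed.

Lemma digits_exist e n (c : nat -> nat) : (forall j, j < n -> c j < radix e) ->
  exists s, s < radix e ^ n /\ forall j, j < n -> digit e s j = c j.
Proof.
have B0 := radix_gt0 e.
elim: n => [_|n IH h]; first by exists 0.
have [s [sn hs]] := IH (fun j hj => h j (ltnW hj : j < n.+1)).
exists (s + c n * radix e ^ n); split.
  rewrite expnS; have := h n (ltnSn n); move: sn; move: (radix e ^ n) (radix e) => *; nia.
move=> j; rewrite ltnS leq_eqVlt /digit => /orP [/eqP ->|jn].
  by rewrite addnC divnMDl ?expn_gt0 ?B0 // divn_small // addn0 modn_small // h.
rewrite -(hs j jn) /digit.
have -> : c n * radix e ^ n = (c n * radix e ^ (n - j.+1) * radix e) * radix e ^ j.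
  by rewrite -!mulnA -expnS -expnD; congr (_ * _ ^ _); lia.
by rewrite addnC divnMDl ?expn_gt0 ?B0 // modnMDl.
Qed.

Lemma int_const (f : int -> nat) : (forall m, f (m + 1)%R = f m) -> forall m, f m = f 0%R.
Proof.
move=> h m; apply: (@int_ind2 (fun m => f m = f 0%R) 0%R) => // k.
by rewrite h.
Qed.

(** The integers A + 2^a modulo 2^(a+1) and B + 3^b modulo 3^(b+1) have the required exact
    valuations. *)
Lemma exact_exists (A B : int) a b : exists i : int,
  [/\ dvd_pow 2 a (i - A), ~~ dvd_pow 2 a.+1 (i - A),
      dvd_pow 3 b (i - B) & ~~ dvd_pow 3 b.+1 (i - B)].
Proof.
have co : coprimez (Posz (2 ^ a.+1)) (Posz (3 ^ b.+1)).
  by rewrite coprimezE /= coprimeXl // coprimeXr.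
pose r1 := (A + Posz (2 ^ a))%R; pose r2 := (B + Posz (3 ^ b))%R.
exists (zchinese (Posz (2 ^ a.+1)) (Posz (3 ^ b.+1)) r1 r2).
set i := zchinese _ _ _ _.
have h1 : dvd_pow 2 a.+1 (i - r1) by rewrite /dvd_pow -eqz_mod_dvd; apply/eqP/zchinese_modl.
have h2 : dvd_pow 3 b.+1 (i - r2) by rewrite /dvd_pow -eqz_mod_dvd; apply/eqP/zchinese_modr.
have aux p c C : 1 < p -> dvd_pow p c.+1 (i - (C + Posz (p ^ c)))%R ->
    dvd_pow p c (i - C) /\ ~~ dvd_pow p c.+1 (i - C).
  move=> p1 h; have e : (i - C = (i - (C + Posz (p ^ c))) + Posz (p ^ c))%R by lia.
  rewrite e /dvd_pow rpredDl; last exact: (dvd_powW (leqnSn c) h).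
  rewrite rpredDl //; split; first exact: dvdzz.
  rewrite dvdzE /=; apply/negP => /dvdn_leq; rewrite expn_gt0 ltnW // => /(_ isT).
  by rewrite leq_exp2l // ltnn.
by have [? ?] := aux 2 a A isT h1; have [? ?] := aux 3 b B isT h2; split.
Qed.

Section Sound.
Variables (e : nat) (s : int -> int -> nat).
Hypothesis conf : sft_config e s.

Let c i k := digit e (s i k).
Let col j i := c i 0%R j.
Let row j k := c 0%R k j.

Lemma conf_cell i k : cell_ok e (c i k).
Proof. by have [_ /and3P [h _] _] := conf i k. Qed.

Lemma conf_right i k : right_ok e (c i k) (c (i + 1)%R k).
Proof. by have [] := conf i k. Qed.

Lemma conf_up i k : up_ok e (c i k) (c i (k + 1)%R).
Proof. by have [] := conf i k. Qed.

Lemma colE j i k : j \in [:: 0; 1; 7; 8; 14] -> c i k j = col j i.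
Proof.
move=> hj; apply: (@int_const (fun k => c i k j)) => {}k.
have /and4P [_ /and4P [_ /eqP h0 /eqP h1 _] /and4P [_ /eqP h7 /eqP h8 _] /eqP h14] := conf_up i k.
by move: hj; rewrite !inE => /or4P [/eqP ->|/eqP ->|/eqP ->|/orP [/eqP ->|/eqP ->]].
Qed.

Lemma rowE j i k : j \in [:: 2; 3; 9; 10; 15; 16; 17] -> c i k j = row j k.
Proof.
move=> hj; apply: (@int_const (fun i => c i k j)) => {}i.
have /and4P [_ /and4P [_ /eqP h0 /eqP h1 _] /and4P [_ /eqP h7 /eqP h8 _]
  /and3P [/eqP h15 /eqP h16 /eqP h17]] := conf_right i k.
move: hj; rewrite !inE => /or4P [/eqP ->|/eqP ->|/eqP ->|/or4P [/eqP ->|/eqP ->|/eqP ->|/eqP ->]] //.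
Qed.

Lemma conf_ruler p o : (p, o) \in [:: (2, 0); (3, 7)] ->
  ruler p (col o) (col o.+1) (row (o + 2)) (row (o + 3))
    (fun i k => c i k (o + 4)) (fun i k => c i k (o + 5)) (fun i k => c i k (o + 6)).
Proof.
move=> hpo.
have p0 : 0 < p by move: hpo; rewrite !inE => /orP [/eqP [-> _]|/eqP [-> _]].
have hc j i k : j \in [:: o; o.+1] -> c i k j = col j i.
  move=> hj; apply: colE; move: hpo hj; rewrite !inE => /orP [/eqP [_ ->]|/eqP [_ ->]] /orP [/eqP ->|/eqP ->] //.
have hr j i k : j \in [:: o + 2; o + 3] -> c i k j = row j k.
  move=> hj; apply: rowE; move: hpo hj; rewrite !inE => /orP [/eqP [_ ->]|/eqP [_ ->]] /orP [/eqP ->|/eqP ->] //.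
have cell i k : ruler_cell p (c i k) o.
  have /and4P [h1 h2 _ _] := conf_cell i k.
  by move: hpo; rewrite !inE => /orP [/eqP [-> ->]|/eqP [-> ->]].
have right i k : ruler_right p (c i k) (c (i + 1)%R k) o.
  have /and4P [_ h1 h2 _] := conf_right i k.
  by move: hpo; rewrite !inE => /orP [/eqP [-> ->]|/eqP [-> ->]].
have up i k : ruler_up p (c i k) (c i (k + 1)%R) o.
  have /and4P [_ h1 h2 _] := conf_up i k.
  by move: hpo; rewrite !inE => /orP [/eqP [-> ->]|/eqP [-> ->]].
have mem0 : o \in [:: o; o.+1] by rewrite inE eqxx.
have mem1 : o.+1 \in [:: o; o.+1] by rewrite !inE eqxx orbT.
have mem2 : o + 2 \in [:: o + 2; o + 3] by rewrite inE eqxx.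
have mem3 : o + 3 \in [:: o + 2; o + 3] by rewrite !inE eqxx orbT.
have stepc i : col o (i + 1)%R = (col o i).+1 %% p ^ 2.
  by have /and4P [/eqP h _ _ _] := right i 0%R; exact: h.
have stepr k : row (o + 2) (k + 1)%R = (row (o + 2) k).+1 %% p ^ 2.
  by have /and4P [/eqP h _ _ _] := up 0%R k; exact: h.
have pf i k : c (i + 1)%R k (o + 5) = (c i k (o + 5) + ~~ skipped (c (i + 1)%R k (o + 4))) %% p ^ 3.
  by have /and4P [_ _ _ /eqP ->] := right i k.
have ps i k : c i (k + 1)%R (o + 6) = (c i k (o + 6) + ~~ skipped (flip (c i (k + 1)%R (o + 4)))) %% p ^ 3.
  by have /and4P [_ _ _ /eqP ->] := up i k.
split; split=> //.
- by move=> i; rewrite -[i](subrK 1%R) stepc ltn_pmod // expn_gt0 p0.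
- by move=> i k; have /andP [h _] := cell i k; rewrite -(hr _ i k mem2) -(hc _ i k mem0) -(hc _ i k mem1).
- by move=> i k; rewrite -[i](subrK 1%R) pf ltn_pmod // expn_gt0 p0.
- by move=> i; rewrite -[i](subrK 1%R) stepr ltn_pmod // expn_gt0 p0.
- by move=> k i; have /andP [_ h] := cell i k; rewrite -(hr _ i k mem2) -(hr _ i k mem3) -(hc _ i k mem0).
by move=> k i; rewrite -[k](subrK 1%R) ps ltn_pmod // expn_gt0 p0.
Qed.

(** L(a,b) is read on one chosen row of levels (a,b). Every column of these levels crosses it with
    both codes 3 and so has the same label; through the columns, the labels kept by different rows
    are identified. *)
Lemma labelling_of_config : exists l, labelling e l.
Proof.
have [A2 [B2 h2]] := ruler_offsets (isT : 1 < 2) (conf_ruler (mem_head _ _) : ruler 2 _ _ _ _ _ _ _).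
have [A3 [B3 h3]] := ruler_offsets (isT : 1 < 3) (conf_ruler (isT : (3, 7) \in [:: (2, 0); (3, 7)]) : ruler 3 _ _ _ _ _ _ _).
pose exact p (C : nat -> int) a i := dvd_pow p a (i - C a) && ~~ dvd_pow p a.+1 (i - C a).
have exC (C D : nat -> int) a b : exists i, exact 2 C a i && exact 3 D b i.
  by have [i [? ? ? ?]] := exact_exists (C a) (D b) a b; exists i; rewrite /exact; apply/andP; split; apply/andP.
have [kk hkk] := boolp.choice (fun ab : nat * nat => exC B2 B3 ab.1 ab.2).
have tr p zc zr t (A B : nat -> int) a : 1 < p ->
   (forall c, [/\ dvd_pow p c.+2 (A c - A c.+1), dvd_pow p c.+2 (B c - B c.+1)
     & ruled p zc zr t c (A c) (B c)]) -> forall i k, exact p B a k ->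
   (exact p A a i -> t i k = 3) /\ (exact p A a.+1 i -> t i k = 4).
  move=> p1 h i k /andP [k1 k2]; have [hA _ [kn _ _ _]] := h a.
  split=> /andP [i1 i2].
    rewrite (kn a i k (ltnSn a) k1 k2 i1) (negbTE i2) ifN //.
    by apply: contraNN i2; apply: dvd_powW.
  (* The centres of levels a and a + 1 agree modulo p^(a+2), enough to compare exact valuation a + 1
     with either. *)
  rewrite !(dvd_pow_eqmod p1 _ hA) // in i1 i2.
  by rewrite (kn a i k (ltnSn a) k1 k2 (dvd_powW (leqnSn a) i1)) (negbTE i2) i1.
have lev p zc zr t (A B : nat -> int) a k : 
   (forall c, [/\ dvd_pow p c.+2 (A c - A c.+1), dvd_pow p c.+2 (B c - B c.+1)
     & ruled p zc zr t c (A c) (B c)]) -> exact p B a k -> (level p (zr k) == 0) = (a == 0).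
  move=> h /andP [k1 k2]; have [_ _ [_ _ _ tk]] := h a.
  have := tracks_dvd k tk (leqnSn 1); rewrite expn1 /level => ->.
  case: a k1 k2 {tk} => [_ ->//|a k1 _]; rewrite (dvd_powW _ k1) //=.
  by case: ifP.
pose L a b := row 15 (kk (a, b)).
have xL a b i : exact 2 A2 a i -> exact 3 A3 b i -> col 14 i = L a b.
  move=> e2 e3; have /andP [k2 k3] := hkk (a, b).
  have /and4P [_ _ /and3P [/implyP h _ _] _] := conf_cell i (kk (a, b)).
  have t2 := (tr 2 _ _ _ _ _ _ isT h2 i _ k2).1 e2; have t3 := (tr 3 _ _ _ _ _ _ isT h3 i _ k3).1 e3.
  by rewrite /L -(colE i (kk (a, b))) // -(@rowE 15 i) //; apply/eqP/h; rewrite t2 t3.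
have L1 a b : L a.+1 b = row 16 (kk (a, b)).
  have [i /andP [e2 e3]] := exC A2 A3 a.+1 b; have /andP [k2 k3] := hkk (a, b).
  have /and4P [_ _ /and3P [_ /implyP h _] _] := conf_cell i (kk (a, b)).
  have t2 := (tr 2 _ _ _ _ _ _ isT h2 i _ k2).2 e2; have t3 := (tr 3 _ _ _ _ _ _ isT h3 i _ k3).1 e3.
  by rewrite -(xL _ _ i) // -(colE i (kk (a, b))) // -(@rowE 16 i) //; apply/eqP/h; rewrite t2 t3.
have L2 a b : L a b.+1 = row 17 (kk (a, b)).
  have [i /andP [e2 e3]] := exC A2 A3 a b.+1; have /andP [k2 k3] := hkk (a, b).
  have /and4P [_ _ /and3P [_ _ /implyP h] _] := conf_cell i (kk (a, b)).
  have t2 := (tr 2 _ _ _ _ _ _ isT h2 i _ k2).1 e2; have t3 := (tr 3 _ _ _ _ _ _ isT h3 i _ k3).2 e3.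
  by rewrite -(xL _ _ i) // -(colE i (kk (a, b))) // -(@rowE 17 i) //; apply/eqP/h; rewrite t2 t3.
have rowc a b : [/\ allowed e (a == 0) (b == 0) (L a b %/ e < e) (L a b %% e) (L a.+1 b %% e) (L a b.+1 %% e),
   a = 0 -> L a b %/ e = 0 & L a.+1 b %/ e = minn (L a b %/ e).+1 e].
  have /andP [k2 k3] := hkk (a, b).
  have /and4P [_ _ _ /and3P [h /implyP h' /eqP h'']] := conf_cell 0%R (kk (a, b)).
  rewrite L1 L2 -(lev _ _ _ _ _ _ _ _ h2 k2) -(lev _ _ _ _ _ _ _ _ h3 k3).
  split=> // a0; apply/eqP/h'; rewrite (lev _ _ _ _ _ _ _ _ h2 k2) a0 //.
have tE a b : L a b %/ e = minn a e.
  elim: a => [|a IH]; first by have [_ -> //] := rowc 0 b; rewrite min0n.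
  by have [_ _ ->] := rowc a b; rewrite IH; lia.
exists (fun a b => L a b %% e) => a b.
by have [h _ _] := rowc a b; move: h; rewrite tE; have -> : (minn a e < e) = (a < e) by lia.
Qed.

End Sound.

Section Complete.
Variables (e : nat) (l : nat -> nat -> nat).
Hypothesis lab : labelling e l.

(** Row or column 0 only has codes 0, 1 and 5, so no equality of labels is demanded there; its
    residue reads as a nonzero level, and 1 is such a level. *)
Let lvl p (k : int) := if k == 0%R then 1 else val_of p k.
Let L a b := l a b + minn a e * e.
Let comps (i k : int) (j : nat) : nat :=
  nth 0 [:: std_digit 2 i; std_unit 2 i; std_digit 2 k; std_unit 2 k;
            std_code 2 i k; std_phase 2 i k; std_phase 2 k i;
            std_digit 3 i; std_unit 3 i; std_digit 3 k; std_unit 3 k;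
            std_code 3 i k; std_phase 3 i k; std_phase 3 k i;
            L (lvl 2 i) (lvl 3 i); L (lvl 2 k) (lvl 3 k);
            L (lvl 2 k).+1 (lvl 3 k); L (lvl 2 k) (lvl 3 k).+1] j.

Lemma lab_lt a b : l a b < e.
Proof. by have [] := allowed_lt (lab a b). Qed.

Lemma L_mod a b : L a b %% e = l a b.
Proof. by rewrite /L addnC modnMDl modn_small // lab_lt. Qed.

Lemma L_div a b : L a b %/ e = minn a e.
Proof.
have := lab_lt a b => h; have e0 : 0 < e by lia.
by rewrite /L addnC divnMDl // divn_small // addn0.
Qed.

Lemma L_lt a b : L a b < radix e.
Proof.
have := lab_lt a b; rewrite /L /radix; have : minn a e <= e by rewrite geq_minr.
move: (minn a e) => t; nia.
Qed.

Lemma std_code_lt p i k : std_code p i k < 6.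
Proof. by rewrite /std_code /cmp_code; do ![case: ifP => // _]. Qed.

Lemma comps_lt i k j : comps i k j < radix e.
Proof.
have r30 : 30 <= radix e by rewrite /radix leq_addl.
have hd p q x : 0 < p -> p ^ q <= 30 -> modn_int x (p ^ q) < radix e.
  by move=> p0 p30; apply: leq_trans (leq_trans p30 r30); rewrite modn_int_lt // expn_gt0 p0.
have hc p x y : std_code p x y < radix e by apply: leq_trans (leq_trans (std_code_lt p x y) _) r30.
rewrite /comps; set sq := [:: _, _ & _].
have /(all_nthP 0) h : all (fun x => x < radix e) sq by rewrite /= !hd // !hc !L_lt.
case: (ltnP j (size sq)) => hj; first exact: h.
by rewrite nth_default // radix_gt0.
Qed.

Lemma std_level p k : prime p -> (level p (std_digit p k) == 0) = (lvl p k == 0).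
Proof.
move=> pp; rewrite /lvl; case: (eqVneq k 0%R) => [->|k0]; first by rewrite level_std0.
by rewrite level_std //; lia.
Qed.

Lemma std_code3 p i k : std_code p i k = 3 -> lvl p i = lvl p k.
Proof.
rewrite /std_code /lvl; case: (eqVneq i 0%R) => _; case: (eqVneq k 0%R) => _ //.
by rewrite /cmp_code; do 2![case: ifP => // _]; case: eqP => // _; case: ifP.
Qed.

Lemma std_code4 p i k : std_code p i k = 4 -> lvl p i = (lvl p k).+1.
Proof.
rewrite /std_code /lvl; case: (eqVneq i 0%R) => _; case: (eqVneq k 0%R) => _ //.
by rewrite /cmp_code; do 3![case: ifP => // _]; case: eqP.
Qed.

Lemma comps_ok i k : cell_ok e (comps i k).
Proof.
have [[_ _ r2 _ _] [_ _ s2 _ _]] := ruler_std (isT : prime 2).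
have [[_ _ r3 _ _] [_ _ s3 _ _]] := ruler_std (isT : prime 3).
rewrite /cell_ok /ruler_cell /comps /= r2 s2 r3 s3 /=; apply/andP; split.
  apply/and3P; split; apply/implyP => /andP [/eqP h2 /eqP h3].
  - by rewrite (std_code3 h2) (std_code3 h3).
  - by rewrite (std_code4 h2) (std_code3 h3).
  by rewrite (std_code3 h2) (std_code4 h3).
rewrite /row_cell /= !L_mod !L_div !std_level //; apply/and3P; split.
- have -> : (minn (lvl 2 k) e < e) = (lvl 2 k < e) by lia. exact: lab.
- by apply/implyP => /eqP ->; rewrite min0n.
by apply/eqP; lia.
Qed.

Lemma comps_right i k : right_ok e (comps i k) (comps (i + 1)%R k).
Proof.
have [[a2 _ _ _ b2] _] := ruler_std (isT : prime 2).
have [[a3 _ _ _ b3] _] := ruler_std (isT : prime 3).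
rewrite /right_ok comps_ok /ruler_right /comps /= !eqxx !andbT.
by rewrite a2 a3 b2 b3 !eqxx.
Qed.

Lemma comps_up i k : up_ok e (comps i k) (comps i (k + 1)%R).
Proof.
have [_ [a2 _ _ _ b2]] := ruler_std (isT : prime 2).
have [_ [a3 _ _ _ b3]] := ruler_std (isT : prime 3).
rewrite /up_ok comps_ok /ruler_up /comps /= !eqxx !andbT.
by rewrite a2 a3 b2 b3 !eqxx.
Qed.

Lemma config_of_labelling : exists s, sft_config e s.
Proof.
have ex (ik : int * int) := digits_exist (fun j (_ : j < 18) => comps_lt ik.1 ik.2 j).
have [s hs] := boolp.choice ex.
have dg i k j : j < 18 -> digit e (s (i, k)) j = comps i k j by move=> hj; rewrite (hs (i, k)).2.
exists (fun i k => s (i, k)) => i k; split; first exact: (hs (i, k)).1.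
  rewrite /hrel; have := comps_right i k.
  rewrite /right_ok /cell_ok /ruler_cell /label_cell /row_cell /ruler_right /=.
  by rewrite !dg.
rewrite /vrel; have := comps_up i k.
rewrite /up_ok /cell_ok /ruler_cell /label_cell /row_cell /ruler_up /=.
by rewrite !dg.
Qed.

End Complete.

Lemma sft_labelling e : (exists l, labelling e l) <-> (exists s, sft_config e s).
Proof.
split=> [[l hl]|[s hs]]; [exact: config_of_labelling hl|exact: labelling_of_config hs].
Qed.

(** * Cross-sections of the tiles *)

Definition inbox (a b x : nat) : bool := (a <= x) && (x < b).

(* Horizontal cross-sections.  Each [|| ... ] lists ridges of the section, each
   [&& ~~ ...] the slots in which ridges of neighbouring tiles end. *)
Definition sec_enc (x y : nat) : bool :=
  [|| [&& inbox 2 22 x, inbox 4 24 y,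
          ~~ (((x < 4) || (20 <= x)) && ((y < 10) || (18 <= y))),
          ~~ ((y == 11) && (x < 5)), ~~ ((y == 16) && (20 <= x)),
          ~~ ((x == 8) && (y < 8)), ~~ ((x == 9) && (y == 7)),
          ~~ ((x == 13) && (20 <= y)), ~~ ((x == 14) && (y == 20)) &
          ~~ ((y == 8) && (x < 6))],
      (y == 11) && inbox 22 25 x, (y == 16) && (x < 2),
      (x == 8) && inbox 24 28 y, (x == 9) && (y == 27),
      (x == 13) && (y < 4), (x == 14) && (y == 0) |
      (y == 8) && inbox 20 23 x].

Definition sec_ref (x y : nat) : bool :=
  [&& x < 4, y < 12 & ~~ ((y == 10) && (x < 3))] || (y == 10) && inbox 4 6 x.

Definition sec (k x y : nat) : bool :=
  [&& x < 25, y < 28 & if k == 0 then sec_enc x y else sec_ref x y].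

(* A bump of the encoder at column (bx,by) faces the dents of the host [hk] at
   column (qx,qy); the host lies at lattice offset (di,dj) - (1,1). *)
Record contact := Contact {
  ctype : nat; bx : nat; by_ : nat; hk : nat; qx : nat; qy : nat; di : nat; dj : nat }.

(** Type 0 faces the encoder to the right, type 1 the one above, type 2 the four surrounding
    pillars; thus any two neighbouring encoders touch two common pillars. *)
Definition contacts : seq contact :=
  [:: Contact 0 22 12 0 2 12 2 1; Contact 1 7 24 0 7 4 1 2;
      Contact 2 3 4 1 3 6 1 1; Contact 2 3 21 1 3 3 1 2;
      Contact 2 20 4 1 0 6 2 1; Contact 2 20 21 1 0 3 2 2].

(** The hole serves twice: the cell left in the middle of a dent aligns bumps modulo 3 in height,
    and the hole of a ring cannot be filled by a ring. *)
Definition ring (a b : nat) : bool := [&& a < 3, b < 3 & ~~ ((a == 1) && (b == 1))].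

Definition in_dent (t : contact) k x y : bool :=
  [&& hk t == k, x == qx t & inbox (qy t) (qy t + 3) y].
Definition in_bump (t : contact) x y : bool := (x == bx t) && inbox (by_ t) (by_ t + 3) y.

(** [sol] keeps the columns occupied at every height, [shadow] contains all that are occupied at
    some height: collisions are derived on the former, positions enumerated over the latter. *)
Definition sol k x y : bool := sec k x y && ~~ has (fun t => in_dent t k x y) contacts.
Definition shadow k x y : bool :=
  sec k x y || ((k == 0) && has (fun t => in_bump t x y) contacts).

(** Written with [if], because [vm_compute] would evaluate both arguments of a conjunction; the
    later checks use it for the same reason. *)
Fixpoint allnat (P : nat -> bool) m : bool :=
  if m is m'.+1 then (if P m' then allnat P m' else false) else true.
Definition allbox (P : nat -> nat -> bool) : bool := allnat (fun x => allnat (P x) 28) 25.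

Lemma allnatP P m : allnat P m -> forall x, x < m -> P x.
Proof.
elim: m => //= m IH; case: ifP => // Pm /IH {}IH x.
by rewrite ltnS leq_eqVlt => /orP [/eqP ->|/IH].
Qed.

Lemma allboxP P : allbox P -> forall x y, x < 25 -> y < 28 -> P x y.
Proof. by move=> /allnatP h x y /h /allnatP; apply. Qed.

Lemma shadow_box k x y : shadow k x y -> x < 25 /\ y < 28.
Proof.
rewrite /shadow /sec => /orP [/and3P [-> -> //]|/andP [_]].
by rewrite /= /in_bump /inbox /=; lia.
Qed.

(** A few points that suffice to witness a collision at every wrong placement, which keeps the
    exhaustive check short. *)
Definition probes (k : nat) : seq (nat * nat) :=
  if k == 0 then [:: (16, 16); (7, 7); (19, 23); (0, 16); (22, 8); (9, 27); (2, 10);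
                     (21, 17); (10, 4); (19, 19); (15, 20); (18, 13)]
  else [:: (2, 5); (1, 1); (3, 11); (0, 0); (3, 9); (2, 0); (0, 9)].

(* The slot (dx,dy) of a section is too deep to be covered by a tile that is not
   at an allowed place: elsewhere one of the probes meets a solid column. *)
Definition slot_ok (k dx dy : nat) (allow : nat -> nat -> nat -> bool) : bool :=
  [&& ~~ shadow k dx dy, sol k dx dy.+1, 0 < dy, sol k dx dy.-1 &
  all (fun k' => allbox (fun px py =>
    if shadow k' px py then
      if allow k' px py then true else
      has (fun q => if px <= q.1 + dx then if py <= q.2 + dy then
          if sol k (q.1 + dx - px) (q.2 + dy - py) then sol k' q.1 q.2 else false
        else false else false) (probes k')
    else true)) [:: 0; 1]].

(** The cell (24,11) is the tip of the right-hand ridge of an encoder, and (4,11) - (24,11) =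
    (-20,0) is the step to the left neighbour. The next four slots pin the other neighbours and the
    pillar likewise. *)
Lemma slot_left : slot_ok 0 4 11 (fun k x y => [&& k == 0, x == 24 & y == 11]).
Proof. by vm_compute. Qed.
Lemma slot_right : slot_ok 0 20 16 (fun k x y => [&& k == 0, x == 0 & y == 16]).
Proof. by vm_compute. Qed.
Lemma slot_down : slot_ok 0 9 7 (fun k x y => [&& k == 0, x == 9 & y == 27]).
Proof. by vm_compute. Qed.
Lemma slot_up : slot_ok 0 14 20 (fun k x y => [&& k == 0, x == 14 & y == 0]).
Proof. by vm_compute. Qed.
Lemma slot_corner : slot_ok 0 5 8 (fun k x y => [&& k == 1, x == 5 & y == 10]).
Proof. by vm_compute. Qed.
(** Only the kind of the intruder is needed: a tiling with a pillar contains an encoder. *)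
Lemma slot_ref : slot_ok 1 2 10 (fun k x y => k == 0).
Proof. by vm_compute. Qed.

(* Sections are compared in the frame where E(i,j) and R(i,j) both have
   y-coordinate 20 j - 6 at 0. *)
Definition yoff (k : nat) : nat := if k == 0 then 2 else 0.

(* The cells of both sections that lie at (u,w) modulo 20 in that frame. *)
Definition representatives u w : seq (nat * nat * nat) :=
  flatten [seq let y := (w + 20 - yoff k) %% 20 in
    [:: (k, u, y); (k, u + 20, y); (k, u, y + 20); (k, u + 20, y + 20)] | k <- [:: 0; 1]].

Definition representing u w :=
  [seq t <- representatives u w | sec t.1.1 t.1.2 t.2].

(** The two sections together are a fundamental domain for translations by multiples of 20 in both
    directions. *)
Lemma representing_checked :
  allnat (fun u => allnat (fun w => size (representing u w) == 1) 20) 20.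
Proof. by vm_compute. Qed.

Lemma representing1 u w : u < 20 -> w < 20 -> exists t, representing u w = [:: t].
Proof.
move=> hu hw; have := allnatP (allnatP representing_checked hu) hw.
by case: (representing u w) => [|t [|]] // _; exists t.
Qed.

Lemma mem_representing k x y : k < 2 -> sec k x y ->
  (k, x, y) \in representing (x %% 20) ((y + yoff k) %% 20).
Proof.
move=> k2 hs; rewrite mem_filter hs /=; have /and3P [hx hy _] := hs.
have ex : x = x %% 20 \/ x = x %% 20 + 20 by lia.
have yk : yoff k <= 2 by rewrite /yoff; case: ifP.
have : y = ((y + yoff k) %% 20 + 20 - yoff k) %% 20 \/
       y = ((y + yoff k) %% 20 + 20 - yoff k) %% 20 + 20 by lia.
case: k k2 {hs yk} => [|[|//]] _; rewrite !mem_cat;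
move: (x %% 20) ((_ - _) %% 20) ex => u v ex ey;
by case: ex => ->; case: ey => ->; rewrite !inE !eqxx ?orbT.
Qed.

Lemma sections_disjoint k k' x y x' y' : k < 2 -> k' < 2 -> sec k x y -> sec k' x' y' ->
  x = x' %[mod 20] -> y + yoff k = y' + yoff k' %[mod 20] -> [/\ k = k', x = x' & y = y'].
Proof.
move=> hk hk' hs hs' ex ey.
have := mem_representing hk hs; have := mem_representing hk' hs'; rewrite -ex -ey.
have [t ->] := representing1 (ltn_pmod x (isT : 0 < 20)) (ltn_pmod (y + yoff k) (isT : 0 < 20)).
by rewrite !inE => /eqP <- /eqP [-> -> ->].
Qed.

Lemma sections_cover x y : x < 20 -> y < 20 -> exists k x' y',
  [/\ k < 2, sec k x' y', x' = x %[mod 20] & y' + yoff k = y %[mod 20]].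
Proof.
move=> hx hy; have [[[k x'] y'] et] := representing1 hx hy.
have : (k, x', y') \in representing x y by rewrite et inE.
rewrite mem_filter => /andP [hs]; rewrite /representatives /= !inE !xpair_eqE => hm; exists k, x', y'.
have h : [&& k < 2, x' %% 20 == x %% 20 & (y' + yoff k) %% 20 == y %% 20].
  move: hm.
  by do 7![case/orP; first by move=> /andP [/andP [/eqP -> /eqP ->] /eqP ->]; rewrite /yoff /=; lia];
    move=> /andP [/andP [/eqP -> /eqP ->] /eqP ->]; rewrite /yoff /=; lia.
by have /and3P [h1 /eqP h2 /eqP h3] := h.
Qed.

Lemma contact_frames t : List.In t contacts ->
  [/\ hk t < 2, ctype t < 3, bx t + 20 = qx t + 20 * di t & by_ t + 2 + 20 = qy t + yoff (hk t) + 20 * dj t].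
Proof. by move=> /= [<-|[<-|[<-|[<-|[<-|[<-|//]]]]]]. Qed.

Definition dent_at t x y : bool := if in_dent t (hk t) x y then sec (hk t) x y else true.

Lemma dent_checked t : List.In t contacts -> allbox (dent_at t).
Proof. by move=> /= [<-|[<-|[<-|[<-|[<-|[<-|//]]]]]]; vm_compute. Qed.

Lemma dent_sec t k x y : List.In t contacts -> in_dent t k x y -> sec k x y.
Proof.
move=> ht hd.
have [hx hy] : x < 25 /\ y < 28.
  move: hd; rewrite /in_dent /inbox.
  by move: ht => /= [<-|[<-|[<-|[<-|[<-|[<-|//]]]]]] /=; lia.
have hk1 : hk t = k by move: hd => /and3P [/eqP].
rewrite -hk1 in hd *.
have := allboxP (dent_checked ht) hx hy; by rewrite /dent_at hd.
Qed.

Lemma dent_inj t t' k x y : List.In t contacts -> List.In t' contacts ->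
  in_dent t k x y -> in_dent t' k x y -> t = t'.
Proof.
by move=> /= [<-|[<-|[<-|[<-|[<-|[<-|//]]]]]] [<-|[<-|[<-|[<-|[<-|[<-|//]]]]]] //;
rewrite /in_dent /inbox /=; lia.
Qed.

(** * Every tiling encodes a configuration *)

(** The factor 4 leaves room: a difference of two shift differences stays below the height, so
    congruences between them become equalities. In [height], 3 is the size of a ring. *)
Definition modulus n := 2 ^ (n + 2).
Definition height n := 3 * modulus n.

(* Each encoder, shifted by 3 * 2^u, has its bumps at the bottom, so a dent at
   height 3 * m accepts exactly the shift differences 3 * m modulo the height. *)
Definition difference_set n (r : nat -> nat -> bool) m : bool :=
  has (fun u => has (fun u' =>
    r u u' && (m == (2 ^ u + modulus n - 2 ^ u') %% modulus n)) (iota 0 n)) (iota 0 n).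

Definition dent_set n (h v : nat -> nat -> bool) ct m : bool :=
  if ct == 0 then difference_set n h m else if ct == 1 then difference_set n v m
  else has (fun u => m == 2 ^ u) (iota 0 n).

Definition dent_cell n h v t k x y z : bool :=
  [&& in_dent t k x y, dent_set n h v (ctype t) (z %/ 3) & ring (y - qy t) (z %% 3)].

Definition bump_cell t x y z : bool := in_bump t x y && ring (y - by_ t) z.

Definition tile_cell n h v k x y z : bool :=
  if k == 2 then (x == 0) && ring y z else
  (z < height n) &&
  (sec k x y && ~~ has (fun t => dent_cell n h v t k x y z) contacts
   || (k == 0) && has (fun t => bump_cell t x y z) contacts).

Definition occ n h v k (a b c X Y Z : int) : bool :=
  [&& (a <= X)%R, (b <= Y)%R, (c <= Z)%R &
    tile_cell n h v k `|X - a|%N `|Y - b|%N `|Z - c|%N].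

Record tiling n h v (P : nat -> int -> int -> int -> Prop) : Prop := Tiling {
  tl_kind : forall k a b c, P k a b c -> k < 3;
  tl_cover : forall X Y Z, exists k a b c, P k a b c /\ occ n h v k a b c X Y Z;
  tl_uniq : forall k a b c k' a' b' c' X Y Z, P k a b c -> P k' a' b' c' ->
    occ n h v k a b c X Y Z -> occ n h v k' a' b' c' X Y Z ->
    [/\ k = k', a = a', b = b' & c = c'] }.

Lemma has_imp (A : Type) (p q : A -> bool) s : (forall t, p t -> q t) -> has p s -> has q s.
Proof. by move=> h; exact: sub_has. Qed.

Lemma has_In (A : Type) (p : A -> bool) s : has p s -> exists2 t, List.In t s & p t.
Proof.
elim: s => //= t0 s IH /orP [h0|/IH [t h1 h2]]; first by exists t0 => //; left.
by exists t => //; right.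
Qed.

Lemma In_has (A : Type) (p : A -> bool) s t : List.In t s -> p t -> has p s.
Proof.
elim: s => //= t0 s IH [->|/IH h] pt; first by rewrite pt.
by rewrite h ?orbT.
Qed.

Section Shape.
Variables (n : nat) (h v : nat -> nat -> bool).
Notation N := (height n).
Notation M := (modulus n).
Notation cell := (tile_cell n h v).
Notation occu := (occ n h v).

Lemma modulus_gt0 : 4 <= M.
Proof. by rewrite /modulus expnD leq_pmull // expn_gt0. Qed.

Lemma occE k (a b c : int) x y z : occu k a b c (a + Posz x) (b + Posz y) (c + Posz z) = cell k x y z.
Proof.
rewrite /occ; have -> : (a + Posz x - a = Posz x)%R by lia.
have -> : (b + Posz y - b = Posz y)%R by lia.
have -> : (c + Posz z - c = Posz z)%R by lia.
by rewrite !lerDl.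
Qed.

Lemma occP k (a b c X Y Z : int) : occu k a b c X Y Z -> exists x y z : nat,
  [/\ X = (a + Posz x)%R, Y = (b + Posz y)%R, Z = (c + Posz z)%R & cell k x y z].
Proof.
move=> /and4P [h1 h2 h3 h4]; exists `|X - a|%N, `|Y - b|%N, `|Z - c|%N.
by split=> //; lia.
Qed.

Lemma sol_cell k x y z : k < 2 -> sol k x y -> z < N -> cell k x y z.
Proof.
move=> hk /andP [hs hd] hz; rewrite /tile_cell hz hs !andTb.
have -> : (k == 2) = false by lia.
apply/orP; left; apply: contraNN hd.
by apply: has_imp => t /and3P [].
Qed.

Lemma cell_shadow k x y z : k < 2 -> cell k x y z -> shadow k x y /\ z < N.
Proof.
move=> hk; rewrite /tile_cell; have -> : (k == 2) = false by lia.
move=> /andP [-> hh]; split=> //; move: hh; rewrite /shadow => /orP [/andP [-> //]|/andP [-> hb]].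
apply/orP; right; by rewrite andTb; move: hb; apply: has_imp => t /andP [].
Qed.

Lemma bump_occ t x w : List.In t contacts -> ring x w ->
  cell 0 (bx t) (by_ t + x) w.
Proof.
move=> ht hr; rewrite /tile_cell (_ : (0 == 2) = false) //; have := modulus_gt0.
have [hx hw] : x < 3 /\ w < 3 by case/and3P: hr.
rewrite /height => hM; apply/andP; split; first by lia.
apply/orP; right; rewrite eqxx andTb; apply: (In_has ht).
by rewrite /bump_cell /in_bump /inbox eqxx leq_addr ltn_add2l hx addKn hr.
Qed.

Lemma dent_absent t x z : List.In t contacts -> x < 3 -> z < N ->
  ~~ cell (hk t) (qx t) (qy t + x) z ->
  dent_set n h v (ctype t) (z %/ 3) && ring x (z %% 3).
Proof.
move=> ht hx hz; have [k2 _ _ _] := contact_frames ht.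
have hd : in_dent t (hk t) (qx t) (qy t + x) by rewrite /in_dent /inbox !eqxx leq_addr ltn_add2l hx.
rewrite /tile_cell hz (dent_sec ht hd) !andTb; have -> : (hk t == 2) = false by lia.
rewrite negb_or negbK => /andP [hh _].
have [t' ht' {}hh] : exists2 t', List.In t' contacts & dent_cell n h v t' (hk t) (qx t) (qy t + x) z.
  exact: has_In.
have [hd' h1 h2] := and3P hh; have e := dent_inj ht ht' hd hd'.
by rewrite -e addKn in h1 h2; apply/andP.
Qed.

End Shape.

Section TilingSound.
Variables (n : nat) (h v : nat -> nat -> bool).
Hypothesis h_irr : forall u, ~~ h u u.
Hypothesis v_irr : forall u, ~~ v u u.
Variable P : nat -> int -> int -> int -> Prop.
Hypothesis T : tiling n h v P.
Notation N := (height n).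
Notation M := (modulus n).
Notation cell := (tile_cell n h v).
Notation occu := (occ n h v).

Lemma N_ge : 12 <= N. Proof. by have := modulus_gt0 n; rewrite /height; lia. Qed.

(** A ring is flat in [x], so from a cell of it in the slot it continues to y - 1 or y + 1, where
    the column is solid. If that step lands in its hole, a further step in height, up or down so as
    to stay within the tile, leaves the hole. *)
Lemma ring_blocked k (a b c Z : int) x y a' b' c' :
  k < 2 -> P k a b c -> sol k x y.+1 -> 0 < y -> sol k x y.-1 ->
  (c <= Z < c + Posz N)%R -> P 2 a' b' c' ->
  ~~ occu 2 a' b' c' (a + Posz x) (b + Posz y) Z.
Proof.
move=> k2 Pk s1 y0 s2 hZ Pf; apply/negP => /occP [fx [fy [fz [e1 e2 e3]]]].
rewrite {1}/tile_cell /= => /andP [/eqP fx0 /and3P [fy3 fz3 fr]].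
have Nge := N_ge.
suff [y' [z' [wy [wz [hy' hz' ey ez hr]]]]] : exists y' z' wy wz : nat,
    [/\ (y' == y.+1) || (y' == y.-1), z' < N, (b + Posz y' = b' + Posz wy)%R,
     (c + Posz z' = c' + Posz wz)%R & ring wy wz].
  have sy : sol k x y' by case/orP: hy' => /eqP ->.
  have o1 : occu k a b c (a + Posz x) (b + Posz y') (c + Posz z') by rewrite occE sol_cell.
  have o2 : occu 2 a' b' c' (a + Posz x) (b + Posz y') (c + Posz z').
    by rewrite ey ez e1 fx0 occE.
  by have [] := tl_uniq T Pk Pf o1 o2; lia.
pose z0 := `|Z - c|%N.
have ez0 : Z = (c + Posz z0)%R by rewrite /z0; lia.
have z0N : z0 < N by lia.
have hz1 : (z0.+1 < N) || (0 < z0) by lia.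
pose y' := if fy == 0 then y.+1 else y.-1.
pose wy := if fy == 0 then 1 else fy.-1.
have hy' : (y' == y.+1) || (y' == y.-1) by rewrite /y'; case: ifP; rewrite eqxx ?orbT.
have ey : (b + Posz y' = b' + Posz wy)%R by rewrite /y' /wy; case: ifP => ?; lia.
have [e|ne] := eqVneq fz 1; last first.
  exists y', z0, wy, fz; split=> //; first by lia.
  by rewrite /ring fz3 (negbTE ne) andbF andbT /wy; case: ifP; lia.
have fy1 : fy != 1 by move: fr; rewrite e eqxx andbT.
have wy1 : wy = 1 by rewrite /wy; case: ifP; lia.
case: (ltnP z0.+1 N) => hz.
  by exists y', z0.+1, wy, 2; split=> //; [lia|rewrite wy1].
by exists y', z0.-1, wy, 0; split=> //; [lia|lia|rewrite wy1].
Qed.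

(** A misplaced encoder or pillar would share with the given tile a point at height [Z] on two solid
    columns, hence be that tile, whose shadow avoids the slot. *)
Lemma slot_cover k dx dy allow (a b c Z : int) :
  k < 2 -> slot_ok k dx dy allow -> P k a b c -> (c <= Z < c + Posz N)%R ->
  exists k' px py c', [/\ k' < 2, allow k' px py,
    P k' (a + Posz dx - Posz px)%R (b + Posz dy - Posz py)%R c' & (c' <= Z < c' + Posz N)%R].
Proof.
move=> k2 /and5P [npi s1 dy0 s2 /allP ch] Pk hZ.
have [k' [a' [b' [c' [Pk' o']]]]] := tl_cover T (a + Posz dx) (b + Posz dy) Z.
have k3 := tl_kind T Pk'.
have k'2 : k' < 2.
  have [e|] := eqVneq k' 2; last by lia.
  by subst k'; have := ring_blocked k2 Pk s1 dy0 s2 hZ Pk'; rewrite o'.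
have [px [py [pz [e1 e2 e3 hc]]]] := occP o'.
have [hpi hpz] := cell_shadow k'2 hc.
have [hx hy] := shadow_box hpi.
have := ch k' ltac:(by rewrite !inE; lia) => /allboxP /(_ px py hx hy); rewrite hpi.
case: ifP => [al _|_ /hasP [[x y] _ /=]].
  exists k', px, py, c'; split=> //.
    by have [-> ->] : (a + Posz dx - Posz px = a')%R /\ (b + Posz dy - Posz py = b')%R by split; lia.
  lia.
case: ifP => // hx1; case: ifP => // hy1; case: ifP => // sk sx.
pose z0 := `|Z - c|%N.
have ez0 : Z = (c + Posz z0)%R by rewrite /z0; lia.
have o1 : occu k a b c (a' + Posz x) (b' + Posz y) Z.
  have -> : (a' + Posz x = a + Posz (x + dx - px))%R by lia.
  have -> : (b' + Posz y = b + Posz (y + dy - py))%R by lia.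
  by rewrite ez0 occE sol_cell //; lia.
have o2 : occu k' a' b' c' (a' + Posz x) (b' + Posz y) Z by rewrite e3 occE sol_cell.
have [e4 e5 e6 e7] := tl_uniq T Pk Pk' o1 o2.
have [exx eyy] : px = dx /\ py = dy by lia.
by move: npi hpi; rewrite -exx -eyy e4 => /negbTE ->.
Qed.

Lemma same_column k (a b c c' Z : int) : k < 2 -> P k a b c -> P k a b c' ->
  (c <= Z < c + Posz N)%R -> (c' <= Z < c' + Posz N)%R -> c = c'.
Proof.
move=> k2 P1 P2 h1 h2.
have [x [y s]] : exists x y, sol k x y.
  by case: k k2 {P1 P2} => [|[|//]] _; [exists 12, 12|exists 1, 1].
have e1 : (Z = c + Posz `|Z - c|%N)%R by lia.
have e2 : (Z = c' + Posz `|Z - c'|%N)%R by lia.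
have o1 : occu k a b c (a + Posz x) (b + Posz y) Z by rewrite e1 occE sol_cell //; lia.
have o2 : occu k a b c' (a + Posz x) (b + Posz y) Z by rewrite e2 occE sol_cell //; lia.
by have [] := tl_uniq T P1 P2 o1 o2.
Qed.

(** A ring with its cell (p,q) in the hole (1,1) of another ring meets that ring in a further
    cell. *)
Lemma ring_meets p q : ring p q -> exists p' q' p2 q2 : nat,
  [/\ ring p' q', ring p2 q2, p' + 1 = p2 + p & q' + 1 = q2 + q].
Proof.
move=> hr; have [p3 q3 _] := and3P hr.
suff : has (fun p' => has (fun q' => [&& ring p' q', p <= p' + 1, q <= q' + 1 &
    ring (p' + 1 - p) (q' + 1 - q)]) (iota 0 3)) (iota 0 3).
  move=> /hasP [p' _ /hasP [q' _ /and4P [h1 h2 h3 h4]]].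
  by exists p', q', (p' + 1 - p), (q' + 1 - q); split=> //; lia.
by move: hr; case: p {p3} => [|[|[|//]]]; case: q {q3} => [|[|[|//]]].
Qed.

Lemma enc_exists : exists a b c, P 0 a b c.
Proof.
have fromref a b c : P 1 a b c -> exists a b c, P 0 a b c.
  move=> P1; have Nge := N_ge.
  have hz : (c <= c < c + Posz N)%R by lia.
  have [k' [px [py [c' [_ /eqP -> P0 _]]]]] := slot_cover (isT : 1 < 2) slot_ref P1 hz.
  by eexists; eexists; eexists; exact: P0.
have [k [a [b [c [Pk _]]]]] := tl_cover T 0%R 0%R 0%R.
have k3 := tl_kind T Pk; case: k Pk k3 => [|[|[|//]]] Pk _.
- by exists a, b, c.
- exact: fromref Pk.
have [k [a' [b' [c' [Pk' o]]]]] := tl_cover T (a + Posz 0)%R (b + Posz 1)%R (c + Posz 1)%R.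
have k3 := tl_kind T Pk'; case: k Pk' o k3 => [|[|[|//]]] Pk' o _.
- by exists a', b', c'.
- exact: fromref Pk'.
exfalso; have [x [p [q [e1 e2 e3 hc]]]] := occP o.
move: hc; rewrite /tile_cell /= => /andP [/eqP x0 hr].
have [p' [q' [p2 [q2 [r1 r2 e4 e5]]]]] := ring_meets hr.
have o1 : occu 2 a b c (a + Posz 0) (b + Posz p2) (c + Posz q2) by rewrite occE.
have o2 : occu 2 a' b' c' (a + Posz 0) (b + Posz p2) (c + Posz q2).
  have -> : (a + Posz 0 = a' + Posz 0)%R by lia.
  have -> : (b + Posz p2 = b' + Posz p')%R by lia.
  have -> : (c + Posz q2 = c' + Posz q')%R by lia.
  by rewrite occE.
have [_ _ e6 e7] := tl_uniq T Pk Pk' o1 o2.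
by case/and3P: hr => _ _ /negP []; apply/andP; split; apply/eqP; lia.
Qed.

Lemma pow2_mod_inj u u' : u < n -> u' < n -> 0 == (2 ^ u + M - 2 ^ u') %% M -> u = u'.
Proof.
move=> un u'n; have eM : M = 4 * 2 ^ n by rewrite /modulus expnD mulnC.
have l1 : 2 ^ u < 2 ^ n by rewrite ltn_exp2l. 
have l2 : 2 ^ u' < 2 ^ n by rewrite ltn_exp2l.
case: (leqP (2 ^ u') (2 ^ u)) => hl.
  have -> : 2 ^ u + M - 2 ^ u' = (2 ^ u - 2 ^ u') + M by lia.
  rewrite modnDr modn_small; last by lia.
  by move=> /eqP e; apply: (@expnI 2) => //; lia.
by rewrite modn_small; lia.
Qed.

Lemma no_zero_dent r : (forall u, ~~ r u u) -> ~~ difference_set n r 0.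
Proof.
move=> rirr; apply/hasPn => u; rewrite mem_iota => un; apply/hasPn => u'; rewrite mem_iota => u'n.
apply/negP => /andP [hr /(pow2_mod_inj un u'n) e].
by move: hr; rewrite e (negbTE (rirr u')).
Qed.

(** At equal heights the bump would need a dent at height 0, that is, two equal colours related by
    [h]. *)
Lemma left_unaligned a b c c' : P 0 a b c -> P 0 (a - 20)%R b c' -> c' <> c.
Proof.
move=> P1 P2 e; subst c'.
set t := nth (Contact 0 0 0 0 0 0 0 0) contacts 0.
have ht : List.In t contacts by left.
have hb : cell 0 (bx t) (by_ t + 0) 0 by apply: bump_occ.
have Nge := N_ge.
have hd : cell 0 2 12 0.
  apply/negPn/negP => hd.
  have := @dent_absent n h v t 0 0 ht isT ltac:(lia) hd.
  by rewrite /dent_set /= div0n (negbTE (no_zero_dent h_irr)).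
have o1 : occu 0 a b c (a + Posz 2) (b + Posz 12) (c + Posz 0) by rewrite occE.
have o2 : occu 0 (a - 20)%R b c (a + Posz 2) (b + Posz 12) (c + Posz 0).
  have -> : (a + Posz 2 = (a - 20) + Posz 22)%R by lia.
  by rewrite occE.
have [] := tl_uniq T P1 P2 o1 o2; lia.
Qed.

Lemma left_of a b c Z : P 0 a b c -> (c <= Z < c + Posz N)%R ->
  exists c', P 0 (a - 20)%R b c' /\ (c' <= Z < c' + Posz N)%R.
Proof.
move=> P0 hZ; have [k' [px [py [c' [_ /and3P [/eqP -> /eqP -> /eqP ->] P1 hz]]]]] :=
  slot_cover (isT : 0 < 2) slot_left P0 hZ.
have ea : (a + Posz 4 - Posz 24 = a - 20)%R by lia.
have eb : (b + Posz 11 - Posz 11 = b)%R by lia.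
by rewrite ea eb in P1; exists c'.
Qed.

Lemma right_of a b c Z : P 0 a b c -> (c <= Z < c + Posz N)%R ->
  exists c', P 0 (a + 20)%R b c' /\ (c' <= Z < c' + Posz N)%R.
Proof.
move=> P0 hZ; have [k' [px [py [c' [_ /and3P [/eqP -> /eqP -> /eqP ->] P1 hz]]]]] :=
  slot_cover (isT : 0 < 2) slot_right P0 hZ.
have ea : (a + Posz 20 - Posz 0 = a + 20)%R by lia.
have eb : (b + Posz 16 - Posz 16 = b)%R by lia.
by rewrite ea eb in P1; exists c'.
Qed.

Lemma down_of a b c Z : P 0 a b c -> (c <= Z < c + Posz N)%R ->
  exists c', P 0 a (b - 20)%R c' /\ (c' <= Z < c' + Posz N)%R.
Proof.
move=> P0 hZ; have [k' [px [py [c' [_ /and3P [/eqP -> /eqP -> /eqP ->] P1 hz]]]]] :=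
  slot_cover (isT : 0 < 2) slot_down P0 hZ.
have ea : (a + Posz 9 - Posz 9 = a)%R by lia.
have eb : (b + Posz 7 - Posz 27 = b - 20)%R by lia.
by rewrite ea eb in P1; exists c'.
Qed.

Lemma up_of a b c Z : P 0 a b c -> (c <= Z < c + Posz N)%R ->
  exists c', P 0 a (b + 20)%R c' /\ (c' <= Z < c' + Posz N)%R.
Proof.
move=> P0 hZ; have [k' [px [py [c' [_ /and3P [/eqP -> /eqP -> /eqP ->] P1 hz]]]]] :=
  slot_cover (isT : 0 < 2) slot_up P0 hZ.
have ea : (a + Posz 14 - Posz 14 = a)%R by lia.
have eb : (b + Posz 20 - Posz 0 = b + 20)%R by lia.
by rewrite ea eb in P1; exists c'.
Qed.

Lemma ref_of a b c Z : P 0 a b c -> (c <= Z < c + Posz N)%R ->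
  exists c', P 1 a (b - 2)%R c' /\ (c' <= Z < c' + Posz N)%R.
Proof.
move=> P0 hZ; have [k' [px [py [c' [_ /and3P [/eqP -> /eqP -> /eqP ->] P1 hz]]]]] :=
  slot_cover (isT : 0 < 2) slot_corner P0 hZ.
have ea : (a + Posz 5 - Posz 5 = a)%R by lia.
have eb : (b + Posz 8 - Posz 10 = b - 2)%R by lia.
by rewrite ea eb in P1; exists c'.
Qed.

(* The left neighbour reaching the top of an encoder sticks out above it,
   because no dent is at height 0, and its slot forces the next encoder. *)
Lemma enc_above a b c : P 0 a b c -> P 0 a b (c + Posz N)%R.
Proof.
move=> P0; have Nge := N_ge.
have [c1 [P1 h1]] := @left_of a b c (c + Posz N - 1)%R P0 ltac:(lia).
have ne := left_unaligned P0 P1.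
have [c2 [P2 h2]] := @right_of _ _ _ (c + Posz N)%R P1 ltac:(lia).
have ea : (a - 20 + 20 = a)%R by lia.
rewrite ea in P2.
have [lt|ge] := lerP (c + Posz N)%R c2.
  by have <- : c2 = (c + Posz N)%R by lia.
have := @same_column 0 a b c c2 (Num.max c c2) isT P0 P2; lia.
Qed.

Lemma enc_below a b c : P 0 a b c -> P 0 a b (c - Posz N)%R.
Proof.
move=> P0; have Nge := N_ge.
have [c1 [P1 h1]] := @left_of a b c c P0 ltac:(lia).
have ne := left_unaligned P0 P1.
have [c2 [P2 h2]] := @right_of _ _ _ (c - 1)%R P1 ltac:(lia).
have ea : (a - 20 + 20 = a)%R by lia.
rewrite ea in P2.
have [lt|ge] := lerP (c2 + Posz N)%R c.
  by have <- : c2 = (c - Posz N)%R by lia.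
have := @same_column 0 a b c c2 c isT P0 P2; lia.
Qed.

Lemma enc_stack a b c m : P 0 a b c -> P 0 a b (c + m * Posz N)%R.
Proof.
move=> P0; move: m; apply: (@int_ind2 (fun m => P 0 a b (c + m * Posz N)%R) 0%R) => [|m].
  by have -> : (c + 0 * Posz N = c)%R by lia.
split=> [/enc_above|/enc_below].
  by have -> : (c + m * Posz N + Posz N = c + (m + 1) * Posz N)%R by lia.
by have -> : (c + (m + 1) * Posz N - Posz N = c + m * Posz N)%R by lia.
Qed.

Lemma enc_at a b c Z : P 0 a b c -> exists c', P 0 a b c' /\ (c' <= Z < c' + Posz N)%R.
Proof.
move=> P0; have Nge := N_ge.
exists (c + ((Z - c) %/ Posz N)%Z * Posz N)%R; split; first exact: enc_stack.
have := divz_eq (Z - c)%R (Posz N); have := @modz_ge0 (Z - c)%R (Posz N) ltac:(lia).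
have := @ltz_pmod (Z - c)%R (Posz N) ltac:(lia); lia.
Qed.

(** Encoders are stacked without gaps, and the one reaching just beyond a pillar demands, through
    its corner slot, a pillar at that height. *)
Lemma ref_stack a b c r m : P 0 a b c -> P 1 a (b - 2)%R r -> P 1 a (b - 2)%R (r + m * Posz N)%R.
Proof.
move=> P0 P1; have Nge := N_ge.
have near r' Z : P 1 a (b - 2)%R r' -> (Z = r' + Posz N \/ Z = r' - 1)%R -> 
    P 1 a (b - 2)%R (if (r' <= Z)%R then r' + Posz N else r' - Posz N)%R.
  move=> P2 hZ; have [c1 [P3 h3]] := enc_at Z P0.
  have [r2 [P4 h4]] := ref_of P3 h3.
  have sc Z' := @same_column 1 a (b - 2)%R r' r2 Z' isT P2 P4.
  case: ifP => hh.
    have [ge|lt] := lerP (r' + Posz N)%R r2; first by have <- : r2 = (r' + Posz N)%R by lia.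
    have := sc (Num.max r' r2); lia.
  have [ge|lt] := lerP (r2 + Posz N)%R r'; first by have <- : r2 = (r' - Posz N)%R by lia.
  have := sc r'; lia.
move: m; apply: (@int_ind2 (fun m => P 1 a (b - 2)%R (r + m * Posz N)%R) 0%R) => [|m].
  by have -> : (r + 0 * Posz N = r)%R by lia.
split=> hm.
  have := near _ _ hm (or_introl erefl); rewrite ifT; last by lia.
  by have -> : (r + m * Posz N + Posz N = r + (m + 1) * Posz N)%R by lia.
have := near _ _ hm (or_intror erefl); rewrite ifF; last by lia.
by have -> : (r + (m + 1) * Posz N - Posz N = r + m * Posz N)%R by lia.
Qed.

(** Where the bump has a cell, the host stack must lack one, and only dents remove cells. [z0] is
    the height of the bump within the period of the host. *)
Lemma contact_dent t (a b s qa qb r : int) : List.In t contacts -> P 0 a b s ->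
  (forall m, P (hk t) qa qb (r + m * Posz N)%R) ->
  (a + Posz (bx t) = qa + Posz (qx t))%R -> (b + Posz (by_ t) = qb + Posz (qy t))%R ->
  ~ [/\ 0 = hk t, a = qa & b = qb] ->
  exists2 m, dent_set n h v (ctype t) m & (Posz N %| (s - r - Posz (3 * m))%R)%Z.
Proof.
move=> ht P0 PQ ea eb ne; have Nge := N_ge.
pose z0 := `|((s - r) %% Posz N)%Z|%N.
have ez0 : Posz z0 = ((s - r) %% Posz N)%Z by rewrite gez0_abs // modz_ge0 //; lia.
have z0N : z0 < N by have := @ltz_pmod (s - r)%R (Posz N) ltac:(lia); lia.
have es := divz_eq (s - r)%R (Posz N); rewrite -ez0 in es.
set d := divz _ _ in es.
have key x w : ring x w ->
    dent_set n h v (ctype t) (((z0 + w) %% N) %/ 3) && ring x (((z0 + w) %% N) %% 3).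
  move=> hr; have [x3 w3 _] := and3P hr.
  apply: (@dent_absent n h v t x _ ht x3); first by rewrite ltn_pmod //; lia.
  have e2 := divn_eq (z0 + w) N; set d2 := divn _ _ in e2; set zw := modn _ _ in e2 *.
  apply/negP => hc.
  have ec : (s + Posz w = (r + (d + Posz d2) * Posz N) + Posz zw)%R.
    have : (Posz (z0 + w) = Posz d2 * Posz N + Posz zw)%R by rewrite e2 PoszD PoszM.
    lia.
  have o1 : occu 0 a b s (a + Posz (bx t)) (b + Posz (by_ t + x)) (s + Posz w).
    by rewrite occE bump_occ.
  have o2 : occu (hk t) qa qb (r + (d + Posz d2) * Posz N)%R
      (a + Posz (bx t)) (b + Posz (by_ t + x)) (s + Posz w).
    rewrite ec ea; have -> : (b + Posz (by_ t + x) = qb + Posz (qy t + x))%R by lia.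
    by rewrite occE.
  by have [? ? ? _] := tl_uniq T P0 (PQ _) o1 o2; apply: ne; split.
have /andP [k0 _] := key 0 0 isT.
(* The cells (1,0) and (1,2), on both sides of the hole, exclude the residues 1 and 2 of [z0] modulo
   3. *)
have /andP [_ /and3P [_ _ k1]] := key 1 0 isT.
have /andP [_ /and3P [_ _ k2]] := key 1 2 isT.
rewrite addn0 (modn_small z0N) in k0 k1.
have N3 : 3 %| N by rewrite /height dvdn_mulr.
rewrite modn_dvdm // in k2.
have z3 : z0 = 3 * (z0 %/ 3) by move: k1 k2; rewrite !andTb; lia.
exists (z0 %/ 3) => //; rewrite -z3.
by apply/dvdzP; exists d; lia.
Qed.

Definition cong x y : bool := (Posz N %| (x - y)%R)%Z.

Lemma cong_sym x y : cong x y -> cong y x.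
Proof.
rewrite /cong => hxy; have -> : (y - x = - (x - y))%R by lia.
by rewrite rpredN.
Qed.

Lemma cong_comb x y x' y' : cong x y -> cong x' y' -> cong (x - x') (y - y').
Proof.
rewrite /cong => h1 h2; have -> : (x - x' - (y - y') = (x - y) - (x' - y'))%R by lia.
by rewrite rpredB.
Qed.

Lemma cong_trans y x z : cong x y -> cong y z -> cong x z.
Proof.
rewrite /cong => h1 h2; have -> : (x - z = (x - y) + (y - z))%R by lia.
by rewrite rpredD.
Qed.

Lemma pow2_sum x y z w : x != w -> 2 ^ x + 2 ^ y = 2 ^ z + 2 ^ w -> x = z /\ y = w.
Proof.
have p0 a : 0 < 2 ^ a by rewrite expn_gt0.
have inj a b : 2 ^ a = 2 ^ b -> a = b by move=> e; apply: (@expnI 2).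
elim: x y z w => [|x IH] [|y] [|z] [|w] //=; rewrite ?expnS ?expn0 => ne e.
- by have := p0 w; lia.
- by have := p0 z; have := p0 w; lia.
- by split=> //; congr S; apply: inj; lia.
- lia.
- by have := p0 x; lia.
- by move: ne; rewrite (inj x w) ?eqxx //; lia.
- by rewrite (inj x z) //; lia.
- lia.
- by have := p0 x; have := p0 y; lia.
- lia.
- lia.
have [||-> -> //] := IH y z w; [by rewrite eqSS in ne|lia].
Qed.

(** Powers of 2 form a Sidon set, and the height 12 * 2^n is too large for the congruence to hide a
    nonzero multiple. *)
Lemma sidon x w z y : x < n -> w < n -> z < n -> y < n -> x != w ->
  cong (Posz (3 * 2 ^ x) - Posz (3 * 2 ^ w)) (Posz (3 * 2 ^ z) - Posz (3 * 2 ^ y)) -> x = z /\ w = y.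
Proof.
move=> xn wn zn yn xw hc.
have l a : a < n -> 0 < 2 ^ a < 2 ^ n by move=> an; rewrite expn_gt0 ltn_exp2l.
have := l x xn; have := l w wn; have := l z zn; have := l y yn => ly lz lw lx.
have eN : N = 12 * 2 ^ n by rewrite /height /modulus expnD; lia.
have e0 : (Posz (3 * 2 ^ x) - Posz (3 * 2 ^ w) - (Posz (3 * 2 ^ z) - Posz (3 * 2 ^ y)) = 0)%R.
  move: hc; rewrite /cong => /dvdzP [q]; rewrite eN.
  move: (2 ^ x) (2 ^ w) (2 ^ z) (2 ^ y) (2 ^ n) ly lz lw lx => X W Z Y K ly lz lw lx e.
  have : (q = 0)%R by nia.
  by move=> q0; rewrite e q0 mul0r.
have [] := @pow2_sum x y z w xw; first by lia.
by move=> -> ->.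
Qed.

Lemma dent_difference q s s' : 
  (exists2 m, difference_set n q m & (Posz N %| (s - s' - Posz (3 * m))%R)%Z) ->
  exists u u', [/\ u < n, u' < n, q u u' & cong (s - s') (Posz (3 * 2 ^ u) - Posz (3 * 2 ^ u'))].
Proof.
move=> [m /hasP [u]]; rewrite mem_iota => un /hasP [u']; rewrite mem_iota => un'.
move=> /andP [hr /eqP em] hd; exists u, u'; split=> //.
apply: (@cong_trans (Posz (3 * m))); first exact: hd.
have l : 2 ^ u' < 2 ^ n by rewrite ltn_exp2l.
have eM : M = 4 * 2 ^ n by rewrite /modulus expnD mulnC.
have := divn_eq (2 ^ u + M - 2 ^ u') M; rewrite -em; set d := divn _ _ => eqd.
rewrite /cong /height; apply/dvdzP; exists (1 - Posz d)%R.
have : (Posz (2 ^ u) + Posz M - Posz (2 ^ u') = Posz d * Posz M + Posz m)%R.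
  by clear -l eM eqd; lia.
rewrite !PoszM; lia.
Qed.

Lemma dent_ref s r :
  (exists2 m, has (fun u => m == 2 ^ u) (iota 0 n) & (Posz N %| (s - r - Posz (3 * m))%R)%Z) ->
  exists2 u, u < n & cong (s - r) (Posz (3 * 2 ^ u)).
Proof. by move=> [m /hasP [u]]; rewrite mem_iota => un /eqP -> hd; exists u. Qed.

Lemma tiling_config : exists c : int -> int -> nat, forall i j,
  [/\ c i j < n, h (c i j) (c (i + 1)%R j) & v (c i j) (c i (j + 1)%R)].
Proof.
have Nge := N_ge; have [a0 [b0 [c0 P0]]] := enc_exists.
have self x : (x <= x < x + Posz N)%R by lia.
have rowi i : exists s, P 0 (a0 + i * 20)%R b0 s.
  move: i; apply: (@int_ind2 (fun i => exists s, P 0 (a0 + i * 20)%R b0 s) 0%R) => [|i].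
    by exists c0; have -> : (a0 + 0 * 20 = a0)%R by lia.
  split=> [[s hs]|[s hs]].
    have [s' [hs' _]] := right_of hs (self s); exists s'.
    by have -> : (a0 + (i + 1) * 20 = a0 + i * 20 + 20)%R by lia.
  have [s' [hs' _]] := left_of hs (self s); exists s'.
  by have -> : (a0 + i * 20 = a0 + (i + 1) * 20 - 20)%R by lia.
have encij (ij : int * int) : exists s, P 0 (a0 + ij.1 * 20)%R (b0 + ij.2 * 20)%R s.
  case: ij => i j /=.
  move: j; apply: (@int_ind2 (fun j => exists s, P 0 (a0 + i * 20)%R (b0 + j * 20)%R s) 0%R) => [|j].
    by have [s hs] := rowi i; exists s; have -> : (b0 + 0 * 20 = b0)%R by lia.
  split=> [[s hs]|[s hs]].
    have [s' [hs' _]] := up_of hs (self s); exists s'.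
    by have -> : (b0 + (j + 1) * 20 = b0 + j * 20 + 20)%R by lia.
  have [s' [hs' _]] := down_of hs (self s); exists s'.
  by have -> : (b0 + j * 20 = b0 + (j + 1) * 20 - 20)%R by lia.
have [s hs] := boolp.choice encij.
have refij (ij : int * int) : exists r, P 1 (a0 + ij.1 * 20)%R (b0 + ij.2 * 20 - 2)%R r.
  by have [r [hr _]] := ref_of (hs ij) (self _); exists r.
have [r hr] := boolp.choice refij.
have encst i j m := @enc_stack _ _ _ m (hs (i, j)).
have refst i j m := @ref_stack _ _ _ _ m (hs (i, j)) (hr (i, j)).
have inc k : k < 6 -> List.In (nth (Contact 0 0 0 0 0 0 0 0) contacts k) contacts.
  by case: k => [|[|[|[|[|[|//]]]]]] _ /=; tauto.
have hH i j := dent_difference (@contact_dent _ _ _ _ _ _ _ (inc 0 isT) (hs (i, j)) (encst (i + 1)%R j)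
  ltac:(rewrite /=; lia) ltac:(rewrite /=; lia) ltac:(move=> [_ /=]; lia)).
have hV i j := dent_difference (@contact_dent _ _ _ _ _ _ _ (inc 1 isT) (hs (i, j)) (encst i (j + 1)%R)
  ltac:(rewrite /=; lia) ltac:(rewrite /=; lia) ltac:(move=> [_ /=]; lia)).
have h00 i j := dent_ref (@contact_dent _ _ _ _ _ _ _ (inc 2 isT) (hs (i, j)) (refst i j)
  ltac:(rewrite /=; lia) ltac:(rewrite /=; lia) ltac:(by case)).
have h01 i j := dent_ref (@contact_dent _ _ _ _ _ _ _ (inc 3 isT) (hs (i, j)) (refst i (j + 1)%R)
  ltac:(rewrite /=; lia) ltac:(rewrite /=; lia) ltac:(by case)).
have h10 i j := dent_ref (@contact_dent _ _ _ _ _ _ _ (inc 4 isT) (hs (i, j)) (refst (i + 1)%R j)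
  ltac:(rewrite /=; lia) ltac:(rewrite /=; lia) ltac:(by case)).
have h11 i j := dent_ref (@contact_dent _ _ _ _ _ _ _ (inc 5 isT) (hs (i, j)) (refst (i + 1)%R (j + 1)%R)
  ltac:(rewrite /=; lia) ltac:(rewrite /=; lia) ltac:(by case)).
(* The shifts of two encoders against a common pillar have the same difference as the encoders
   themselves, so [sidon] identifies the colours. *)
have pin s1 s2 rr u u' a b : u < n -> u' < n -> a < n -> b < n -> u != u' ->
    cong (s1 - s2) (Posz (3 * 2 ^ u) - Posz (3 * 2 ^ u')) ->
    cong (s1 - rr) (Posz (3 * 2 ^ a)) -> cong (s2 - rr) (Posz (3 * 2 ^ b)) -> u = a /\ u' = b.
  move=> un un' an bn ne hd ha hb; apply: sidon => //.
  apply: cong_trans (cong_sym hd) _.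
  have -> : (s1 - s2 = (s1 - rr) - (s2 - rr))%R by lia.
  exact: cong_comb.
(* Both pillars lie 3 * 2^u below the encoder [s1], modulo the height. *)
have same s1 s2 r1 r2 u u' a b a' b' : u < n -> u' < n -> a < n -> b < n -> a' < n -> b' < n -> u != u' ->
    cong (s1 - s2) (Posz (3 * 2 ^ u) - Posz (3 * 2 ^ u')) ->
    cong (s1 - r1) (Posz (3 * 2 ^ a)) -> cong (s2 - r1) (Posz (3 * 2 ^ b)) ->
    cong (s1 - r2) (Posz (3 * 2 ^ a')) -> cong (s2 - r2) (Posz (3 * 2 ^ b')) -> cong r1 r2.
  move=> un un' an bn an' bn' ne hd e1 e2 e3 e4.
  have [ea _] := pin _ _ _ _ _ _ _ un un' an bn ne hd e1 e2.
  have [ea' _] := pin _ _ _ _ _ _ _ un un' an' bn' ne hd e3 e4.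
  rewrite -ea in e1; rewrite -ea' in e3; have := cong_comb e3 e1.
  by rewrite /cong; have -> : (s1 - r2 - (s1 - r1) - (Posz (3 * 2 ^ u) - Posz (3 * 2 ^ u)) = r1 - r2)%R by lia.
have neq_of (q : nat -> nat -> bool) u u' : (forall u, ~~ q u u) -> q u u' -> u != u'.
  by move=> qi quu; apply: contraTneq quu => ->.
(* Both pillars touch the encoders (i-1,j) and (i,j); in [rH] the common encoders are (i,j-1) and
   (i,j). *)
have rV i j : cong (r (i, j)) (r (i, (j + 1)%R)).
  have [u [u' [un un' hu e]]] := hH (i - 1)%R j.
  have [a an ea] := h10 (i - 1)%R j; have [a' an' ea'] := h11 (i - 1)%R j.
  rewrite subrK in e ea ea'.
  have [b bn eb] := h00 i j; have [b' bn' eb'] := h01 i j.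
  exact: (same _ _ _ _ _ _ _ _ _ _ un un' an bn an' bn' (neq_of _ _ _ h_irr hu) e ea eb ea' eb').
have rH i j : cong (r (i, j)) (r ((i + 1)%R, j)).
  have [u [u' [un un' hu e]]] := hV i (j - 1)%R.
  have [a an ea] := h01 i (j - 1)%R; have [a' an' ea'] := h11 i (j - 1)%R.
  rewrite subrK in e ea ea'.
  have [b bn eb] := h00 i j; have [b' bn' eb'] := h10 i j.
  exact: (same _ _ _ _ _ _ _ _ _ _ un un' an bn an' bn' (neq_of _ _ _ v_irr hu) e ea eb ea' eb').
have [c hc] := boolp.choice (fun ij : int * int =>
  let: ex_intro2 u un e := h00 ij.1 ij.2 in
  ex_intro (fun u => u < n /\ cong (s (ij.1, ij.2) - r (ij.1, ij.2)) (Posz (3 * 2 ^ u))) u (conj un e)).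
exists (fun i j => c (i, j)) => i j.
have [cn e0] := hc (i, j); rewrite /= in e0.
have shift (i' j' : int) : cong (r (i, j)) (r (i', j')) ->
    cong (s (i', j') - r (i, j)) (Posz (3 * 2 ^ (c (i', j')))).
  move=> hcg; have [_ e1] := hc (i', j'); rewrite /= in e1.
  have := cong_comb e1 hcg; rewrite /cong => h1.
  have -> : (s (i', j') - r (i, j) - Posz (3 * 2 ^ c (i', j')) =
    (s (i', j') - r (i', j') - r (i, j) - (Posz (3 * 2 ^ c (i', j')) - r (i', j'))))%R by lia.
  exact: h1.
split=> //.
  have [u [u' [un un' hu e]]] := hH i j; have [cn' _] := hc ((i + 1)%R, j).
  by have [<- <-] := pin _ _ _ _ _ _ _ un un' cn cn' (neq_of _ _ _ h_irr hu) e e0 (shift _ _ (rH i j)).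
have [u [u' [un un' hu e]]] := hV i j; have [cn' _] := hc (i, (j + 1)%R).
by have [<- <-] := pin _ _ _ _ _ _ _ un un' cn cn' (neq_of _ _ _ v_irr hu) e e0 (shift _ _ (rV i j)).
Qed.

End TilingSound.

(** * Every configuration yields a tiling *)

Section TilingComplete.
Variables (n : nat) (h v : nat -> nat -> bool) (c : int -> int -> nat).
Hypothesis conf : forall i j,
  [/\ c i j < n, h (c i j) (c (i + 1)%R j) & v (c i j) (c i (j + 1)%R)].
Notation N := (height n).
Notation M := (modulus n).
Notation cell := (tile_cell n h v).
Notation occu := (occ n h v).

Let base (k : nat) (i j : int) : nat := if k == 0 then 3 * 2 ^ c i j else 0.
Let px (i : int) : int := (20 * i - 2)%R.
Let py (k : nat) (j : int) : int := (20 * j - 6 + Posz (yoff k))%R.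
Let pz (k : nat) (i j m : int) : int := (Posz (base k i j) + m * Posz N)%R.

Let bump_i t (i : int) : int := (i + 1 - Posz (di t))%R.
Let bump_j t (j : int) : int := (j + 1 - Posz (dj t))%R.

(** The last condition lets rings fill exactly the dents that no bump enters: no encoder of the
    facing stack starts at that height. *)
Definition placed (k : nat) (X Y Z : int) : Prop :=
  (k < 2 /\ exists i j m, [/\ X = px i, Y = py k j & Z = pz k i j m]) \/
  (k = 2 /\ exists t i j m d, [/\ List.In t contacts, dent_set n h v (ctype t) d /\ d < M,
     X = (px i + Posz (qx t))%R /\ Y = (py (hk t) j + Posz (qy t))%R,
     Z = (pz (hk t) i j m + Posz (3 * d))%R &
     forall m', Z <> pz 0 (bump_i t i) (bump_j t j) m']).

Lemma Ngt : 12 <= N. Proof. by have := modulus_gt0 n; rewrite /height; lia. Qed.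

Lemma pow_lt i j : 4 * 2 ^ c i j < M.
Proof.
have [cn _ _] := conf i j; have : 2 ^ c i j < 2 ^ n by rewrite ltn_exp2l.
rewrite /modulus expnD; lia.
Qed.

Lemma difference_dent (q : nat -> nat -> bool) u u' : u < n -> u' < n -> q u u' ->
  exists d (e : int), [/\ difference_set n q d, d < M &
    Posz (3 * 2 ^ u) = (Posz (3 * 2 ^ u') + e * Posz N + Posz (3 * d))%R].
Proof.
move=> un un' hq; have M4 := modulus_gt0 n.
have l : 2 ^ u' < 2 ^ n by rewrite ltn_exp2l.
have eM : M = 4 * 2 ^ n by rewrite /modulus expnD mulnC.
exists ((2 ^ u + M - 2 ^ u') %% M), (Posz ((2 ^ u + M - 2 ^ u') %/ M) - 1)%R; split.
- apply/hasP; exists u; first by rewrite mem_iota.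
  by apply/hasP; exists u'; rewrite ?mem_iota // hq eqxx.
- by rewrite ltn_pmod //; lia.
have := divn_eq (2 ^ u + M - 2 ^ u') M; move: (_ %/ _) (_ %% _) => d r e.
have : (Posz (2 ^ u) + Posz M - Posz (2 ^ u') = Posz d * Posz M + Posz r)%R by clear -l eM e; lia.
rewrite /height !PoszM; lia.
Qed.

(** Against an encoder the dent is a colour difference, allowed by [conf]; against a pillar, which
    stands at height 0, it is the power of 2 of the colour. *)
Lemma bump_dent t i j : List.In t contacts -> exists d e,
  [/\ dent_set n h v (ctype t) d, d < M &
   pz 0 (bump_i t i) (bump_j t j) 0 = (pz (hk t) i j e + Posz (3 * d))%R].
Proof.
have refcase i' j' : exists d e, [/\ has (fun u => d == 2 ^ u) (iota 0 n), d < M &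
    pz 0 i' j' 0 = (pz 1 i j e + Posz (3 * d))%R].
  have [cn _ _] := conf i' j'; have := pow_lt i' j' => hp.
  exists (2 ^ c i' j'), 0%R; split; [|lia|rewrite /pz /base /=; lia].
  by apply/hasP; exists (c i' j'); rewrite ?mem_iota ?eqxx.
move=> ht; move: ht (ht) => /= [<-|[<-|[<-|[<-|[<-|[<-|//]]]]]] _ /=; try exact: refcase.
- have -> : bump_i (Contact 0 22 12 0 2 12 2 1) i = (i - 1)%R by rewrite /bump_i /=; lia.
  have -> : bump_j (Contact 0 22 12 0 2 12 2 1) j = j by rewrite /bump_j /=; lia.
  have [cn hc _] := conf (i - 1)%R j; rewrite subrK in hc; have [cn' _ _] := conf i j.
  have [d [e [h1 h2 h3]]] := difference_dent cn cn' hc.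
  by exists d, e; split=> //; rewrite /pz /base /= h3; lia.
have -> : bump_i (Contact 1 7 24 0 7 4 1 2) i = i by rewrite /bump_i /=; lia.
have -> : bump_j (Contact 1 7 24 0 7 4 1 2) j = (j - 1)%R by rewrite /bump_j /=; lia.
have [cn _ hc] := conf i (j - 1)%R; rewrite subrK in hc; have [cn' _ _] := conf i j.
have [d [e [h1 h2 h3]]] := difference_dent cn cn' hc.
by exists d, e; split=> //; rewrite /pz /base /= h3; lia.
Qed.

Lemma nominal_exists (X Y : int) : exists k i j x y,
  [/\ k < 2, sec k x y, X = (px i + Posz x)%R & Y = (py k j + Posz y)%R].
Proof.
pose x0 := `|((X + 2) %% 20)%Z|%N; pose y0 := `|((Y + 6) %% 20)%Z|%N.
have hx : x0 < 20 by rewrite /x0; lia.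
have hy : y0 < 20 by rewrite /y0; lia.
have [k [x [y [k2 s ex ey]]]] := sections_cover hx hy.
exists k, ((X + 2 - Posz x) %/ 20)%Z, ((Y + 6 - Posz (y + yoff k)) %/ 20)%Z, x, y.
split=> //; rewrite /px /py /x0 /y0 in ex ey *; lia.
Qed.

Lemma nominal_unique k k' i i' j j' x x' y y' :
  k < 2 -> k' < 2 -> sec k x y -> sec k' x' y' ->
  (px i + Posz x = px i' + Posz x')%R -> (py k j + Posz y = py k' j' + Posz y')%R ->
  [/\ k = k', x = x', y = y' & i = i' /\ j = j'].
Proof.
move=> k2 k2' s s' ex ey.
have m1 : x = x' %[mod 20] by rewrite /px in ex; lia.
have m2 : y + yoff k = y' + yoff k' %[mod 20] by rewrite /py in ey; lia.
have [ek exx eyy] := sections_disjoint k2 k2' s s' m1 m2.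
by split=> //; rewrite /px /py ek in ex ey; lia.
Qed.

Lemma height_exists k i j (Z : int) : exists m z, z < N /\ Z = (pz k i j m + Posz z)%R.
Proof.
have Nge := Ngt.
have := divz_eq (Z - Posz (base k i j))%R (Posz N).
have := @modz_ge0 (Z - Posz (base k i j))%R (Posz N) ltac:(lia).
have := @ltz_pmod (Z - Posz (base k i j))%R (Posz N) ltac:(lia).
move: (_ %/ _)%Z (_ %% _)%Z => m r h1 h2 h3.
by exists m, `|r|%N; rewrite /pz; split; lia.
Qed.

Lemma height_unique k i j m m' z z' : z < N -> z' < N ->
  (pz k i j m + Posz z = pz k i j m' + Posz z')%R -> m = m' /\ z = z'.
Proof.
move=> hz hz' e.
have e' : ((m - m') * Posz N = Posz z' - Posz z)%R by rewrite /pz in e; lia.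
have em : m = m' by nia.
by split=> //; rewrite em in e; lia.
Qed.

(** The tile of a point as a function of the section and layer in which the point lies: outside
    dents the tile of that section, inside a dent the facing encoder or else a ring. Disjointness of
    the tiles becomes [owner_unique]. *)
Definition owner k0 i j m x y z (k : nat) (A B C : int) : Prop :=
  (~~ has (fun t => dent_cell n h v t k0 x y z) contacts /\
     [/\ k = k0, A = px i, B = py k0 j & C = pz k0 i j m]) \/
  (exists t, [/\ List.In t contacts, dent_cell n h v t k0 x y z &
    [/\ k = 0, A = px (bump_i t i), B = py 0 (bump_j t j),
        C = (pz k0 i j m + Posz (3 * (z %/ 3)))%R &
        exists m', C = pz 0 (bump_i t i) (bump_j t j) m'] \/
    [/\ k = 2, A = (px i + Posz (qx t))%R, B = (py k0 j + Posz (qy t))%R,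
        C = (pz k0 i j m + Posz (3 * (z %/ 3)))%R &
        forall m', C <> pz 0 (bump_i t i) (bump_j t j) m']]).

Lemma owner_unique k0 i j m x y z k A B C k' A' B' C' :
  owner k0 i j m x y z k A B C -> owner k0 i j m x y z k' A' B' C' ->
  [/\ k = k', A = A', B = B' & C = C'].
Proof.
move=> [[nd [-> -> -> ->]]|[t [ht dt ow]]] [[nd' [-> -> -> ->]]|[t' [ht' dt' ow']]] //.
- by rewrite (In_has ht' dt') in nd.
- by rewrite (In_has ht dt) in nd'.
have e : t' = t by apply: (@dent_inj _ _ k0 x y) => //; [case/and3P: dt'|case/and3P: dt].
subst t'; move: ow ow' => [] [-> -> -> -> hm] [] [-> -> -> e hm'].
- by rewrite e.
- by case: hm => m' em; case: (hm' m'); rewrite e -em.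
- by case: hm' => m' em; case: (hm m'); rewrite -em e.
by rewrite e.
Qed.

Section Cell.
Variables (X Y Z : int) (k0 : nat) (i j m : int) (x y z : nat).
Hypotheses (k02 : k0 < 2) (hs : sec k0 x y) (eX : X = (px i + Posz x)%R)
  (eY : Y = (py k0 j + Posz y)%R) (zN : z < N) (eZ : Z = (pz k0 i j m + Posz z)%R).

Lemma dent_owner t i' j' m' d w a : List.In t contacts -> dent_set n h v (ctype t) d -> d < M ->
  ring a w -> X = (px i' + Posz (qx t))%R -> Y = (py (hk t) j' + Posz (qy t + a))%R ->
  Z = (pz (hk t) i' j' m' + Posz (3 * d + w))%R ->
  [/\ k0 = hk t, i = i', j = j', m = m' & dent_cell n h v t k0 x y z /\ 3 * (z %/ 3) = 3 * d].
Proof.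
move=> ht hd dM hr eX' eY' eZ'; have [a3 w3 _] := and3P hr.
have [k2 _ _ _] := contact_frames ht.
have hin : in_dent t (hk t) (qx t) (qy t + a) by rewrite /in_dent /inbox !eqxx leq_addr ltn_add2l a3.
rewrite eX in eX'; rewrite eY in eY'.
have [ek ex ey [ei ej]] := nominal_unique k02 k2 hs (dent_sec ht hin) eX' eY'.
have zb : 3 * d + w < N by rewrite /height; lia.
rewrite eZ ek ei ej in eZ'; have [em ez] := height_unique zN zb eZ'.
split=> //; split; last by rewrite ez; lia.
rewrite /dent_cell ek ex ey hin addKn ez.
have -> : (3 * d + w) %/ 3 = d by lia.
have -> : (3 * d + w) %% 3 = w by lia.
by rewrite hd hr.
Qed.

Lemma placed_owner k A B C : placed k A B C -> occu k A B C X Y Z ->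
  owner k0 i j m x y z k A B C.
Proof.
move=> pl /occP [x' [y' [z' [eX' eY' eZ' hc]]]].
case: pl => [[k2 [i' [j' [m' [eA eB eC]]]]]|[ek [t [i' [j' [m' [d [ht [hd dM] [eA eB] eC nb]]]]]]]].
  move: hc; rewrite /tile_cell; have -> : (k == 2) = false by lia.
  move=> /andP [zN' /orP [/andP [hs' nd]|/andP [/eqP ek0 /has_In [t ht]]]].
    left; rewrite eX eA in eX'; rewrite eY eB in eY'.
    have [ek ex ey [ei ej]] := nominal_unique k02 k2 hs hs' eX' eY'.
    rewrite eZ eC ek ei ej in eZ'; have [em ez] := height_unique zN zN' eZ'.
    by rewrite ek ex ey ez ei ej em.
  rewrite /bump_cell /in_bump => /andP [/andP [/eqP ex' /andP [y1 y2]] hr].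
  have [_ _ fx fy] := contact_frames ht.
  pose i1 := (i' + Posz (di t) - 1)%R; pose j1 := (j' + Posz (dj t) - 1)%R.
  have bi : bump_i t i1 = i' by rewrite /bump_i /i1; lia.
  have bj : bump_j t j1 = j' by rewrite /bump_j /j1; lia.
  have [d [e [hd dM he]]] := bump_dent i1 j1 ht; rewrite bi bj in he.
  have hX : X = (px i1 + Posz (qx t))%R by rewrite eX' eA ex' /px /i1; lia.
  have hY : Y = (py (hk t) j1 + Posz (qy t + (y' - by_ t)))%R.
    have y0 : yoff 0 = 2 by [].
    by rewrite eY' eB ek0 /py /j1 y0; lia.
  have hC : pz 0 i' j' m' = (pz (hk t) i1 j1 (e + m') + Posz (3 * d))%R.
    by move: he; rewrite /pz; lia.
  have hZ : Z = (pz (hk t) i1 j1 (e + m') + Posz (3 * d + z'))%R by rewrite eZ' eC ek0 hC; lia.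
  have [e1 e2 e3 e4 [hdc hz]] := dent_owner ht hd dM hr hX hY hZ.
  right; exists t; split=> //; left.
  rewrite hz e1 e2 e3 e4 bi bj eC ek0; split=> //; first by rewrite eB ek0.
  by exists m'.
move: hc; rewrite ek /tile_cell /= => /andP [/eqP x0 hr].
have hX : X = (px i' + Posz (qx t))%R by rewrite eX' eA x0; lia.
have hY : Y = (py (hk t) j' + Posz (qy t + y'))%R by rewrite eY' eB; lia.
have hZ : Z = (pz (hk t) i' j' m' + Posz (3 * d + z'))%R by rewrite eZ' eC; lia.
have [e1 e2 e3 e4 [hdc hz]] := dent_owner ht hd dM hr hX hY hZ.
right; exists t; split=> //; right.
by rewrite hz e1 e2 e3 e4.
Qed.

Lemma cell_placed : exists k A B C, placed k A B C /\ occu k A B C X Y Z.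
Proof.
case: (boolP (has (fun t => dent_cell n h v t k0 x y z) contacts)) => [/has_In [t ht dt]|nd]; last first.
  exists k0, (px i), (py k0 j), (pz k0 i j m); split; first by left; split=> //; exists i, j, m.
  rewrite eX eY eZ occE /tile_cell zN hs nd.
  by have -> : (k0 == 2) = false by lia.
have [/and3P [/eqP ek /eqP ex /andP [y1 y2]] hd hr] := and3P dt.
have [_ _ fx fy] := contact_frames ht.
have dM : z %/ 3 < M by move: zN; rewrite /height; lia.
case: (boolp.pselect (exists m', (pz k0 i j m + Posz (3 * (z %/ 3)) = pz 0 (bump_i t i) (bump_j t j) m')%R)).
  move=> [m' em]; exists 0, (px (bump_i t i)), (py 0 (bump_j t j)), (pz 0 (bump_i t i) (bump_j t j) m').
  split; first by left; split=> //; exists (bump_i t i), (bump_j t j), m'.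
  have := bump_occ n h v ht hr; rewrite -(occE n h v 0 (px (bump_i t i)) (py 0 (bump_j t j)) (pz 0 (bump_i t i) (bump_j t j) m')).
  rewrite -em; congr occ.
  - by rewrite eX ex /px /bump_i; lia.
  - have y0 : yoff 0 = 2 by [].
    by rewrite eY /py -ek /bump_j y0; lia.
  by rewrite eZ; lia.
move=> nb; exists 2, (px i + Posz (qx t))%R, (py k0 j + Posz (qy t))%R, (pz k0 i j m + Posz (3 * (z %/ 3)))%R.
split.
  right; split=> //; exists t, i, j, m, (z %/ 3); rewrite ek; split=> //.
  by move=> m' e; apply: nb; exists m'.
have -> : X = (px i + Posz (qx t) + Posz 0)%R by rewrite eX ex; lia.
have -> : Y = (py k0 j + Posz (qy t) + Posz (y - qy t))%R by rewrite eY; lia.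
have -> : Z = (pz k0 i j m + Posz (3 * (z %/ 3)) + Posz (z %% 3))%R by rewrite eZ; lia.
by rewrite occE /tile_cell.
Qed.

End Cell.

Lemma placed_tiling : tiling n h v placed.
Proof.
split.
- by move=> k A B C [[k2 _]|[-> _]] //; exact: ltnW.
- move=> X Y Z; have [k [i [j [x [y [k2 s eX eY]]]]]] := nominal_exists X Y.
  have [m [z [zN eZ]]] := height_exists k i j Z.
  exact: (cell_placed k2 s eX eY zN eZ).
move=> k A B C k' A' B' C' X Y Z p p' o o'.
have [k0 [i [j [x [y [k2 s eX eY]]]]]] := nominal_exists X Y.
have [m [z [zN eZ]]] := height_exists k0 i j Z.
exact: (owner_unique (placed_owner k2 s eX eY zN eZ p o) (placed_owner k2 s eX eY zN eZ p' o')).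
Qed.

End TilingComplete.

(** * Computability of the reduction *)

(** Total computability on lists of length [k]. Predicates are included through [nat_of_bool], which
    is why that coercion is written out below. *)
Definition prf (k : nat) (f : seq nat -> nat) : Prop :=
  exists p, forall s, size s = k -> eval p s (f s).

Lemma prf_ext k f g : prf k f -> (forall s, size s = k -> f s = g s) -> prf k g.
Proof. by move=> [p hp] h; exists p => s sk; rewrite -h //; apply: hp. Qed.

Fixpoint const_prog c : recfun := if c is c'.+1 then RComp RSucc [:: const_prog c'] else RZero.

Lemma prf_const k c : prf k (fun=> c).
Proof.
exists (const_prog c) => s _; elim: c => [|c IH]; first exact: eval_zero.
by apply: (@eval_comp _ _ _ [:: c]); [apply: evals_cons => //; exact: evals_nil|exact: eval_succ].
Qed.

Lemma prf_nth k i : i < k -> prf k (fun s => nth 0 s i).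
Proof. by move=> ik; exists (RProj i) => s sk; apply: eval_proj; rewrite sk. Qed.

Lemma prf_comp k m f (gs : seq (seq nat -> nat)) : prf m f -> size gs = m ->
  (forall i, i < m -> prf k (nth (fun=> 0) gs i)) -> prf k (fun s => f [seq g s | g <- gs]).
Proof.
move=> [p hp] sz hg.
have [ps hps] : exists ps, forall s, size s = k -> evals ps s [seq g s | g <- gs].
  elim: gs m hg sz {hp} => [|g gs IH] m hg sz; first by exists [::] => s _; exact: evals_nil.
  have [q hq] := hg 0 ltac:(by rewrite -sz).
  have [ps hps] := IH (size gs) (fun i hi => hg i.+1 ltac:(by rewrite -sz)) erefl.
  by exists (q :: ps) => s sk; apply: evals_cons; [exact: hq|exact: hps].
exists (RComp p ps) => s sk; apply: eval_comp (hps s sk) _.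
by apply: hp; rewrite size_map.
Qed.

Lemma prf_comp1 k (op : nat -> nat) f :
  prf 1 (fun s => op (nth 0 s 0)) -> prf k f -> prf k (fun s => op (f s)).
Proof. by move=> ho hf; apply: (@prf_comp k 1 _ [:: f] ho) => // -[|//]. Qed.

Lemma prf_comp2 k (op : nat -> nat -> nat) f g :
  prf 2 (fun s => op (nth 0 s 0) (nth 0 s 1)) -> prf k f -> prf k g ->
  prf k (fun s => op (f s) (g s)).
Proof.
move=> ho hf hg; apply: (@prf_comp k 2 _ [:: f; g] ho) => // i.
by case: i => [|[|//]].
Qed.

Lemma prf_comp3 k (op : nat -> nat -> nat -> nat) f g h :
  prf 3 (fun s => op (nth 0 s 0) (nth 0 s 1) (nth 0 s 2)) -> prf k f -> prf k g -> prf k h ->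
  prf k (fun s => op (f s) (g s) (h s)).
Proof.
move=> ho hf hg hh; apply: (@prf_comp k 3 _ [:: f; g; h] ho) => // i.
by case: i => [|[|[|//]]].
Qed.

Lemma prf_comp5 k (op : nat -> nat -> nat -> nat -> nat -> nat) f g h l q :
  prf 5 (fun s => op (nth 0 s 0) (nth 0 s 1) (nth 0 s 2) (nth 0 s 3) (nth 0 s 4)) ->
  prf k f -> prf k g -> prf k h -> prf k l -> prf k q ->
  prf k (fun s => op (f s) (g s) (h s) (l s) (q s)).
Proof.
move=> ho hf hg hh hl hq; apply: (@prf_comp k 5 _ [:: f; g; h; l; q] ho) => // i.
by case: i => [|[|[|[|[|//]]]]].
Qed.

Lemma map_nth_iota (s : seq nat) m : [seq nth 0 s i | i <- iota m (size s - m)] = drop m s.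
Proof.
apply: (@eq_from_nth _ 0) => [|i]; first by rewrite size_map size_iota size_drop.
rewrite size_map size_iota => hi.
by rewrite (nth_map 0) ?size_iota // nth_iota // nth_drop.
Qed.

(* Substitution of [u] for the first argument, forgetting [d] others. *)
Lemma prf_subst k d f u : prf k.+1 f -> prf (d + k) u ->
  prf (d + k) (fun s => f (u s :: drop d s)).
Proof.
move=> hf hu.
have := @prf_comp (d + k) k.+1 f (u :: [seq (fun s => nth 0 s i) | i <- iota d k]) hf.
rewrite /= size_map size_iota => /(_ erefl) h.
apply: prf_ext (h _) _ => [[//|i] hi|s sk] /=.
  rewrite (nth_map 0) ?size_iota // nth_iota //; apply: prf_nth; lia.
congr (f (_ :: _)); rewrite -map_comp -map_nth_iota sk addKn.
by apply: eq_map.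
Qed.

Lemma prf_behead k f : prf k f -> prf k.+1 (fun s => f (behead s)).
Proof.
move=> hf.
have := @prf_comp k.+1 k f [seq (fun s => nth 0 s i) | i <- iota 1 k] hf.
rewrite size_map size_iota => /(_ erefl) h.
apply: prf_ext (h _) _ => [i hi|s sk].
  rewrite (nth_map 0) ?size_iota // nth_iota //; apply: prf_nth; lia.
congr f; rewrite -map_comp -drop1 -map_nth_iota sk subn1.
by apply: eq_map.
Qed.

Lemma prf_loop k cnt init body : prf k cnt -> prf k init -> prf k.+2 body ->
  prf k (fun s => nat_rect (fun=> nat) (init s) (fun i r => body (i :: r :: s)) (cnt s)).
Proof.
move=> hc [pi hi] [pb hb].
have hr : prf k.+1 (fun s => nat_rect (fun=> nat) (init (behead s))
    (fun i r => body (i :: r :: behead s)) (nth 0 s 0)).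
  exists (RPrim pi pb) => -[//|c s] [sk] /=.
  elim: c => [|c IH] /=; first by apply: eval_prim0; exact: hi.
  by apply: eval_primS IH _; apply: hb; rewrite /= sk.
have := @prf_subst k 0 _ _ hr hc.
by move=> h; apply: prf_ext h _ => s _; rewrite drop0.
Qed.

Lemma prf_succ k f : prf k f -> prf k (fun s => (f s).+1).
Proof.
apply: prf_comp1; exists RSucc => -[//|x s] _; exact: eval_succ.
Qed.

Lemma prf_add k f g : prf k f -> prf k g -> prf k (fun s => f s + g s).
Proof.
apply: prf_comp2.
apply: prf_ext (prf_loop (@prf_nth 2 0 isT) (@prf_nth 2 1 isT) (prf_succ (@prf_nth 4 1 isT))) _ => s _.
by elim: (nth 0 s 0) => //= n ->.
Qed.

Lemma prf_mul k f g : prf k f -> prf k g -> prf k (fun s => f s * g s).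
Proof.
apply: prf_comp2.
apply: prf_ext (prf_loop (@prf_nth 2 0 isT) (prf_const 2 0)
  (prf_add (@prf_nth 4 3 isT) (@prf_nth 4 1 isT))) _ => s _.
by elim: (nth 0 s 0) => //= n ->; rewrite mulSn.
Qed.

Lemma prf_pred k f : prf k f -> prf k (fun s => (f s).-1).
Proof.
apply: (@prf_comp1 _ (fun n => n.-1)).
apply: prf_ext (prf_loop (@prf_nth 1 0 isT) (prf_const 1 0) (@prf_nth 3 0 isT)) _ => s _.
by case: (nth 0 s 0).
Qed.

Lemma prf_sub k f g : prf k f -> prf k g -> prf k (fun s => f s - g s).
Proof.
apply: prf_comp2.
apply: prf_ext (prf_loop (@prf_nth 2 1 isT) (@prf_nth 2 0 isT) (prf_pred (@prf_nth 4 1 isT))) _ => s _.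
by elim: (nth 0 s 1) => [|n /= ->]; rewrite ?subn0 ?subnS.
Qed.

Lemma prf_exp k f g : prf k f -> prf k g -> prf k (fun s => f s ^ g s).
Proof.
apply: prf_comp2.
apply: prf_ext (prf_loop (@prf_nth 2 1 isT) (prf_const 2 1)
  (prf_mul (@prf_nth 4 2 isT) (@prf_nth 4 1 isT))) _ => s _.
by elim: (nth 0 s 1) => [|n /= ->]; rewrite ?expn0 ?expnS.
Qed.

Lemma prf_leq k f g : prf k f -> prf k g -> prf k (fun s => nat_of_bool (f s <= g s)).
Proof.
move=> hf hg; apply: prf_ext (prf_sub (prf_const k 1) (prf_sub hf hg)) _ => s _.
by rewrite /leq; case: (f s - g s) => // n; rewrite subSS sub0n.
Qed.

Lemma prf_and k (f g : seq nat -> bool) : prf k f -> prf k g -> prf k (fun s => nat_of_bool (f s && g s)).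
Proof. by move=> hf hg; apply: prf_ext (prf_mul hf hg) _ => s _; case: (f s); case: (g s). Qed.

Lemma prf_neg k (f : seq nat -> bool) : prf k f -> prf k (fun s => nat_of_bool (~~ f s)).
Proof. by move=> hf; apply: prf_ext (prf_sub (prf_const k 1) hf) _ => s _; case: (f s). Qed.

Lemma prf_or k (f g : seq nat -> bool) : prf k f -> prf k g -> prf k (fun s => nat_of_bool (f s || g s)).
Proof.
move=> hf hg; apply: prf_ext (prf_neg (prf_and (prf_neg hf) (prf_neg hg))) _ => s _.
by case: (f s); case: (g s).
Qed.

Lemma prf_imp k (f g : seq nat -> bool) : prf k f -> prf k g -> prf k (fun s => nat_of_bool (f s ==> g s)).
Proof.
move=> hf hg; apply: prf_ext (prf_or (prf_neg hf) hg) _ => s _.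
by case: (f s); case: (g s).
Qed.

Lemma prf_eq k f g : prf k f -> prf k g -> prf k (fun s => nat_of_bool (f s == g s)).
Proof.
move=> hf hg; apply: prf_ext (prf_and (prf_leq hf hg) (prf_leq hg hf)) _ => s _.
by rewrite eqn_leq.
Qed.

Lemma prf_if k (b : seq nat -> bool) f g : prf k b -> prf k f -> prf k g ->
  prf k (fun s => if b s then f s else g s).
Proof.
move=> hb hf hg; apply: prf_ext (prf_add (prf_mul hb hf) (prf_mul (prf_neg hb) hg)) _ => s _.
by case: (b s); rewrite /= ?mul1n ?mul0n ?addn0.
Qed.

Lemma prf_ifb k (b : seq nat -> bool) (f g : seq nat -> bool) : prf k b -> prf k f -> prf k g ->
  prf k (fun s => nat_of_bool (if b s then f s else g s)).
Proof.
move=> hb hf hg; apply: prf_ext (prf_if hb hf hg) _ => s _.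
by case: (b s).
Qed.

Lemma sum_lt m q : q <= m -> nat_rect (fun=> nat) 0 (fun i r => r + (i < q)) m = q.
Proof.
move=> qm; suff h i : nat_rect (fun=> nat) 0 (fun i r => r + (i < q)) i = minn i q by rewrite h; lia.
elim: i => [|i /= ->]; first by rewrite min0n.
by case: (ltnP i q) => h /=; lia.
Qed.

(** The quotient of m by d counts the i < m with (i + 1) * d at most m; the factor testing that d is
    positive makes division by 0 return 0. *)
Lemma prf_div k f g : prf k f -> prf k g -> prf k (fun s => f s %/ g s).
Proof.
apply: prf_comp2.
have hb : prf 4 (fun s => nth 0 s 1 + ((nth 0 s 0).+1 * nth 0 s 3 <= nth 0 s 2)).
  by apply: prf_add; [exact: prf_nth|apply: prf_leq; [apply: prf_mul; [apply: prf_succ|]|]; exact: prf_nth].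
have h0 : prf 2 (fun s => nat_of_bool (1 <= nth 0 s 1)) by apply: prf_leq; [exact: prf_const|exact: prf_nth].
apply: prf_ext (prf_mul h0 (prf_loop (@prf_nth 2 0 isT) (prf_const 2 0) hb)) _ => s _ /=.
move: (nth 0 s 0) (nth 0 s 1) => m [|d]; first by rewrite divn0.
rewrite mul1n -[RHS](@sum_lt m) ?leq_div //.
by congr nat_rect; apply: boolp.funext => i; apply: boolp.funext => r; rewrite leq_divRL.
Qed.

Lemma prf_mod k f g : prf k f -> prf k g -> prf k (fun s => f s %% g s).
Proof.
move=> hf hg; apply: prf_ext (prf_sub hf (prf_mul (prf_div hf hg) hg)) _ => s _.
by rewrite {1}(divn_eq (f s) (g s)) addKn.
Qed.

Lemma prf_odd k f : prf k f -> prf k (fun s => nat_of_bool (odd (f s))).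
Proof.
move=> hf; apply: prf_ext (prf_mod hf (prf_const k 2)) _ => s _.
by rewrite modn2.
Qed.

Lemma prf_dvd k f g : prf k f -> prf k g -> prf k (fun s => nat_of_bool (f s %| g s)).
Proof. by move=> hf hg; apply: prf_eq; [exact: prf_mod|exact: prf_const]. Qed.

Lemma prf_minn k f g : prf k f -> prf k g -> prf k (fun s => minn (f s) (g s)).
Proof.
move=> hf hg; apply: prf_ext (prf_if (prf_leq hf hg) hf hg) _ => s _.
by case: leqP.
Qed.

Lemma prf_has k B (F : nat -> seq nat -> bool) : prf k B ->
  prf k.+1 (fun s => nat_of_bool (F (nth 0 s 0) (behead s))) ->
  prf k (fun s => nat_of_bool (has (fun u => F u s) (iota 0 (B s)))).
Proof.
move=> hB hF.
have hb : prf k.+2 (fun s => nat_of_bool (0 < nth 0 s 1 + F (nth 0 s 0) (drop 2 s))).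
  apply: prf_leq; [exact: prf_const|apply: prf_add; first exact: prf_nth].
  have := @prf_subst k 2 _ _ hF (@prf_nth (2 + k) 0 isT).
  by move=> h; apply: prf_ext h _.
apply: prf_ext (prf_loop hB (prf_const k 0) hb) _ => s _ /=.
elim: (B s) => // n IH; have -> : iota 0 n.+1 = iota 0 n ++ [:: n] by rewrite -addn1 iotaD.
rewrite has_cat /= IH orbF drop0.
by case: (has _ _) => //=; case: (F n s).
Qed.

(** A code grows at the head of its list, so the loop treats the candidates [w] in decreasing order,
    from B - 1 down to 0. *)
Lemma prf_code_filter k B (chi : nat -> seq nat -> bool) (F : nat -> seq nat -> nat) : prf k B ->
  prf k.+1 (fun s => nat_of_bool (chi (nth 0 s 0) (behead s))) ->
  prf k.+1 (fun s => F (nth 0 s 0) (behead s)) ->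
  prf k (fun s => CodeSeq.code [seq F w s | w <- iota 0 (B s) & chi w s]).
Proof.
move=> hB hchi hF.
pose u s := B (drop 2 s) - (nth 0 s 0).+1.
have hu : prf (2 + k) u.
  apply: prf_sub; last by apply: prf_succ; exact: prf_nth.
  by apply: prf_ext (prf_behead (prf_behead hB)) _ => s _; rewrite -!drop1 drop_drop.
pose G s := if chi (u s) (drop 2 s) then 2 ^ F (u s) (drop 2 s) * (nth 0 s 1 * 2).+1 else nth 0 s 1.
have hG : prf k.+2 G.
  apply: prf_if; last exact: prf_nth.
    exact: prf_ext (@prf_subst k 2 _ _ hchi hu) _.
  apply: prf_mul; [apply: prf_exp; first exact: prf_const|].
    exact: prf_ext (@prf_subst k 2 _ _ hF hu) _.
  by apply: prf_succ; apply: prf_mul; [exact: prf_nth|exact: prf_const].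
apply: prf_ext (prf_loop hB (prf_const k 0) hG) _ => s _.
suff h i : i <= B s -> nat_rect (fun=> nat) 0 (fun i r => G (i :: r :: s)) i =
    CodeSeq.code [seq F w s | w <- iota (B s - i) i & chi w s].
  by rewrite h // subnn.
elim: i => [//|i IH] hi /=; rewrite IH ?(ltnW hi) // /G /u /= drop0.
have -> : (B s - i) = (B s - i.+1).+1 by lia.
by case: ifP => //= _; rewrite muln2.
Qed.

Ltac prf_base := lazymatch goal with
  | |- prf _ (fun _ => ?c) => exact: prf_const
  | |- prf _ (fun s => nth 0 s ?i) => exact: prf_nth
  | |- prf _ (fun s => nth 0 (behead s) ?i) => refine (@prf_behead _ (fun s => nth 0 s i) _)
  | |- prf _ (fun s => nth 0 (behead (behead s)) ?i) => refine (@prf_behead _ (fun s => nth 0 (behead s) i) _)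
  | |- prf _ (fun s => nth 0 (behead (behead (behead s))) ?i) =>
      refine (@prf_behead _ (fun s => nth 0 (behead (behead s)) i) _)
  | |- prf _ (fun s => (@?f s).+1) => apply: (@prf_succ _ f)
  | |- prf _ (fun s => (@?f s) + (@?g s)) => apply: (@prf_add _ f g)
  | |- prf _ (fun s => (@?f s) * (@?g s)) => apply: (@prf_mul _ f g)
  | |- prf _ (fun s => (@?f s) - (@?g s)) => apply: (@prf_sub _ f g)
  | |- prf _ (fun s => (@?f s) ^ (@?g s)) => apply: (@prf_exp _ f g)
  | |- prf _ (fun s => (@?f s) %/ (@?g s)) => apply: (@prf_div _ f g)
  | |- prf _ (fun s => (@?f s) %% (@?g s)) => apply: (@prf_mod _ f g)
  | |- prf _ (fun s => minn (@?f s) (@?g s)) => apply: (@prf_minn _ f g)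
  | |- prf _ (fun s => nat_of_bool ((@?f s) && (@?g s))) => apply: (@prf_and _ f g)
  | |- prf _ (fun s => nat_of_bool ((@?f s) || (@?g s))) => apply: (@prf_or _ f g)
  | |- prf _ (fun s => nat_of_bool ((@?f s) ==> (@?g s))) => apply: (@prf_imp _ f g)
  | |- prf _ (fun s => nat_of_bool (~~ (@?f s))) => apply: (@prf_neg _ f)
  | |- prf _ (fun s => nat_of_bool (odd (@?f s))) => apply: (@prf_odd _ f)
  | |- prf _ (fun s => nat_of_bool ((@?f s) %| (@?g s))) => apply: (@prf_dvd _ f g)
  | |- prf _ (fun s => nat_of_bool ((@?f s) <= (@?g s))) => apply: (@prf_leq _ f g)
  | |- prf _ (fun s => nat_of_bool ((@?f s) == (@?g s))) => apply: (@prf_eq _ f g)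
  | |- prf _ (fun s => nat_of_bool (if _ then _ else _)) => apply: prf_ifb
  | |- prf _ (fun s => if _ then _ else _) => apply: prf_if
  end.

Ltac prf_auto := repeat prf_base.

Lemma prf_digit k e s j : prf k e -> prf k s -> prf k j -> prf k (fun x => digit (e x) (s x) (j x)).
Proof. by apply: prf_comp3; rewrite /digit /radix; prf_auto. Qed.

Lemma prf_level k p z : prf k z -> prf k (fun x => level p (z x)).
Proof. by apply: (@prf_comp1 _ (fun z => level p z)); rewrite /level; prf_auto. Qed.

Lemma prf_skipped k t : prf k t -> prf k (fun x => nat_of_bool (skipped (t x))).
Proof. by apply: (@prf_comp1 _ (fun t => nat_of_bool (skipped t))); rewrite /skipped; prf_auto. Qed.

Lemma prf_flip k t : prf k t -> prf k (fun x => flip (t x)).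
Proof. by apply: prf_comp1; rewrite /flip; prf_auto. Qed.

Lemma prf_cmp_code k a b : prf k a -> prf k b -> prf k (fun x => cmp_code (a x) (b x)).
Proof. by apply: prf_comp2; rewrite /cmp_code; prf_auto. Qed.

Lemma prf_phase_code k p f : prf k f -> prf k (fun x => phase_code p (f x)).
Proof. by apply: (@prf_comp1 _ (fun z => phase_code p z)); rewrite /phase_code; prf_auto. Qed.

Ltac prf_rule := first [prf_base | lazymatch goal with
  | |- prf _ (fun s => digit _ _ _) => apply: prf_digit
  | |- prf _ (fun s => level _ _) => apply: prf_level
  | |- prf _ (fun s => flip _) => apply: prf_flip
  | |- prf _ (fun s => cmp_code _ _) => apply: prf_cmp_code
  | |- prf _ (fun s => phase_code _ _) => apply: prf_phase_code
  | |- prf _ (fun s => nat_of_bool (skipped _)) => apply: prf_skipped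
  end].

Lemma prf_half_rule k p zl zc gc t f : prf k zl -> prf k zc -> prf k gc -> prf k t -> prf k f ->
  prf k (fun x => nat_of_bool (half_rule p (zl x) (zc x) (gc x) (t x) (f x))).
Proof.
apply: (@prf_comp5 _ (fun a b c d e => nat_of_bool (half_rule p a b c d e))).
by rewrite /half_rule; repeat prf_rule.
Qed.

Lemma prf_allowed k e (a b c : seq nat -> bool) u0 u1 u2 : prf k e -> prf k a -> prf k b ->
  prf k c -> prf k u0 -> prf k u1 -> prf k u2 ->
  prf k (fun x => nat_of_bool (allowed (e x) (a x) (b x) (c x) (u0 x) (u1 x) (u2 x))).
Proof.
move=> he ha hb hc h0 h1 h2.
have hcode x (s : seq nat) : CodeSeq.code (x :: s) = 2 ^ x * (CodeSeq.code s * 2).+1.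
  by rewrite /= muln2.
have pc : prf k (fun x => CodeSeq.code [:: a x + b x * 2 + c x * 4; u0 x; u1 x; u2 x]).
  have := @prf_ext k (fun x => 2 ^ (a x + b x * 2 + c x * 4) * ((2 ^ u0 x * ((2 ^ u1 x * ((2 ^ u2 x *
    (0 * 2).+1) * 2).+1) * 2).+1) * 2).+1).
  apply=> [|x _]; last by rewrite !hcode.
  by repeat first [assumption | prf_base].
rewrite /allowed /testbit; apply: (@prf_odd _ (fun x => e x %/ _)).
by apply: prf_div => //; apply: prf_exp => //; exact: prf_const.
Qed.

Lemma prf_cell_ok k e s : prf k e -> prf k s ->
  prf k (fun x => nat_of_bool (cell_ok (e x) (digit (e x) (s x)))).
Proof.
apply: (@prf_comp2 _ (fun e s => nat_of_bool (cell_ok e (digit e s)))).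
rewrite /cell_ok /ruler_cell /label_cell /row_cell.
repeat first [prf_rule | lazymatch goal with
  | |- prf _ (fun s => nat_of_bool (half_rule _ _ _ _ _ _)) => apply: prf_half_rule
  | |- prf _ (fun s => nat_of_bool (allowed _ _ _ _ _ _ _)) => apply: prf_allowed end].
Qed.

Lemma prf_hrel k e s s' : prf k e -> prf k s -> prf k s' ->
  prf k (fun x => nat_of_bool (hrel (e x) (s x) (s' x))).
Proof.
apply: (@prf_comp3 _ (fun e s s' => nat_of_bool (hrel e s s'))).
rewrite /hrel /right_ok /ruler_right.
repeat first [prf_rule | lazymatch goal with
  | |- prf _ (fun s => nat_of_bool (cell_ok _ _)) => apply: prf_cell_ok end].
Qed.

Lemma prf_vrel k e s s' : prf k e -> prf k s -> prf k s' ->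
  prf k (fun x => nat_of_bool (vrel (e x) (s x) (s' x))).
Proof.
apply: (@prf_comp3 _ (fun e s s' => nat_of_bool (vrel e s s'))).
rewrite /vrel /up_ok /ruler_up.
repeat first [prf_rule | lazymatch goal with
  | |- prf _ (fun s => nat_of_bool (cell_ok _ _)) => apply: prf_cell_ok end].
Qed.

Lemma prf_nsym k e : prf k e -> prf k (fun x => nsym (e x)).
Proof. by apply: prf_comp1; rewrite /nsym /radix; prf_auto. Qed.

Lemma prf_modulus k n : prf k n -> prf k (fun x => modulus (n x)).
Proof. by apply: prf_comp1; rewrite /modulus; prf_auto. Qed.

Lemma prf_height k e : prf k e -> prf k (fun x => height (nsym (e x))).
Proof. by move=> h; rewrite /height; prf_auto; apply: prf_modulus; exact: prf_nsym. Qed.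

Lemma prf_difference_set k e (r : nat -> nat -> nat -> bool) m :
  prf 3 (fun x => nat_of_bool (r (nth 0 x 0) (nth 0 x 1) (nth 0 x 2))) ->
  prf k e -> prf k m ->
  prf k (fun x => nat_of_bool (difference_set (nsym (e x)) (r (e x)) (m x))).
Proof.
move=> hr; apply: (@prf_comp2 _ (fun e m => nat_of_bool (difference_set (nsym e) (r e) m))).
rewrite /difference_set.
have hn i j : i < j -> prf j (fun x => nsym (nth 0 x i)) by move=> ij; apply: prf_nsym; exact: prf_nth.
apply: (@prf_has 2 (fun x => nsym (nth 0 x 0)) (fun u x => has (fun u' => r (nth 0 x 0) u u' &&
  (nth 0 x 1 == (2 ^ u + modulus (nsym (nth 0 x 0)) - 2 ^ u') %% modulus (nsym (nth 0 x 0))))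
   (iota 0 (nsym (nth 0 x 0))))); first exact: hn.
apply: (@prf_has 3 (fun x => nsym (nth 0 (behead x) 0)) (fun u' x => r (nth 0 (behead x) 0) (nth 0 x 0) u' &&
  (nth 0 (behead x) 1 == (2 ^ nth 0 x 0 + modulus (nsym (nth 0 (behead x) 0)) - 2 ^ u') %% modulus (nsym (nth 0 (behead x) 0))))).
  by apply: (@prf_behead 2 (fun x => nsym (nth 0 x 0))); exact: hn.
have e2 : prf 4 (fun x => nth 0 (behead (behead x)) 0) by prf_auto.
have e3 : prf 4 (fun x => nth 0 (behead x) 0) by prf_auto.
have e4 : prf 4 (fun x => nth 0 x 0) by prf_auto.
have eM : prf 4 (fun x => modulus (nsym (nth 0 (behead (behead x)) 0))).
  by apply: prf_modulus; apply: prf_nsym.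
apply: (@prf_and _ (fun x => r _ _ _)).
  exact: (@prf_comp3 _ (fun a b c => nat_of_bool (r a b c)) _ _ _ hr e2 e3 e4).
by repeat first [exact: eM | prf_base].
Qed.

(* [tile_at e k]: the encoder (0), the pillar (1), the ring (2) and a shifted copy
   of the ring (3) of the tile set of [e]. *)
Definition tile_at e k x y z : bool :=
  if k == 3 then (x == 1) && ring y z
  else tile_cell (nsym e) (hrel e) (vrel e) k x y z.

Lemma prf_dent_set k e ct m : prf k e -> prf k m ->
  prf k (fun x => nat_of_bool (dent_set (nsym (e x)) (hrel (e x)) (vrel (e x)) ct (m x))).
Proof.
move=> he hm; rewrite /dent_set; case: (ct == 0); last case: (ct == 1).
- by apply: prf_difference_set => //; apply: (@prf_hrel 3); exact: prf_nth.
- by apply: prf_difference_set => //; apply: (@prf_vrel 3); exact: prf_nth.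
apply: (@prf_comp2 _ (fun e m => nat_of_bool (has (fun u => m == 2 ^ u) (iota 0 (nsym e))))) he hm.
apply: (@prf_has 2 (fun x => nsym (nth 0 x 0)) (fun u x => nth 0 x 1 == 2 ^ u)).
  by apply: prf_nsym; exact: prf_nth.
by prf_auto.
Qed.

Lemma prf_ring k a b : prf k a -> prf k b -> prf k (fun x => nat_of_bool (ring (a x) (b x))).
Proof. by apply: (@prf_comp2 _ (fun a b => nat_of_bool (ring a b))); rewrite /ring; prf_auto. Qed.

Lemma prf_hasl k (A : Type) (l : seq A) (F : A -> seq nat -> bool) :
  (forall a, prf k (fun x => nat_of_bool (F a x))) ->
  prf k (fun x => nat_of_bool (has (fun a => F a x) l)).
Proof.
move=> h; elim: l => [|a l IH] /=; first exact: prf_const.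
exact: prf_or (h a) IH.
Qed.

Lemma prf_sec k j x y : prf k x -> prf k y -> prf k (fun s => nat_of_bool (sec j (x s) (y s))).
Proof.
apply: (@prf_comp2 _ (fun x y => nat_of_bool (sec j x y))).
by rewrite /sec; case: (j == 0); rewrite /sec_enc /sec_ref /inbox; prf_auto.
Qed.

Lemma prf_tile_at k j e x y z : prf k e -> prf k x -> prf k y -> prf k z ->
  prf k (fun s => nat_of_bool (tile_at (e s) j (x s) (y s) (z s))).
Proof.
move=> he hx hy hz; rewrite /tile_at /tile_cell.
case: (j == 3); last case: (j == 2).
- by apply: (@prf_and _ (fun s => x s == 1)); [prf_base; [|prf_base]|exact: prf_ring].
- by apply: (@prf_and _ (fun s => x s == 0)); [prf_base; [|prf_base]|exact: prf_ring].
have hh := prf_height he.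
prf_base; first by prf_base => //; exact: prf_succ.
prf_base.
  prf_base; first exact: prf_sec.
  prf_base; apply: prf_hasl => t; rewrite /dent_cell /in_dent /inbox.
  by repeat first [assumption | apply: prf_dent_set | apply: prf_ring | prf_base].
prf_base; first exact: prf_const.
apply: prf_hasl => t; rewrite /bump_cell /in_bump /inbox.
by repeat first [assumption | apply: prf_ring | prf_base].
Qed.

(** * The tiles as finite sets of lattice points *)

Definition vec (x y z : int) : 'rV[int]_3 := (\row_(i < 3) nth 0 [:: x; y; z] i)%R.

Lemma vec_ext (u v : 'rV[int]_3) :
  u 0%R 0%R = v 0%R 0%R -> u 0%R 1%R = v 0%R 1%R -> u 0%R 2%:R%R = v 0%R 2%:R%R -> u = v.
Proof.
move=> h0 h1 h2; apply/rowP => -[[|[|[|//]]] hi].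
- by have -> : Ordinal hi = 0%R by apply: val_inj.
- by have -> : Ordinal hi = 1%R by apply: val_inj.
by have -> : Ordinal hi = 2%:R%R by apply: val_inj.
Qed.

Lemma vec_surj (v : 'rV[int]_3) : v = vec (v 0%R 0%R) (v 0%R 1%R) (v 0%R 2%:R%R).
Proof. by apply: vec_ext; rewrite mxE. Qed.

Lemma vec_add x y z x' y' z' : (vec x y z + vec x' y' z')%R = vec (x + x')%R (y + y')%R (z + z')%R.
Proof. by apply: vec_ext; rewrite !mxE. Qed.

Lemma vec_inj x y z x' y' z' : vec x y z = vec x' y' z' -> [/\ x = x', y = y' & z = z'].
Proof.
move=> h; split.
- by have := congr1 (fun v : 'rV[int]_3 => v 0%R 0%R) h; rewrite !mxE.
- by have := congr1 (fun v : 'rV[int]_3 => v 0%R 1%R) h; rewrite !mxE.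
by have := congr1 (fun v : 'rV[int]_3 => v 0%R 2%:R%R) h; rewrite !mxE.
Qed.

Lemma delta0 : delta_mx 0%R 0%R = vec 1 0 0. Proof. by apply: vec_ext; rewrite !mxE. Qed.
Lemma delta1 : delta_mx 0%R 1%R = vec 0 1 0. Proof. by apply: vec_ext; rewrite !mxE. Qed.
Lemma delta2 : delta_mx 0%R 2%:R%R = vec 0 0 1. Proof. by apply: vec_ext; rewrite !mxE. Qed.

(** Numbering the points of the box reduces the listing of a tile to filtering an initial segment of
    the natural numbers; 700 = 25 * 28. *)
Definition box_point w : 'rV[int]_3 :=
  vec (Posz (w %% 25)) (Posz (w %/ 25 %% 28)) (Posz (w %/ 700)).

Definition tile_points e k : seq 'rV[int]_3 :=
  [seq box_point w | w <- iota 0 (700 * height (nsym e)) &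
     tile_at e k (w %% 25) (w %/ 25 %% 28) (w %/ 700)].

Definition tile_fset e k : {fset 'rV[int]_3} := [fset v in tile_points e k]%fset.

Definition tile_lists e := [seq tile_points e k | k <- iota 0 4].

Definition tile_set e : {fset {fset 'rV[int]_3}} :=
  [fset P in [seq tile_fset e k | k <- iota 0 4]]%fset.

Lemma tile_at_box e k x y z : tile_at e k x y z -> [/\ x < 25, y < 28 & z < height (nsym e)].
Proof.
have M4 := modulus_gt0 (nsym e); rewrite /tile_at /tile_cell; case: (k == 3).
  by move=> /andP [/eqP -> /and3P [h1 h2 _]]; rewrite /height; split=> //; lia.
case: (k == 2).
  by move=> /andP [/eqP -> /and3P [h1 h2 _]]; rewrite /height; split=> //; lia.
move=> /andP [hz hc]; suff [h1 h2] : x < 25 /\ y < 28 by split.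
apply: (@shadow_box k); move: hc; rewrite /shadow => /orP [/andP [-> //]|/andP [-> hb]].
apply/orP; right; rewrite andTb; move: hb; apply: has_imp => t.
by rewrite /bump_cell => /andP [].
Qed.

Lemma box_decode x y z : x < 25 -> y < 28 ->
  [/\ (x + 25 * y + 700 * z) %% 25 = x, (x + 25 * y + 700 * z) %/ 25 %% 28 = y
    & (x + 25 * y + 700 * z) %/ 700 = z].
Proof. by move=> hx hy; split; lia. Qed.

Lemma tile_fsetP e k v : reflect (exists x y z : nat, v = vec x y z /\ tile_at e k x y z)
  (v \in tile_fset e k).
Proof.
apply: (iffP idP).
  rewrite !inE /= => /mapP [w]; rewrite mem_filter => /andP [hw _] ->.
  by do 3!eexists; split; [|exact: hw].
move=> [x [y [z [-> h]]]]; have [hx hy hz] := tile_at_box h.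
rewrite !inE /=; apply/mapP; exists (x + 25 * y + 700 * z).
  have [e1 e2 e3] := box_decode z hx hy.
  by rewrite mem_filter e1 e2 e3 h mem_iota; lia.
by have [e1 e2 e3] := box_decode z hx hy; rewrite /box_point e1 e2 e3.
Qed.

Lemma mem_tile e k (x y z : nat) : (vec x y z \in tile_fset e k) = tile_at e k x y z.
Proof.
apply/tile_fsetP/idP => [[x' [y' [z' [/vec_inj [[->] [->] [->]] //]]]]|h].
by exists x, y, z.
Qed.

Lemma tile_points_uniq e k : uniq (tile_points e k).
Proof.
rewrite map_inj_in_uniq ?filter_uniq ?iota_uniq // => w w' _ _ /vec_inj [[h1] [h2] [h3]].
lia.
Qed.

(** Largest [x] coordinate of each tile; the four values differ, and this tells the tiles apart. *)
Definition width k : nat := nth 0 [:: 24; 5; 0; 1] k.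

Lemma sol_tile_at e k x y z : k < 2 -> sol k x y -> z < height (nsym e) -> tile_at e k x y z.
Proof.
move=> k2 hs hz; rewrite /tile_at; have -> : (k == 3) = false by lia.
exact: sol_cell.
Qed.

Lemma tile_width e k x y z : k < 4 -> tile_at e k x y z -> x <= width k.
Proof.
case: k => [|[|[|[|//]]]] _ h; have [hx hy hz] := tile_at_box h.
- by rewrite /width /= -ltnS.
- have [hp _] : shadow 1 x y /\ z < height (nsym e) by apply: cell_shadow h.
  by move: hp; rewrite /shadow /= orbF /sec /= => /and3P [_ _]; rewrite /sec_ref /inbox /width /=; lia.
- by move: h; rewrite /tile_at /tile_cell /= => /andP [/eqP ->].
by move: h; rewrite /tile_at /= => /andP [/eqP ->].
Qed.

Lemma tile_extents e k : k < 4 ->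
  [/\ exists y z, tile_at e k (k == 3) y z, exists x z, tile_at e k x 0 z,
      exists x y, tile_at e k x y 0 & exists y z, tile_at e k (width k) y z].
Proof.
have M4 := modulus_gt0 (nsym e); have N0 : 0 < height (nsym e) by rewrite /height; lia.
case: k => [|[|[|[|//]]]] _.
- by split; [exists 16, 0|exists 13, 0|exists 12, 12|exists 11, 0]; apply: sol_tile_at.
- by split; [exists 0, 0|exists 0, 0|exists 0, 0|exists 10, 0]; apply: sol_tile_at.
- by split; [exists 0, 0|exists 0, 0|exists 0, 0|exists 0, 0].
by split; [exists 0, 0|exists 1, 0|exists 1, 0|exists 0, 0].
Qed.

Lemma tile_fset_inj e k k' : k < 4 -> k' < 4 -> tile_fset e k = tile_fset e k' -> k = k'.
Proof.
move=> hk hk' h.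
have wle a b : a < 4 -> b < 4 -> tile_fset e a = tile_fset e b -> width a <= width b.
  move=> ha hb hab; have [_ _ _ [y [z hw]]] := tile_extents e ha.
  apply: (tile_width hb (x := width a) (y := y) (z := z) (e := e)).
  by rewrite -mem_tile -hab mem_tile.
have : width k = width k' by apply/eqP; rewrite eqn_leq !wle.
by case: k k' hk hk' {h} => [|[|[|[|//]]]] [|[|[|[|//]]]].
Qed.

Lemma tile_set_card e : #|` tile_set e| = 4.
Proof.
rewrite /tile_set card_fseq undup_id ?size_map ?size_iota //.
rewrite map_inj_in_uniq ?iota_uniq // => k k'; rewrite !mem_iota => hk hk'.
exact: tile_fset_inj.
Qed.

Lemma tile_set_code e : tileset_code (tile_set e) (listing_code (tile_lists e)).
Proof.
exists (tile_lists e); split=> //.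
  by apply/allP => s /mapP [k _ ->]; exact: tile_points_uniq.
rewrite /tile_lists -map_comp; apply: uniq_perm; rewrite ?fset_uniq //.
  rewrite map_inj_in_uniq ?iota_uniq // => k k'; rewrite !mem_iota => hk hk'.
  exact: tile_fset_inj.
move=> P; rewrite (_ : (P \in enum_fset (tile_set e)) = (P \in tile_set e)) //.
by rewrite /tile_set !inE orbF.
Qed.

Lemma code_cons x (s : seq nat) : CodeSeq.code (x :: s) = 2 ^ x * (CodeSeq.code s * 2).+1.
Proof. by rewrite /= muln2. Qed.

Lemma prf_code_cons k a (s : seq nat -> seq nat) : prf k a ->
  prf k (fun x => CodeSeq.code (s x)) -> prf k (fun x => CodeSeq.code (a x :: s x)).
Proof.
move=> ha hs; have := @prf_ext k (fun x => 2 ^ a x * (CodeSeq.code (s x) * 2).+1).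
apply=> [|x _]; last by rewrite code_cons.
by repeat first [assumption | prf_base].
Qed.

Lemma prf_listing : prf 1 (fun s => listing_code (tile_lists (nth 0 s 0))).
Proof.
have pt k : prf 1 (fun s => CodeSeq.code [seq point_code v | v <- tile_points (nth 0 s 0) k]).
  (* Coordinates are nonnegative, and [int_code] doubles such integers. *)
  have hF : prf 2 (fun s => CodeSeq.code [:: nth 0 s 0 %% 25 * 2; nth 0 s 0 %/ 25 %% 28 * 2; nth 0 s 0 %/ 700 * 2]).
    by apply: prf_code_cons; [prf_auto|apply: prf_code_cons; [prf_auto|apply: prf_code_cons; prf_auto]].
  have hchi : prf 2 (fun s => nat_of_bool (tile_at (nth 0 (behead s) 0) k (nth 0 s 0 %% 25)
      (nth 0 s 0 %/ 25 %% 28) (nth 0 s 0 %/ 700))).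
    by apply: prf_tile_at; prf_auto.
  have hB : prf 1 (fun s => 700 * height (nsym (nth 0 s 0))).
    by prf_base; [prf_base|apply: prf_height; prf_base].
  have := @prf_code_filter 1 _ (fun w s => tile_at (nth 0 s 0) k (w %% 25) (w %/ 25 %% 28) (w %/ 700))
    (fun w s => CodeSeq.code [:: w %% 25 * 2; w %/ 25 %% 28 * 2; w %/ 700 * 2]) hB hchi hF.
  move=> hc; apply: prf_ext hc _ => s _; rewrite /tile_points -map_comp; congr CodeSeq.code.
  apply: eq_map => w /=; rewrite /point_code /= !enum_ordSl enum_ord0 /= /box_point !mxE /= !muln2.
  by [].
pose C k s := CodeSeq.code [seq point_code v | v <- tile_points (nth 0 s 0) k].
have h3 : prf 1 (fun s => CodeSeq.code [:: C 3 s]).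
  exact: (@prf_code_cons 1 (C 3) (fun=> [::]) (pt 3) (prf_const 1 0)).
have h2 := @prf_code_cons 1 (C 2) (fun s => [:: C 3 s]) (pt 2) h3.
have h1 := @prf_code_cons 1 (C 1) (fun s => [:: C 2 s; C 3 s]) (pt 1) h2.
exact: (@prf_code_cons 1 (C 0) (fun s => [:: C 1 s; C 2 s; C 3 s]) (pt 0) h1).
Qed.

Local Open Scope classical_set_scope.

Section Tileable.
Variable e : nat.
Notation occu := (occ (nsym e) (hrel e) (vrel e)).

Lemma translateP k (a b c : int) y : k < 3 ->
  translate (tile_fset e k) (vec a b c) y <-> occu k a b c (y 0%R 0%R) (y 0%R 1%R) (y 0%R 2%:R%R).
Proof.
move=> k3; have tE x' y' z' : tile_at e k x' y' z' = tile_cell (nsym e) (hrel e) (vrel e) k x' y' z'.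
  by rewrite /tile_at ltn_eqF.
split=> [[x /= /tile_fsetP [x' [y' [z' [-> h]]]] <-]|].
  rewrite vec_add !mxE /= ![(Posz _ + _)%R]GRing.addrC occE -tE.
  exact: h.
move=> /occP [x' [y' [z' [e1 e2 e3 h]]]]; exists (vec x' y' z').
  by apply/tile_fsetP; exists x', y', z'; rewrite tE.
by rewrite vec_add; apply: vec_ext; rewrite !mxE /= (e1, e2, e3) GRing.addrC.
Qed.

Lemma translate_ring_copy (a b c : int) :
  translate (tile_fset e 3) (vec a b c) = translate (tile_fset e 2) (vec (a + 1)%R b c).
Proof.
rewrite predeqE => y; split=> [[x /= /tile_fsetP [x' [y' [z' [-> h]]]] <-]|[x /= /tile_fsetP [x' [y' [z' [-> h]]]] <-]].
  move: h; rewrite /tile_at /= => /andP [/eqP -> hr]; exists (vec 0 y' z').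
    by apply/tile_fsetP; exists 0, y', z'; rewrite /tile_at /tile_cell.
  by rewrite !vec_add; congr vec; lia.
move: h; rewrite /tile_at /tile_cell /= => /andP [/eqP -> hr]; exists (vec 1 y' z').
  by apply/tile_fsetP; exists 1, y', z'; rewrite /tile_at.
by rewrite !vec_add; congr vec; lia.
Qed.

(** A set determines its least coordinates, which give the translation, and then its largest [x],
    which gives the kind. *)
Lemma translate_inj k k' a b c a' b' c' : k < 3 -> k' < 3 ->
  translate (tile_fset e k) (vec a b c) = translate (tile_fset e k') (vec a' b' c') ->
  [/\ k = k', a = a', b = b' & c = c'].
Proof.
move=> k3 k3' h.
have key k1 k2 a1 b1 c1 a2 b2 c2 : k1 < 3 -> k2 < 3 ->
    translate (tile_fset e k1) (vec a1 b1 c1) = translate (tile_fset e k2) (vec a2 b2 c2) ->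
    [/\ (a2 <= a1)%R, (b2 <= b1)%R, (c2 <= c1)%R & (a1 + Posz (width k1) <= a2 + Posz (width k2))%R].
  move=> k31 k32 h12; have [[y1 [z1 x0]] [x2 [z2 y0]] [x3 [y3 z0]] [y4 [z4 w0]]] :=
    tile_extents e (leqW k31).
  have tE x' y' z' : tile_at e k1 x' y' z' = tile_cell (nsym e) (hrel e) (vrel e) k1 x' y' z'.
    by rewrite /tile_at ltn_eqF.
  have tE2 x' y' z' : tile_at e k2 x' y' z' = tile_cell (nsym e) (hrel e) (vrel e) k2 x' y' z'.
    by rewrite /tile_at ltn_eqF.
  have tr (x y z : nat) : tile_at e k1 x y z -> exists x' y' z' : nat,
     [/\ (a1 + Posz x = a2 + Posz x')%R, (b1 + Posz y = b2 + Posz y')%R,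
         (c1 + Posz z = c2 + Posz z')%R & tile_at e k2 x' y' z'].
    rewrite tE -(occE _ _ _ k1 a1 b1 c1) => o.
    have : translate (tile_fset e k1) (vec a1 b1 c1) (vec (a1 + Posz x)%R (b1 + Posz y)%R (c1 + Posz z)%R).
      by apply/translateP; rewrite // !mxE.
    rewrite h12 => /(translateP _ _ _ _ k32); rewrite !mxE /= => /occP [x' [y' [z' [h1 h2 h3 h4]]]].
    by exists x', y', z'; rewrite tE2.
  rewrite ltn_eqF // in x0.
  have [? [? [? [? _ _ _]]]] := tr _ _ _ x0.
  have [? [? [? [_ ? _ _]]]] := tr _ _ _ y0.
  have [? [? [? [_ _ ? _]]]] := tr _ _ _ z0.
  have [x' [? [? [? _ _ hw]]]] := tr _ _ _ w0.
  have := tile_width (leqW k32) hw.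
  by split; lia.
have [h1 h2 h3 h4] := key _ _ _ _ _ _ _ _ k3 k3' h.
have [h5 h6 h7 h8] := key _ _ _ _ _ _ _ _ k3' k3 (esym h).
have ew : width k = width k' by lia.
split; try lia.
by move: ew; case: k k3 {h h4 h8} => [|[|[|//]]] _; case: k' k3' => [|[|[|//]]].
Qed.

Lemma tileable_tiling : tileable (tile_set e) <->
  exists P, tiling (nsym e) (hrel e) (vrel e) P.
Proof.
split=> [[F [F1 F2 F3]]|[P [P1 P2 P3]]].
  exists (fun k a b c => k < 3 /\ F (translate (tile_fset e k) (vec a b c))); split.
  - by move=> k a b c [].
  - move=> X Y Z; have : (\bigcup_(A in F) A) (vec X Y Z) by rewrite F3.
    move=> [A FA Ay]; have [Q [v [hQ hA]]] := F1 A FA.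
    have [k [k3 [a [b [c hk]]]]] : exists k, k < 3 /\ exists a b c, A = translate (tile_fset e k) (vec a b c).
      move: hQ; rewrite !inE /= hA (vec_surj v).
      move=> /or4P [/eqP ->|/eqP ->|/eqP ->|/orP [/eqP ->|//]].
      + by exists 0; split=> //; do 3!eexists.
      + by exists 1; split=> //; do 3!eexists.
      + by exists 2; split=> //; do 3!eexists.
      by exists 2; split=> //; rewrite translate_ring_copy; do 3!eexists.
    exists k, a, b, c; split; first by rewrite -hk.
    by move: Ay; rewrite hk => /(translateP _ _ _ _ k3); rewrite !mxE.
  move=> k a b c k' a' b' c' X Y Z [k3 FA] [k3' FB] o o'.
  apply: translate_inj => //; apply: contrapT => ne.
  have := F2 _ _ FA FB ne; rewrite -subset0 => /(_ (vec X Y Z)); apply.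
  by split; apply/translateP; rewrite // !mxE.
exists [set A | exists k a b c, P k a b c /\ A = translate (tile_fset e k) (vec a b c)]; split.
- move=> A [k [a [b [c [hP ->]]]]]; exists (tile_fset e k), (vec a b c); split=> //.
  rewrite !inE /=; have := P1 _ _ _ _ hP.
  by case: k {hP} => [|[|[|//]]] _; rewrite eqxx ?orbT.
- move=> A B [k [a [b [c [hP ->]]]]] [k' [a' [b' [c' [hP' ->]]]]] ne.
  rewrite -subset0 => y [/(translateP _ _ _ _ (P1 _ _ _ _ hP)) o /(translateP _ _ _ _ (P1 _ _ _ _ hP')) o'].
  by have [e1 e2 e3 e4] := P3 _ _ _ _ _ _ _ _ _ _ _ hP hP' o o'; apply: ne; rewrite e1 e2 e3 e4.
rewrite -subTset => y _; have [k [a [b [c [hP o]]]]] := P2 (y 0%R 0%R) (y 0%R 1%R) (y 0%R 2%:R%R).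
exists (translate (tile_fset e k) (vec a b c)); first by exists k, a, b, c.
by apply/translateP => //; exact: P1 hP.
Qed.

End Tileable.

(** * Connectedness of the tiles *)

Section Linked.
Variable P : {fset 'rV[int]_3}.

Definition linked (x y : 'rV[int]_3) : Prop := exists s : seq 'rV[int]_3,
  [/\ all (fun z => z \in P) s, path (@adjacent 3) x s & last x s = y].

Lemma adjacent_sym (u v : 'rV[int]_3) : adjacent u v = adjacent v u.
Proof.
apply: eq_existsb => i; rewrite orbC; congr (_ || _).
  by rewrite eq_sym GRing.subr_eq.
by rewrite -GRing.subr_eq eq_sym.
Qed.

Lemma linked_refl x : linked x x. Proof. by exists [::]. Qed.

Lemma linked_trans y x z : linked x y -> linked y z -> linked x z.
Proof.
move=> [s [h1 h2 h3]] [s' [h1' h2' h3']]; exists (s ++ s'); split.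
- by rewrite all_cat h1.
- by rewrite cat_path h2 h3.
by rewrite last_cat h3.
Qed.

Lemma linked_sym x y : x \in P -> linked x y -> linked y x.
Proof.
move=> xP [s [h1 h2 h3]]; exists (rev (belast x s)); split.
- rewrite all_rev; apply/allP => z /mem_belast; rewrite inE => /orP [/eqP -> //|hz].
  exact: (allP h1).
- rewrite -h3 rev_path; rewrite (eq_path (e' := @adjacent 3)) // => u v; exact: adjacent_sym.
case: s h1 h2 h3 => [|w s] h1 h2 h3 /=; first by rewrite -h3.
by rewrite rev_cons last_rcons.
Qed.

Lemma linked_step x y : adjacent x y -> y \in P -> linked x y.
Proof. by move=> h yP; exists [:: y]; rewrite /= yP h. Qed.

End Linked.

Section Connected.
Variable e : nat.
Notation N := (height (nsym e)).
Notation T := (tile_fset e).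

Let link k (x y z x' y' z' : nat) := linked (T k) (vec x y z) (vec x' y' z').

Lemma adj_x (x y z : nat) : adjacent (vec x y z) (vec x.+1 y z).
Proof. by apply/existsP; exists 0%R; rewrite delta0 vec_add; apply/orP; left; apply/eqP; congr vec; lia. Qed.
Lemma adj_y (x y z : nat) : adjacent (vec x y z) (vec x y.+1 z).
Proof. by apply/existsP; exists 1%R; rewrite delta1 vec_add; apply/orP; left; apply/eqP; congr vec; lia. Qed.
Lemma adj_z (x y z : nat) : adjacent (vec x y z) (vec x y z.+1).
Proof. by apply/existsP; exists 2%:R%R; rewrite delta2 vec_add; apply/orP; left; apply/eqP; congr vec; lia. Qed.

Lemma link_step k (x y z x' y' z' : nat) : tile_at e k x' y' z' ->
  adjacent (vec x y z) (vec x' y' z') || adjacent (vec x' y' z') (vec x y z) -> link k x y z x' y' z'.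
Proof.
move=> hc /orP ha; apply: linked_step; last by rewrite mem_tile.
by case: ha => // ha; rewrite adjacent_sym.
Qed.

Definition flood_get (g : seq (seq bool)) x y : bool := nth false (nth [::] g x) y.

(** One round of a flood fill over the solid columns within a horizontal layer; these columns are
    the same in all layers. *)
Definition flood_step k (g : seq (seq bool)) : seq (seq bool) :=
  mkseq (fun x => mkseq (fun y =>
    if sol k x y then
      if flood_get g x y then true else if flood_get g x.+1 y then true
      else if flood_get g x y.+1 then true
      else if (0 < x) && flood_get g x.-1 y then true else (0 < y) && flood_get g x y.-1
    else false) 28) 25.

Definition flood_seed a b : seq (seq bool) :=
  mkseq (fun x => mkseq (fun y => (x == a) && (y == b)) 28) 25.

Lemma get_mkseq (f : nat -> nat -> bool) x y :
  flood_get (mkseq (fun x => mkseq (f x) 28) 25) x y -> f x y.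
Proof.
rewrite /flood_get; case: (ltnP x 25) => hx; last by rewrite [nth [::] _ _]nth_default ?size_mkseq // nth_nil.
rewrite (nth_mkseq [::]) //; case: (ltnP y 28) => hy; last by rewrite nth_default ?size_mkseq.
by rewrite nth_mkseq.
Qed.

Lemma flood_get_step k g x y : flood_get (flood_step k g) x y ->
  if sol k x y then
    if flood_get g x y then true else if flood_get g x.+1 y then true
    else if flood_get g x y.+1 then true
    else if (0 < x) && flood_get g x.-1 y then true else (0 < y) && flood_get g x y.-1
  else false.
Proof.
exact: (@get_mkseq (fun x y => if sol k x y then
  if flood_get g x y then true else if flood_get g x.+1 y then true
  else if flood_get g x y.+1 then true
  else if (0 < x) && flood_get g x.-1 y then true else (0 < y) && flood_get g x y.-1
  else false)).
Qed.

Lemma flood_sound k a b n x y z : k < 2 -> sol k a b -> z < N ->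
  flood_get (iter n (flood_step k) (flood_seed a b)) x y -> sol k x y /\ link k a b z x y z.
Proof.
move=> k2 hab zN; have cellz x' y' : sol k x' y' -> tile_at e k x' y' z by move=> h; apply: sol_tile_at.
elim: n x y => [|n IH] x y.
  by move=> /(@get_mkseq (fun x y => (x == a) && (y == b))) /andP [/eqP -> /eqP ->]; split=> //; exact: linked_refl.
rewrite iterS => /flood_get_step h0.
have hs : sol k x y by move: h0; case: ifP.
have next x' y' : flood_get (iter n (flood_step k) (flood_seed a b)) x' y' ->
    adjacent (vec x' y' z) (vec x y z) || adjacent (vec x y z) (vec x' y' z) ->
    sol k x y /\ link k a b z x y z.
  move=> /IH [_ h1] h2; split=> //; apply: linked_trans h1 _.
  by apply: link_step => //; exact: cellz.
move: h0; rewrite {1}hs; case: ifP => [/IH h _|_]; first exact: h.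
case: ifP => [h _|_]; first by apply: (next _ _ h); rewrite adj_x orbT.
case: ifP => [h _|_]; first by apply: (next _ _ h); rewrite adj_y orbT.
case: ifP => [/andP [x0 h] _|_].
  by apply: (next _ _ h); have := adj_x x.-1 y z; rewrite prednK // => ->.
by move=> /andP [y0 h]; apply: (next _ _ h); have := adj_y x y.-1 z; rewrite prednK // => ->.
Qed.

Definition flood_ok k a b : bool :=
  let g := iter 70 (flood_step k) (flood_seed a b) in
  allbox (fun x y => if sol k x y then flood_get g x y else true).

Lemma flood_enc : flood_ok 0 12 12. Proof. by vm_compute. Qed.
Lemma flood_ref : flood_ok 1 1 1. Proof. by vm_compute. Qed.

Definition attached k : bool := allbox (fun x y =>
  if shadow k x y then if sol k x y then true else if sol k x.+1 y then true
    else (0 < x) && sol k x.-1 y else true).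

Lemma attached_enc : attached 0. Proof. by vm_compute. Qed.
Lemma attached_ref : attached 1. Proof. by vm_compute. Qed.

(** The path climbs the solid column over (a,b), crosses the layer by the flood fill and, for a cell
    of a dent column or a bump, ends with one step in [x]. *)
Lemma link_base k a b (x y z : nat) : k < 2 -> sol k a b -> flood_ok k a b -> attached k ->
  tile_at e k x y z -> link k a b 0 x y z.
Proof.
move=> k2 hab hf ha hc; have [hx hy zN] := tile_at_box hc.
have up z' : z' < N -> link k a b 0 a b z'.
  elim: z' => [_|z' IH hz]; first exact: linked_refl.
  apply: linked_trans (IH (ltnW hz)) _.
  by apply: link_step; [exact: sol_tile_at|rewrite adj_z].
apply: linked_trans (up z zN) _.
have solcase x' y' : sol k x' y' -> link k a b z x' y' z.
  move=> hs; have [hx' hy'] : x' < 25 /\ y' < 28 by move: hs => /andP [/and3P []].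
  have := allboxP hf hx' hy'; rewrite hs => /(flood_sound k2 hab zN) [] //.
have hsh : shadow k x y.
  move: hc; rewrite /tile_at; have -> : (k == 3) = false by lia.
  by move=> /(cell_shadow k2) [].
have := allboxP ha hx hy; rewrite hsh; case: ifP => [/solcase //|_].
case: ifP => [hs _|_ /andP [x0 hs]].
  by apply: linked_trans (solcase _ _ hs) _; apply: link_step => //; rewrite adj_x orbT.
by apply: linked_trans (solcase _ _ hs) _; apply: link_step => //; have := adj_x x.-1 y z; rewrite prednK // => ->.
Qed.

Lemma connected_base k a b c : tile_at e k a b c ->
  (forall x y z : nat, tile_at e k x y z -> link k a b c x y z) -> polycube (T k).
Proof.
move=> hab h; split.
  by apply/fset0Pn; exists (vec a b c); rewrite mem_tile.
move=> u v /tile_fsetP [x [y [z [-> h1]]]] /tile_fsetP [x' [y' [z' [-> h2]]]].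
apply: (@linked_trans _ (vec a b c)); last exact: h.
by apply: linked_sym (h _ _ _ h1); rewrite mem_tile.
Qed.

Lemma ring_linked k (w : nat) : (forall y z, tile_at e k w y z = ring y z) ->
  (forall x y z, tile_at e k x y z -> x = w) -> polycube (T k).
Proof.
move=> hr hw; apply: (@connected_base k w 0 0); first by rewrite hr.
have sy y z y' z' : link k w 0 0 w y z -> ring y' z' ->
    [|| (y' == y.+1) && (z' == z), (y' == y) && (z' == z.+1),
        (y == y'.+1) && (z' == z) | (y' == y) && (z == z'.+1)] -> link k w 0 0 w y' z'.
  move=> h1 h2 h3; apply: linked_trans h1 _; apply: link_step; first by rewrite hr.
  case/or4P: h3 => /andP [/eqP -> /eqP ->]; by rewrite ?adj_y ?adj_z ?orbT.
have l00 : link k w 0 0 w 0 0 by exact: linked_refl.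
have l01 := sy 0 0 0 1 l00 isT isT; have l02 := sy 0 1 0 2 l01 isT isT.
have l10 := sy 0 0 1 0 l00 isT isT; have l20 := sy 1 0 2 0 l10 isT isT.
have l12 := sy 0 2 1 2 l02 isT isT; have l22 := sy 1 2 2 2 l12 isT isT.
have l21 := sy 2 0 2 1 l20 isT isT.
move=> x y z hc; have ex := hw _ _ _ hc; rewrite ex hr in hc *.
by case: y hc => [|[|[|y]]] hc; case: z hc => [|[|[|z]]] hc.
Qed.

Lemma tile_set_polycubes : four_polycubes (tile_set e).
Proof.
have M4 := modulus_gt0 (nsym e); have N0 : 0 < N by rewrite /height; lia.
split; first exact: tile_set_card.
move=> Q; rewrite !inE /= => /or4P [/eqP ->|/eqP ->|/eqP ->|/orP [/eqP ->|//]].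
- apply: (@connected_base 0 12 12 0); first exact: sol_tile_at.
  by move=> x y z; apply: link_base; [|exact: isT|exact: flood_enc|exact: attached_enc].
- apply: (@connected_base 1 1 1 0); first exact: sol_tile_at.
  by move=> x y z; apply: link_base; [|exact: isT|exact: flood_ref|exact: attached_ref].
- by apply: (@ring_linked 2 0) => [y z //|x y z]; rewrite /tile_at /tile_cell /= => /andP [/eqP].
by apply: (@ring_linked 3 1) => [y z //|x y z]; rewrite /tile_at /= => /andP [/eqP].
Qed.

End Connected.

Theorem theorem2 :
  undecidable_problem (@tileset_code 3) four_polycubes (@tileable 3).
Proof.
move=> [p hp]; have [q hq] := prf_listing.
(* The simulated program lists the tile set of its input and submits it to the decider; [e] is both
   its rule and its input, so the tile set of [e] is tileable exactly when the decider answers 0. *)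
have [e he] := quadrant_simulation (RComp p [:: q]).
have [b [ev hb]] := hp _ _ (tile_set_polycubes e) (tile_set_code e).
have {ev} /he : eval (RComp p [:: q]) [:: e] b.
  by apply: eval_comp ev; apply: evals_cons; [exact: (hq [:: e])|exact: evals_nil].
have -> : (exists l, labelling e l) <-> b.
  rewrite sft_labelling hb tileable_tiling; split=> [[c hc]|[P hP]].
    by eexists; exact: placed_tiling hc.
  exact: tiling_config (hrel_irrefl e) (vrel_irrefl e) _ hP.
by case: b {hb} => -[h h']; [have := h isT|have := h' erefl].
Qed.
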